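(* Let $\{S_i\}_{i=1}^m$ be an IFS satisfying the finite neighbour condition, with self-similar set $K$, and let $\mu$ be the self-similar measure associated with probabilities $(p_i)_{i=1}^m$. Let $\mathcal{L}$ be an irreducible, maximal loop class (of the transition graph) that is not simple. Then $$[\alpha_{\min}(\mathcal{L}),\alpha_{\max}(\mathcal{L})]=\{\dim_{\mathrm{loc}}\mu(x):x\in K_{\mathcal{L}},\ x\text{ interior}\}=\{\overline{\dim}_{\mathrm{loc}}\mu(x):x\in K_{\mathcal{L}},\ x\text{ interior}\},$$ where the middle set is taken over those $x$ for which the local dimension exists.
   Context: IFS. $\{S_i\}_{i=1}^m$ is a finite set of similarities $S_i(x)=r_ix+d_i$ of $\mathbb{R}$ with $0<|r_i|<1$. $K$ is the unique non-empty compact set with $K=\bigcup_iS_i(K)$; it is assumed not to be a singleton and to have convex hull $[0,1]$. Probabilities $p_i>0$, $\sum_ip_i=1$, are given, and $\mu$ is the unique Borel probability measure with $\mu(E)=\sum_ip_i\mu(S_i^{-1}(E))$ for Borel $E$; its support is $K$. For a word $\sigma=(\sigma_1,\ldots,\sigma_j)$ over $\{1,\ldots,m\}$ let $S_\sigma=S_{\sigma_1}\circ\cdots\circ S_{\sigma_j}$, $r_\sigma=r_{\sigma_1}\cdots r_{\sigma_j}$, $\sigma^-=(\sigma_1,\ldots,\sigma_{j-1})$; the empty word has $S_\emptyset=\mathrm{id}$, $r_\emptyset=1$. For $0<t\le1$, $\Lambda_t=\{\sigma:|r_\sigma|<t\le|r_{\sigma^-}|\}$; for $t>1$, $\Lambda_t=\{\emptyset\}$.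 Net intervals and neighbours. Let $h_1<\cdots<h_{s(t)}$ be the distinct elements of $\{S_\sigma(0),S_\sigma(1):\sigma\in\Lambda_t\}$. The net intervals of generation $t$ are the elements of $\mathcal{F}_t=\{[h_j,h_{j+1}]:(h_j,h_{j+1})\cap K\ne\emptyset\}$. For a net interval $\Delta$, $T_\Delta(x)=rx+a$, $r>0$, is the similarity with $T_\Delta([0,1])=\Delta$. A neighbour of $\Delta\in\mathcal{F}_t$ is a similarity $f=T_\Delta^{-1}\circ S_\sigma$ with $\sigma\in\Lambda_t$ and $S_\sigma(K)\cap\Delta^\circ\neq\emptyset$ ($\sigma$ is said to generate $f$); the neighbour set $\mathcal{V}_t(\Delta)$ (written $\mathcal{V}(\Delta)$ when the generation is understood) is the set of all distinct neighbours. The transition generation $\mathrm{tg}(\Delta)$ is the maximum of $|r_\sigma|$ over words $\sigma$ generating neighbours of $\Delta$. The children of $\Delta$ are the net intervals of generation $\mathrm{tg}(\Delta)$ contained in $\Delta$. For $\Delta=[a,b]$ with child $\Delta_1=[a_1,b_1]$, $q(\Delta,\Delta_1)=(a_1-a)/\mathrm{diam}(\Delta)$. Transition graph. $\mathcal{G}$ is the directed graph whose vertices are the distinct neighbour sets of net intervals, with an edge $e=(\mathcal{V}_t(\Delta),\mathcal{V}_{\mathrm{tg}(\Delta)}(\Delta_1),q(\Delta,\Delta_1))$ from $\mathcal{V}_t(\Delta)$ to $\mathcal{V}_{\mathrm{tg}(\Delta)}(\Delta_1)$ for each $\Delta\in\mathcal{F}_t$ and child $\Delta_1$ (well defined: children's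 data depend only on the neighbour set of the parent). The edge weight is $W(e)=\mathrm{tg}(\Delta_1)/\mathrm{tg}(\Delta)\in(0,1)$. Fix a total order on all neighbours. If $\mathcal{V}(\Delta)=\{f_1<\cdots<f_k\}$ and $\mathcal{V}(\Delta_1)=\{g_1<\cdots<g_n\}$, the transition matrix $T(e)$ is the $k\times n$ matrix with $T(e)_{i,j}=p_\ell$ if there are a word $\sigma$ and a letter $\ell$ such that $\sigma$ generates $f_i$ and $\sigma\ell$ generates $g_j$; $T(e)_{i,j}=1$ if a single word $\sigma$ generates both $f_i$ and $g_j$; and $T(e)_{i,j}=0$ otherwise. For $\eta=(e_1,\ldots,e_n)$, $W(\eta)=\prod W(e_i)$, $T(\eta)=T(e_1)\cdots T(e_n)$, $\eta^-=(e_1,\ldots,e_{n-1})$. Every column of $T(\eta)$ has a positive entry. $\|M\|=\sum_{i,j}M_{i,j}$. The IFS satisfies the finite neighbour condition if $\mathcal{G}$ is finite. Symbolic representations. An infinite path $\gamma$ in $\mathcal{G}$ starting at the root vertex $\mathcal{V}([0,1])=\{\mathrm{id}\}$ corresponds to a unique sequence $[0,1]=\Delta_0\supseteq\Delta_1\supseteq\cdots$, each $\Delta_i$ a child of $\Delta_{i-1}$, whose successive edges are those of $\gamma$; $\gamma$ is a symbolic representation of $x\in K$ if $\{x\}=\bigcap_i\Delta_i$. A point $x\in K$ is interior if it has a unique symbolic representation. Loop classes. A loop class $\mathcal{L}$ is an induced subgraph of $\mathcal{G}$ such that any two of its vertices $v_1,v_2$ are joined by a non-empty directed path in $\mathcal{L}$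 from $v_1$ to $v_2$; it is maximal if maximal with this property. $\mathcal{L}$ is simple if all cycles in $\mathcal{L}$ share the same edge set. $\mathcal{L}$ is irreducible if for any $v_1,v_2\in V(\mathcal{L})$, $1\le i\le\#v_1$, $1\le j\le\#v_2$, there is a non-empty path $\eta$ in $\mathcal{L}$ from $v_1$ to $v_2$ with $T(\eta)_{i,j}>0$. A path is eventually in $\mathcal{L}$ if some tail of it lies in $\mathcal{L}$. $K_{\mathcal{L}}$ is the set of $x\in K$ having a symbolic representation that is eventually in $\mathcal{L}$. With $\Sigma_t(\mathcal{L})$ the set of finite paths $\eta$ in $\mathcal{L}$ with $W(\eta)<t\le W(\eta^-)$, set $$\alpha_{\min}(\mathcal{L})=\lim_{t\to0}\min_{\eta\in\Sigma_t(\mathcal{L})}\frac{\log\|T(\eta)\|}{\log t},\qquad\alpha_{\max}(\mathcal{L})=\lim_{t\to0}\max_{\eta\in\Sigma_t(\mathcal{L})}\frac{\log\|T(\eta)\|}{\log t}$$ (these limits exist and are real). Local dimensions. $\underline{\dim}_{\mathrm{loc}}\mu(x)$ and $\overline{\dim}_{\mathrm{loc}}\mu(x)$ are the $\liminf$ and $\limsup$ as $t\to0$ of $\log\mu(B(x,t))/\log t$; when equal, the common value is $\dim_{\mathrm{loc}}\mu(x)$. *)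

(* Defs.v *)
From HB Require Import structures.
From mathcomp Require Import all_boot all_order all_algebra.
From mathcomp Require Import finmap.
From mathcomp Require Import all_classical all_reals all_analysis.
Set Implicit Arguments.
Unset Strict Implicit.
Unset Printing Implicit Defensive.
Import Order.TTheory GRing.Theory Num.Theory.
Import numFieldNormedType.Exports.

Local Open Scope classical_set_scope.
Local Open Scope ring_scope.

(* The affine map x |-> r x + d of the line is represented by the pair (r, d). *)
Definition sim (R : realType) : choiceType := (R * R)%type.

Section Similarity.
Context {R : realType}.
Implicit Types f g : sim R.

Definition sim_app f (x : R) : R := f.1 * x + f.2.
Definition sim_id : sim R := (1, 0).
Definition sim_comp f g : sim R := (f.1 * g.1, f.1 * g.2 + f.2).
(* inverse for composition when f.1 != 0 *)
Definition sim_inv f : sim R := (f.1^-1, - (f.2 / f.1)).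

Definition convex_hull (A : set R) : set R :=
  smallest (@convex_set R (R^o)) A.

End Similarity.

(* A closed interval [a, b] is represented by the pair (a, b). *)
Definition segment {R : realType} (D : R * R) : set R := `[D.1, D.2]%classic.
Definition open_segment {R : realType} (D : R * R) : set R :=
  `]D.1, D.2[%classic.

(* A vertex of the transition graph is a neighbour set. *)
Definition vertex (R : realType) : Type := set (sim R).

(* Source, target and relative position q of the child. *)
Definition edge (R : realType) : Type := (vertex R * vertex R * R)%type.

Section NetIntervals.
Context {R : realType} {m : nat} (S : 'I_m -> sim R) (K : set R).
Implicit Types (s : seq 'I_m) (t : R) (D : R * R).

Definition word_map s : sim R := foldr (fun i f => sim_comp (S i) f) sim_id s.

Definition word_ratio s : R := \prod_(i <- s) (S i).1.

Definition Lambda t : set (seq 'I_m) :=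
  if 1 < t then [set [::]]
  else [set s | exists s' l, s = rcons s' l /\
                 `|word_ratio s| < t <= `|word_ratio s'|].

Definition endpoints t : set R :=
  [set y | exists2 s, Lambda t s &
     y = sim_app (word_map s) 0 \/ y = sim_app (word_map s) 1].

Definition net_interval t : set (R * R) :=
  [set D | [/\ endpoints t D.1, endpoints t D.2, D.1 < D.2,
               open_segment D `&` endpoints t = set0 &
               open_segment D `&` K !=set0]].

Definition diam D : R := D.2 - D.1.

(* The orientation-preserving similarity mapping [0, 1] onto D. *)
Definition T_ D : sim R := (diam D, D.1).

Definition contributes t D s : Prop :=
  Lambda t s /\ (sim_app (word_map s) @` K) `&` open_segment D !=set0.

Definition generates t D s (f : sim R) : Prop :=
  contributes t D s /\ f = sim_comp (sim_inv (T_ D)) (word_map s).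

Definition neighbour_set t D : vertex R := [set f | exists s, generates t D s f].

(* The set below is finite and non-empty for a net interval D of generation
   t > 0, so that the supremum is a maximum. *)
Definition tg t D : R := sup [set `|word_ratio s| | s in contributes t D].

Definition child t D D1 : Prop :=
  net_interval (tg t D) D1 /\ segment D1 `<=` segment D.

Definition child_edge t D D1 : edge R :=
  (neighbour_set t D, neighbour_set (tg t D) D1, (D1.1 - D.1) / diam D).

Definition realizes (e : edge R) t D D1 : Prop :=
  [/\ 0 < t, net_interval t D, child t D D1 & e = child_edge t D D1].

Definition graph_vertices : set (vertex R) :=
  [set v | exists t D, [/\ 0 < t, net_interval t D & v = neighbour_set t D]].

Definition graph_edges : set (edge R) :=
  [set e | exists t D D1, realizes e t D D1].

Definition finite_neighbour_condition : Prop :=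
  finite_set graph_vertices /\ finite_set graph_edges.

(* The weight does not depend on the parent and child realizing the edge. *)
Definition edge_weight (e : edge R) : R :=
  xget 0 [set w | exists t D D1,
    realizes e t D D1 /\ w = tg (tg t D) D1 / tg t D].

(* A finite path is given by its initial vertex v and the list of its
   successive steps: the step (w, q) stands for the edge of position q from the
   current vertex to w. *)
Definition step : Type := (vertex R * R)%type.

Fixpoint path_end (v : vertex R) (h : seq step) : vertex R :=
  if h is a :: h' then path_end a.1 h' else v.

Fixpoint path_edges (v : vertex R) (h : seq step) : set (edge R) :=
  if h is a :: h' then (v, a.1, a.2) |` path_edges a.1 h' else set0.

Fixpoint path_weight (v : vertex R) (h : seq step) : R :=
  if h is a :: h' then edge_weight (v, a.1, a.2) * path_weight a.1 h' else 1.

(* Paths in the subgraph induced by a set L of vertices. *)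
Fixpoint path_in (L : set (vertex R)) (v : vertex R) (h : seq step) : Prop :=
  L v /\
  (if h is a :: h' then graph_edges (v, a.1, a.2) /\ path_in L a.1 h' else True).

(* An induced subgraph is identified with its set of vertices. *)
Definition loop_class (L : set (vertex R)) : Prop :=
  L `<=` graph_vertices /\
  forall v1 v2, L v1 -> L v2 ->
    exists h, [/\ h <> [::], path_in L v1 h & path_end v1 h = v2].

Definition maximal_loop_class (L : set (vertex R)) : Prop :=
  loop_class L /\ forall L', loop_class L' -> L `<=` L' -> L' = L.

Definition cycle_in (L : set (vertex R)) (v : vertex R) (h : seq step) : Prop :=
  [/\ h <> [::], path_in L v h & path_end v h = v].

Definition simple_class (L : set (vertex R)) : Prop :=
  forall v h v' h', cycle_in L v h -> cycle_in L v' h' ->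
    path_edges v h = path_edges v' h'.

(* The infinite path g starts at the root, i.e. at [0, 1] as the net interval
   of any generation larger than 1 (here 2); D n is the n-th net interval and
   t n its generation. *)
Definition symbolic_rep (g : nat -> edge R) (x : R) : Prop :=
  exists (t : nat -> R) (D : nat -> R * R),
    [/\ t 0%N = 2, D 0%N = (0, 1),
        forall n, [/\ child (t n) (D n) (D n.+1), t n.+1 = tg (t n) (D n) &
                      g n = child_edge (t n) (D n) (D n.+1)] &
        \bigcap_n segment (D n) = [set x]].

Definition interior_point (x : R) : Prop :=
  K x /\ exists! g : nat -> edge R, symbolic_rep g x.

Definition eventually_in (L : set (vertex R)) (g : nat -> edge R) : Prop :=
  exists N, forall n, (N <= n)%N -> L (g n).1.1 /\ L (g n).1.2.

Definition K_ (L : set (vertex R)) : set R :=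
  [set x | K x /\ exists2 g, symbolic_rep g x & eventually_in L g].

Section TransitionMatrices.
(* le is the total order fixed on the neighbours, p the probabilities. *)
Context (le : rel (sim R)) (p : 'I_m -> R).

Definition neighbours (v : vertex R) : seq (sim R) :=
  sort le (enum_fset (fset_set v)).

Definition card_nb (v : vertex R) : nat := size (neighbours v).

Definition nb (v : vertex R) (i : 'I_(card_nb v)) : sim R :=
  nth sim_id (neighbours v) i.

(* The three cases do not depend on the realization of the edge, and the letter
   l is unique when the similarities S i are distinct. *)
Definition trans_entry (e : edge R) (f g : sim R) : R :=
  if [pick l | `[< exists t D D1 s, [/\ realizes e t D D1,
        generates t D s f & generates (tg t D) D1 (rcons s l) g] >]] is Some l
  then p l
  else if `[< exists t D D1 s, [/\ realizes e t D D1,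
        generates t D s f & generates (tg t D) D1 s g] >] then 1 else 0.

Definition trans_mx (v w : vertex R) (q : R) : 'M[R]_(card_nb v, card_nb w) :=
  \matrix_(i, j) trans_entry (v, w, q) (nb i) (nb j).

Fixpoint path_mx (v : vertex R) (h : seq step) :
    'M[R]_(card_nb v, card_nb (path_end v h)) :=
  match h with
  | [::] => 1%:M
  | a :: h' => trans_mx v a.1 a.2 *m path_mx a.1 h'
  end.

Definition mx_norm1 (k n : nat) (M : 'M[R]_(k, n)) : R := \sum_i \sum_j M i j.

(* The equality j' = j of natural numbers only serves to transport j along
   path_end v1 h = v2. *)
Definition irreducible_class (L : set (vertex R)) : Prop :=
  forall v1 v2, L v1 -> L v2 ->
  forall (i : 'I_(card_nb v1)) (j : 'I_(card_nb v2)),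
    exists h, [/\ h <> [::], path_in L v1 h, path_end v1 h = v2 &
      exists2 j' : 'I_(card_nb (path_end v1 h)),
        j' = j :> nat & 0 < path_mx v1 h i j'].

Definition Sigma_ (L : set (vertex R)) t : set (vertex R * seq step) :=
  [set vh | path_in L vh.1 vh.2 /\
     exists h a, vh.2 = rcons h a /\
       path_weight vh.1 vh.2 < t <= path_weight vh.1 h].

Definition log_ratios (L : set (vertex R)) t : set R :=
  [set ln (mx_norm1 (path_mx vh.1 vh.2)) / ln t | vh in Sigma_ L t].

(* For 0 < t <= 1 and a loop class L of a finite graph, log_ratios L t is
   finite and non-empty (if L is), so that inf and sup are a minimum and a
   maximum. *)
Definition alpha_min (L : set (vertex R)) : R :=
  lim (inf (log_ratios L t) @[t --> 0^'+]).

Definition alpha_max (L : set (vertex R)) : R :=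
  lim (sup (log_ratios L t) @[t --> 0^'+]).

End TransitionMatrices.
End NetIntervals.

Section LocalDimension.
Context {R : realType} (mu : probability (measurableTypeR R) R).

Definition log_mu_ratio (x t : R) : \bar R :=
  (ln (fine (mu (ball x t))) / ln t)%:E.

Definition lower_dim_loc (x : R) : \bar R := limf_einf (log_mu_ratio x) 0^'+.

Definition upper_dim_loc (x : R) : \bar R := limf_esup (log_mu_ratio x) 0^'+.

Definition has_dim_loc (x : R) (d : \bar R) : Prop :=
  lower_dim_loc x = d /\ upper_dim_loc x = d.

End LocalDimension.

(* Main.v *)
Require Import Defs.
From HB Require Import structures.
From mathcomp Require Import all_boot all_order all_algebra.
From mathcomp Require Import finmap.
From mathcomp Require Import all_classical all_reals all_analysis.
From mathcomp Require Import measurable_realfun.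
From mathcomp Require Import ring lra zify.
Set Implicit Arguments.
Unset Strict Implicit.
Unset Printing Implicit Defensive.
Import Order.TTheory GRing.Theory Num.Theory.
Import numFieldNormedType.Exports.

Local Open Scope classical_set_scope.
Local Open Scope ring_scope.

(** Why the theorem is true. The children of a net interval, their relative
    positions, their neighbour sets and the way in which words of one
    generation continue those of the previous one depend on the neighbour set
    only (child_place, child_neighbours, trans_entry_big). So an infinite path
    from the root is the same as a nested sequence of net intervals, called a
    descent below, and along a descent D the diameter of D n is, up to bounded
    factors, the weight of the path, while by self-similarity the mass of the
    interior of D n is, up to bounded factors, the norm of the product of the
    transition matrices (mass_edge, descent_mass, descent_mass_bounds).
    Writing cost = - ln W and decay = - ln of the norm, a local dimension is
    a rate of decay per unit of cost, except for the fact that a ball may be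
    larger than the net intervals it is compared with.

    In an irreducible class L the decay is superadditive under concatenation,
    and additive up to a constant when suitable connecting paths are inserted
    (path_gluing). Hence the least and the greatest decay over the paths of
    L of cost about u are almost superadditive functions of u, so they are
    asymptotic to alpha_min u and alpha_max u (least_decay_limit,
    greatest_decay_limit).

    Range (upper_dim_in_range). Balls around a point x of D n with radius
    twice the diameter of D n contain D n, which bounds the upper local
    dimension by alpha_max. For the bound by alpha_min one needs infinitely
    many n for which some ball of comparable radius has at most the mass of
    D n. If x is inside all D n, both ends move infinitely often within
    windows of bounded length, and such a ball fits into D n. If x is an end
    of D n, then K has no points near x on the other side, since they would
    give a second representation of x, and points have no mass
    (interior_ball_often).

    Realization (exact_dimension_point). As L is not simple, some vertex has
    two outgoing edges in L, which yields a cycle z after which both ends of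
    the net interval have moved (inner_cycle). Given a between alpha_min and
    alpha_max, start from the root, go to L, and glue blocks: the k-th one has
    cost about 2 k + 1, is followed by z, and has nearly the least or nearly
    the greatest decay, according to whether the decay so far is larger or
    smaller than a k ^+ 2. The decay is then a k ^+ 2 + o(k ^+ 2) for a cost of
    k ^+ 2 + O(k). The cycles z put the limit point x inside all its net
    intervals, which makes its representation unique, and make the balls
    around x comparable with net intervals once in every block; the blocks are
    short with respect to k ^+ 2, so that the local dimension at x is a.

    Thus [alpha_min, alpha_max] is contained in the set of local dimensions,
    this set in the set of upper local dimensions, and the latter in
    [alpha_min, alpha_max]. *)

(** * Sequences and monotone functions of a real variable *)

Section RealSequences.
Context {R : realType}.
Implicit Types (u v e : R) (k n : nat).

Lemma const_le_linear (C e : R) : 0 < e ->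
  exists2 u0, 1 <= u0 & forall u, u0 <= u -> C <= e * u.
Proof.
move=> e0; exists (Num.max 1 (C / e)); first by rewrite le_max lexx.
by move=> u; rewrite ge_max => /andP[_]; rewrite ler_pdivrMr// mulrC.
Qed.

Lemma nat_above (u : R) k : (Num.truncn u < k)%N -> u <= k%:R.
Proof. by move=> uk; apply: ltW; apply: lt_le_trans (truncnS_gt u) _; rewrite ler_nat. Qed.

Lemma inv_nat_le (a : R) : 0 < a -> (Num.truncn a^-1).+1%:R^-1 <= a.
Proof. by move=> a0; rewrite -[leRHS]invrK lef_pV2 ?posrE ?invr_gt0// nat_above. Qed.

Lemma exp_small (rho e : R) : 0 < rho -> rho < 1 -> 0 < e ->
  exists n, forall k, (n <= k)%N -> rho ^+ k < e.
Proof.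
move=> rho0 rho1 e0.
have : (GRing.exp rho : R ^nat) @ \oo --> 0 by apply: cvg_expr; rewrite gtr0_norm.
move=> /cvgrPdist_lt/(_ _ e0)[n _ nP]; exists n => k /nP /=.
by rewrite sub0r normrN gtr0_norm// exprn_gt0.
Qed.

(** Fekete's lemma for a continuous variable. With u1 nearly optimal for the
    supremum of J u / u, a large u is s + n u1 with s bounded, and
    superadditivity gives J u >= J s + n J u1. *)
Lemma superadditive_limit (J : R -> R) (a B : R) : 1 <= a ->
  (forall u, a <= u -> `|J u| <= B * u) ->
  (forall u v, a <= u -> a <= v -> J u + J v <= J (u + v)) ->
  exists l, (forall u, a <= u -> J u <= l * u) /\
    forall e, 0 < e -> exists u0, forall u, u0 <= u -> (l - e) * u <= J u.
Proof.
move=> a1 JB Jadd.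
have ap u : a <= u -> 0 < u by lra.
have B0 : 0 <= B by have := JB a (lexx _); have := normr_ge0 (J a); nra.
pose E := [set J u / u | u in [set u | a <= u]].
have Eub u : a <= u -> J u / u <= B.
  move=> au; rewrite ler_pdivrMr ?ap//.
  exact: le_trans (ler_norm _) (JB _ au).
have Esup : has_sup E.
  split; first by exists (J a / a); exists a => //=.
  by exists B => _ [u au <-]; exact: Eub.
exists (sup E); split=> [u au|e e0].
  rewrite -ler_pdivrMr ?ap//; apply: sup_upper_bound => //.
  by exists u.
have e2 : 0 < e / 2 by lra.
have [_ [u1 /= au1 <-] u1E] := sup_adherent e2 Esup.
have {}u1E : (sup E - e / 2) * u1 <= J u1.
  by rewrite -ler_pdivlMr ?ap// ltW.
set l := sup E in u1E *.
have iter n s : a <= s -> J s + n%:R * J u1 <= J (s + n%:R * u1).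
  move=> as_; elim: n => [|n IH]; first by rewrite !mul0r !addr0.
  have nu0 : 0 <= n%:R * u1 by rewrite mulr_ge0// ltW ?ap.
  have h : a <= s + n%:R * u1 by lra.
  have := Jadd _ _ h au1; rewrite -natr1.
  have -> : s + n%:R * u1 + u1 = s + (n%:R + 1) * u1 by ring.
  lra.
pose D := B * (a + u1) + `|l - e / 2| * (a + u1).
have [u0 u01 u0P] := const_le_linear D e2.
exists (Num.max u0 a) => u; rewrite ge_max => /andP[u0u au].
(* J is controlled on [a, +oo[ only, so the remainder s is taken in [a, a + u1]
   and not in [0, u1]. *)
pose q := (u - a) / u1.
have q0 : 0 <= q by rewrite divr_ge0 ?subr_ge0// ltW ?ap.
pose n := Num.truncn q; pose s := u - n%:R * u1.
have /andP[nq qn] : n%:R <= q < n.+1%:R.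
  exact: truncn_itv q0.
have u1p := ap _ au1.
have uE : u = s + n%:R * u1 by rewrite /s subrK.
have as_ : a <= s.
  by move: nq; rewrite /q ler_pdivlMr// /s; lra.
have sa : s <= a + u1.
  by move: qn; rewrite /q ltr_pdivrMr// /s -natr1; lra.
have Js : - (B * (a + u1)) <= J s.
  have := JB s as_; rewrite ler_norml => /andP[h _].
  apply: le_trans h; rewrite lerN2; apply: ler_wpM2l => //.
have nJ : n%:R * ((l - e / 2) * u1) <= n%:R * J u1 by apply: ler_wpM2l.
have := iter n s as_; rewrite -uE => it.
have hl : (l - e / 2) * s <= `|l - e / 2| * (a + u1).
  apply: (@le_trans _ _ (`|l - e / 2| * s)).
    by apply: ler_wpM2r; [lra|exact: ler_norm].
  by apply: ler_wpM2l.
have := u0P _ u0u; rewrite /D => hD.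
have : (l - e / 2) * u = (l - e / 2) * s + n%:R * ((l - e / 2) * u1).
  by rewrite {1}uE; ring.
have -> : (l - e) * u = (l - e / 2) * u - e / 2 * u by field.
lra.
Qed.

(** The shifted function J u = H (u - C) - C' absorbs both errors and is
    superadditive. *)
Lemma almost_superadditive_limit (H : R -> R) (B C C' : R) :
  0 <= C -> 0 <= C' ->
  (forall u, 1 <= u -> `|H u| <= B * u) ->
  (forall u v, 1 <= u -> 1 <= v -> H u + H v - C' <= H (u + v + C)) ->
  exists l, forall e, 0 < e -> exists u0, forall u, u0 <= u ->
    `|H u - l * u| <= e * u.
Proof.
move=> C0 C'0 HB Hadd.
pose J u := H (u - C) - C'.
have B0 : 0 <= B by have := HB 1 (lexx _); have := normr_ge0 (H 1); lra.
have [|||l [lub llb]] := @superadditive_limit J (1 + C) (B + C').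
- by rewrite lerDl.
- move=> u Cu; apply: le_trans (ler_normB _ _) _.
  rewrite mulrDl lerD//; last by rewrite ger0_norm//; nra.
  by have := HB (u - C); rewrite lerBrDr => /(_ Cu); nra.
- move=> u v Cu Cv; rewrite /J.
  have := Hadd (u - C) (v - C); rewrite !lerBrDr => /(_ Cu Cv).
  have -> : u - C + (v - C) + C = u + v - C by ring.
  lra.
exists l => e e0.
have e2 : 0 < e / 2 by lra.
have [u1 u1P] := llb _ e2.
have [u2 u21 u2P] := const_le_linear (e / 2 * C + `|l| * C + C') e2.
exists (Num.max u1 u2) => u; rewrite ge_max => /andP[u1u u2u].
have HJ : H u = J (u + C) + C' by rewrite /J addrK subrK.
have h1 := lub (u + C); have h2 := u1P (u + C).
have := u2P _ u2u.
have lC : l * C <= `|l| * C by apply: ler_wpM2r => //; exact: ler_norm.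
have lC' : - (l * C) <= `|l| * C.
  by rewrite -mulNr; apply: ler_wpM2r => //; rewrite -normrN ler_norm.
have {}h1 := h1 ltac:(lra); have {}h2 := h2 ltac:(lra).
have Hp : e / 2 * C + `|l| * C + C' <= e / 2 * u -> `|H u - l * u| <= e * u.
  move=> h; rewrite HJ ler_norml; apply/andP; split; nra.
exact: Hp.
Qed.

(** As long as X is positive its increments are at most (e / 2) (k + 1), and
    one increment from a value that is not positive adds at most B (k + 1);
    hence X k stays below the sum of the former, a fraction of k ^+ 2, and a
    linear term. *)
Lemma steering_upper (X : nat -> R) (B : R) : 0 <= B ->
  (forall k, X k.+1 - X k <= B * k.+1%:R) ->
  (forall e, 0 < e -> exists k0, forall k, (k0 <= k)%N -> 0 < X k ->
     X k.+1 - X k <= e * k.+1%:R) ->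
  forall e, 0 < e -> exists k0, forall k, (k0 <= k)%N -> X k <= e * k%:R ^+ 2.
Proof.
move=> B0 XB Xe e e0; have e2 : 0 < e / 2 by lra.
have [j jP] := Xe _ e2.
have bound i : X (j + i)%N <= `|X j| + B * (j + i)%:R + e / 2 * (j + i)%:R ^+ 2.
  elim: i => [|i IH].
    rewrite addn0; have := ler_norm (X j).
    have : 0 <= B * j%:R by rewrite mulr_ge0.
    have : 0 <= e / 2 * j%:R ^+ 2 by rewrite mulr_ge0 ?sqr_ge0// ltW.
    lra.
  rewrite addnS; set n := (j + i)%N in IH *.
  have n1 : n.+1%:R = n%:R + 1 :> R by rewrite natr1.
  have n0 : 0 <= n%:R :> R by [].
  have nX := normr_ge0 (X j).
  have [Xn|Xn] := ltP 0 (X n).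
    have := jP n (leq_addr _ _) Xn; rewrite n1; nra.
  have := XB n; rewrite n1.
  have : 0 <= e / 2 * (n%:R + 1) ^+ 2 by rewrite mulr_ge0 ?sqr_ge0// ltW.
  nra.
have e4 : 0 < e / 4 by lra.
have [u0 u01 u0P] := const_le_linear (`|X j|) e4.
have [u1 u11 u1P] := const_le_linear B e4.
exists (maxn j (maxn (Num.truncn u0).+1 (Num.truncn u1).+1)) => k.
rewrite !geq_max => /and3P[jk u0k u1k].
have k0 : u0 <= k%:R by exact: nat_above.
have k1 : u1 <= k%:R by exact: nat_above.
have := bound (k - j)%N; rewrite subnKC//.
have := u0P _ k0; have := u1P _ k1.
have : 1 <= k%:R :> R by exact: le_trans k0.
move: (k%:R : R) => x x1 h1 h2 h3.
have : B * x <= e / 4 * x ^+ 2 by nra.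
have : `|X j| <= e / 4 * x ^+ 2 by nra.
lra.
Qed.

(** Used for the difference between the decay of a path made of k blocks and
    a k ^+ 2, every block being chosen according to the sign of that
    difference. *)
Lemma steering (X : nat -> R) (B : R) : 0 <= B ->
  (forall k, `|X k.+1 - X k| <= B * k.+1%:R) ->
  (forall e, 0 < e -> exists k0, forall k, (k0 <= k)%N ->
     (0 < X k -> X k.+1 - X k <= e * k.+1%:R) /\
     (X k < 0 -> - (e * k.+1%:R) <= X k.+1 - X k)) ->
  forall e, 0 < e -> exists k0, forall k, (k0 <= k)%N -> `|X k| <= e * k%:R ^+ 2.
Proof.
move=> B0 XB Xe e e0.
have [||k0 k0P] := @steering_upper X B B0 _ _ e e0.
- by move=> k; exact: le_trans (ler_norm _) (XB k).
- by move=> d /Xe[k0 h]; exists k0 => k /h[].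
have [||k1 k1P] := @steering_upper (fun k => - X k) B B0 _ _ e e0.
- by move=> k; rewrite -opprD; apply: le_trans (ler_norm _) _; rewrite normrN.
- move=> d /Xe[k1 h]; exists k1 => k /h[_ h1]; rewrite oppr_gt0 => /h1; lra.
exists (maxn k0 k1) => k; rewrite geq_max => /andP[/k0P h0 /k1P h1].
by rewrite ler_norml h0 andbT lerNl.
Qed.

Section Interpolation.
Context (g : R -> R) (w : nat -> R) (a : R).
Context (g_ge0 : forall u, 0 <= u -> 0 <= g u).
Context (g_homo : forall u v, u <= v -> g u <= g v).
Context (w_infty : forall u, exists k0, forall k, (k0 <= k)%N -> u <= w k).
Context (w_slow : forall e, 0 < e -> exists k0, forall k, (k0 <= k)%N ->
  w k.+1 <= (1 + e) * w k).

(** The ratio of consecutive values of w tends to 1: sampling along w loses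
    nothing. *)
Lemma consecutive_bracket (e : R) k0 : 0 < e -> exists u0, forall u, u0 <= u ->
  exists k, [/\ (k0 <= k)%N, 1 <= w k, w k <= u, u < w k.+1 & w k.+1 <= (1 + e) * w k].
Proof.
move=> e0; have [k1 k1P] := w_slow e0; have [k2 k2P] := w_infty 1.
pose k3 := maxn k0 (maxn k1 k2); exists (w k3) => u u3.
have [i ui] : exists i, u < w (k3 + i)%N.
  have [k4 k4P] := w_infty (u + 1); exists k4.
  by apply: lt_le_trans (k4P _ (leq_addl _ _)); rewrite ltrDl.
have ex : exists i, u < w (k3 + i)%N by exists i.
case: (ex_minnP ex) => -[|j] uj jmin; first by move: uj; rewrite addn0; lra.
exists (k3 + j)%N; rewrite -addnS.
have kk : (k3 <= k3 + j)%N := leq_addr _ _.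
have k3j k : (k <= k3)%N -> (k <= k3 + j)%N by move=> h; exact: leq_trans kk.
split=> //.
- by apply: k3j; rewrite leq_maxl.
- by apply: k2P; apply: k3j; rewrite !leq_max leqnn !orbT.
- by rewrite leNgt; apply/negP => /jmin; rewrite ltnn.
- by rewrite addnS; apply: k1P; apply: k3j; rewrite !leq_max leqnn !orbT.
Qed.

Lemma interpolate_le :
  (forall e, 0 < e -> exists k0, forall k, (k0 <= k)%N -> g (w k) <= (a + e) * w k) ->
  forall e, 0 < e -> exists u0, forall u, u0 <= u -> g u <= (a + e) * u.
Proof.
move=> ga.
(* g >= 0 forces a >= 0, which is needed to multiply the bound at w k.+1 by the
   ratio of u to w k.+1. *)
have a0 : 0 <= a.
  rewrite leNgt; apply/negP => an.
  have [k0 k0P] := ga (- a / 2) ltac:(lra).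
  have [k1 k1P] := w_infty 1.
  have := k0P (maxn k0 k1) (leq_maxl _ _).
  have := k1P (maxn k0 k1) (leq_maxr _ _) => w1.
  have := g_ge0 (u := w (maxn k0 k1)) ltac:(lra); nra.
move=> e e0.
pose d := Num.min 1 (e / (a + 2)).
have d0 : 0 < d by rewrite lt_min ltr01 divr_gt0//; lra.
have d1 : d <= 1 by rewrite ge_min lexx.
have de : d * (a + 2) <= e by rewrite -ler_pdivlMr ?ge_min ?lexx ?orbT//; lra.
have [k0 k0P] := ga _ d0.
have [u0 u0P] := consecutive_bracket k0 d0.
exists u0 => u /u0P[k [k0k w1 wu uw ww]].
apply: le_trans (g_homo (ltW uw)) _.
apply: le_trans (k0P _ (leqW k0k)) _.
have h : w k.+1 <= (1 + d) * u by nra.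
apply: (@le_trans _ _ ((a + d) * ((1 + d) * u))).
  by apply: ler_wpM2l => //; lra.
rewrite mulrA; apply: ler_wpM2r; nra.
Qed.

Lemma interpolate_ge :
  (forall e, 0 < e -> exists k0, forall k, (k0 <= k)%N -> (a - e) * w k <= g (w k)) ->
  forall e, 0 < e -> exists u0, forall u, u0 <= u -> (a - e) * u <= g u.
Proof.
move=> ga e e0.
pose d := Num.min (e / 2) (e / (2 * `|a| + 2)).
have na := normr_ge0 a.
have d0 : 0 < d by rewrite lt_min !divr_gt0//; lra.
have d1 : d <= e / 2 by rewrite ge_min lexx.
have de : d * (2 * `|a| + 2) <= e by rewrite -ler_pdivlMr ?ge_min ?lexx ?orbT//; lra.
have [k0 k0P] := ga _ d0.
have [u0 u0P] := consecutive_bracket k0 d0.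
exists u0 => u /u0P[k [k0k w1 wu uw ww]].
have [ae|ae] := leP (a - e) 0.
  by apply: (@le_trans _ _ 0); [nra|apply: g_ge0; lra].
apply: le_trans (g_homo wu); apply: le_trans (k0P _ k0k).
have anE : `|a| = a by rewrite ger0_norm//; lra.
have h : u <= (1 + d) * w k by lra.
apply: (@le_trans _ _ ((a - e) * ((1 + d) * w k))).
  by apply: ler_wpM2l => //; lra.
by rewrite mulrA; apply: ler_wpM2r; rewrite anE in de; nra.
Qed.

End Interpolation.
End RealSequences.

Lemma ball_measurable {R : realType} (x r : R) :
  measurable (ball x r : set (measurableTypeR R)).
Proof. by rewrite ball_itv; exact: measurable_itv. Qed.

(** * Local dimensions in logarithmic scale *)

Section LocalDimensionBounds.
Context {R : realType}.

Lemma limf_esup_le (F : set_system R) (phi : R -> R) (a : R) :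
  (forall e, 0 < e -> exists2 V, F V & forall t, V t -> phi t <= a + e) ->
  (limf_esup (EFin \o phi) F <= a%:E)%E.
Proof.
move=> h; apply/lee_addgt0Pr => e e0; have [V FV VP] := h _ e0.
apply: (@le_trans _ _ (ereal_sup ((EFin \o phi) @` V))).
  by apply: ereal_inf_lbound; exists V.
by apply: ge_ereal_sup => _ [t Vt <-] /=; rewrite -EFinD lee_fin VP.
Qed.

Lemma limf_esup_ge (F : set_system R) (phi : R -> R) (a : R) :
  (forall e V, 0 < e -> F V -> exists2 t, V t & a - e <= phi t) ->
  (a%:E <= limf_esup (EFin \o phi) F)%E.
Proof.
move=> h; apply: le_ereal_inf_tmp => _ [V FV <-].
apply/lee_addgt0Pr => e e0; have [t Vt at_] := h _ _ e0 FV.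
rewrite -leeBlDr//; apply: (@le_trans _ _ ((phi t)%:E)).
  by rewrite -EFinB lee_fin.
by apply: ereal_sup_ubound; exists t.
Qed.

Context (mu : probability (measurableTypeR R) R) (x : R).

(** With u = - ln t the ratio log_mu_ratio at the radius t is ball_decay
    u / u: small radii become large u, and the numerator is a nondecreasing
    function of u. *)
Definition ball_decay (u : R) : R := - ln (fine (mu (ball x (expR (- u))))).

Lemma log_mu_ratioE t : 0 < t ->
  log_mu_ratio mu x t = (ball_decay (- ln t) / - ln t)%:E.
Proof. by move=> t0; rewrite /log_mu_ratio /ball_decay opprK lnK// invrN mulrNN. Qed.

Lemma near0_log (V : set R) : (0^'+ : set_system R) V ->
  exists u0, forall u, u0 <= u -> V (expR (- u)).
Proof.
move=> [d /= d0 dV]; exists (- ln d + 1) => u du; apply: dV => /=; last exact: expR_gt0.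
rewrite sub0r normrN gtr0_norm ?expR_gt0//.
by rewrite -[ltRHS]lnK// ltr_expR; lra.
Qed.

Lemma log_near0 (u0 : R) :
  (0^'+ : set_system R) [set t | 0 < t /\ u0 <= - ln t].
Proof.
exists (expR (- u0)) => /=; first exact: expR_gt0.
move=> t /= + t0; rewrite sub0r normrN gtr0_norm// => tu; split => //.
by rewrite lerNr -[leRHS]expRK ler_ln ?posrE ?expR_gt0// ltW.
Qed.

Lemma upper_dim_le a :
  (forall e, 0 < e -> exists u0, forall u, u0 <= u -> ball_decay u <= (a + e) * u) ->
  (upper_dim_loc mu x <= a%:E)%E.
Proof.
move=> h; apply: (@limf_esup_le _ (fun t => ln (fine (mu (ball x t))) / ln t)) => e /h[u0 u0P].
exists [set t | 0 < t /\ Num.max u0 1 <= - ln t]; first exact: log_near0.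
move=> t [t0]; rewrite ge_max => /andP[/u0P h1 h2].
have := log_mu_ratioE t0 => -[->].
by rewrite ler_pdivrMr//; lra.
Qed.

Lemma upper_dim_ge a :
  (forall e u0, 0 < e -> exists2 u, u0 <= u & (a - e) * u <= ball_decay u) ->
  (a%:E <= upper_dim_loc mu x)%E.
Proof.
move=> h; apply: (@limf_esup_ge _ (fun t => ln (fine (mu (ball x t))) / ln t)) => e V e0 /near0_log[u0 u0P].
have [u] := h _ (Num.max u0 1) e0; rewrite ge_max => /andP[/u0P Vu u1] ue.
exists (expR (- u)) => //.
have := log_mu_ratioE (expR_gt0 (- u)) => -[->].
by rewrite expRK opprK ler_pdivlMr//; lra.
Qed.

Lemma lower_dim_ge a :
  (forall e, 0 < e -> exists u0, forall u, u0 <= u -> (a - e) * u <= ball_decay u) ->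
  (a%:E <= lower_dim_loc mu x)%E.
Proof.
move=> h; rewrite leeNr -EFinN.
apply: (@limf_esup_le _ (fun t => - (ln (fine (mu (ball x t))) / ln t))) => e /h[u0 u0P].
exists [set t | 0 < t /\ Num.max u0 1 <= - ln t]; first exact: log_near0.
move=> t [t0]; rewrite ge_max => /andP[/u0P h1 h2].
have := log_mu_ratioE t0 => -[->].
by rewrite lerNl opprD opprK ler_pdivlMr//; lra.
Qed.

Lemma lower_dim_le a :
  (forall e u0, 0 < e -> exists2 u, u0 <= u & ball_decay u <= (a + e) * u) ->
  (lower_dim_loc mu x <= a%:E)%E.
Proof.
move=> h; rewrite leeNl -EFinN.
apply: (@limf_esup_ge _ (fun t => - (ln (fine (mu (ball x t))) / ln t))) => e V e0 /near0_log[u0 u0P].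
have [u] := h _ (Num.max u0 1) e0; rewrite ge_max => /andP[/u0P Vu u1] ue.
exists (expR (- u)) => //.
have := log_mu_ratioE (expR_gt0 (- u)) => -[->].
by rewrite expRK opprK lerNr opprD !opprK ler_pdivrMr//; lra.
Qed.

Lemma dim_locP a :
  (forall e, 0 < e -> exists u0, forall u, u0 <= u -> (a - e) * u <= ball_decay u) ->
  (forall e, 0 < e -> exists u0, forall u, u0 <= u -> ball_decay u <= (a + e) * u) ->
  has_dim_loc mu x a%:E.
Proof.
move=> h1 h2; split; apply/eqP; rewrite eq_le; apply/andP; split.
- apply: lower_dim_le => e u0 /h2[u1 u1P].
  by exists (Num.max u0 u1); [rewrite le_max lexx|apply: u1P; rewrite le_max lexx orbT].
- exact: lower_dim_ge.
- exact: upper_dim_le.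
- apply: upper_dim_ge => e u0 /h1[u1 u1P].
  by exists (Num.max u0 u1); [rewrite le_max lexx|apply: u1P; rewrite le_max lexx orbT].
Qed.

Context (x_supp : forall r, 0 < r -> (0 < mu (ball x r))%E).

Lemma fine_ball_gt0 r : 0 < r -> 0 < fine (mu (ball x r)).
Proof.
move=> /x_supp h; apply: fine_gt0; rewrite h /=.
by apply: le_lt_trans (probability_le1 _ _) (ltry _); exact: ball_measurable.
Qed.

Lemma fine_mu_le (A B : set R) : measurable A -> measurable B -> A `<=` B ->
  fine (mu A) <= fine (mu B).
Proof.
move=> mA mB AB; apply: fine_le; rewrite ?fin_num_measure//.
by apply: le_measure; rewrite ?inE.
Qed.

Lemma ball_decay_ge0 u : 0 <= ball_decay u.
Proof.
rewrite oppr_ge0 -ln1 ler_ln ?posrE ?fine_ball_gt0 ?expR_gt0//.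
rewrite -lee_fin fineK ?fin_num_measure//; last exact: ball_measurable.
by apply: probability_le1; exact: ball_measurable.
Qed.

Lemma ball_decay_homo u v : u <= v -> ball_decay u <= ball_decay v.
Proof.
move=> uv; rewrite lerN2 ler_ln ?posrE ?fine_ball_gt0 ?expR_gt0//.
apply: fine_mu_le; try exact: ball_measurable.
by apply: le_ball; rewrite ler_expR lerN2.
Qed.

End LocalDimensionBounds.

(** * Composition of similarities *)

Section SimilarityAlgebra.
Context {R : realType}.
Implicit Types (f g h : sim R) (x y : R).

Lemma sim_eq f g : f.1 = g.1 -> f.2 = g.2 -> f = g.
Proof. by case: f g => [a b] [c d] /= -> ->. Qed.

Lemma sim_app_comp f g x : sim_app (sim_comp f g) x = sim_app f (sim_app g x).
Proof. by rewrite /sim_app /=; ring. Qed.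

Lemma sim_app_id x : sim_app sim_id x = x.
Proof. by rewrite /sim_app /= mul1r addr0. Qed.

Lemma sim_compA f g h : sim_comp f (sim_comp g h) = sim_comp (sim_comp f g) h.
Proof. by apply: sim_eq; rewrite /=; ring. Qed.

Lemma sim_comp1l f : sim_comp sim_id f = f.
Proof. by apply: sim_eq; rewrite /=; ring. Qed.

Lemma sim_comp1r f : sim_comp f sim_id = f.
Proof. by apply: sim_eq; rewrite /=; ring. Qed.

Lemma sim_compVl f : f.1 != 0 -> sim_comp (sim_inv f) f = sim_id.
Proof. by move=> f0; apply: sim_eq; rewrite /=; field. Qed.

Lemma sim_compVr f : f.1 != 0 -> sim_comp f (sim_inv f) = sim_id.
Proof. by move=> f0; apply: sim_eq; rewrite /=; field. Qed.

Lemma sim_comp_inj f g h : f.1 != 0 -> sim_comp f g = sim_comp f h -> g = h.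
Proof.
by move=> f0 e; rewrite -(sim_comp1l g) -(sim_comp1l h) -(sim_compVl f0) -!sim_compA e.
Qed.

Lemma sim_compKV f g : f.1 != 0 -> sim_comp f (sim_comp (sim_inv f) g) = g.
Proof. by move=> f0; rewrite sim_compA sim_compVr// sim_comp1l. Qed.

Lemma sim_compK f g : f.1 != 0 -> sim_comp (sim_inv f) (sim_comp f g) = g.
Proof. by move=> f0; rewrite sim_compA sim_compVl// sim_comp1l. Qed.

Lemma sim_appK f x : f.1 != 0 -> sim_app (sim_inv f) (sim_app f x) = x.
Proof. by move=> f0; rewrite -sim_app_comp sim_compVl// sim_app_id. Qed.

Lemma sim_appVK f x : f.1 != 0 -> sim_app f (sim_app (sim_inv f) x) = x.
Proof. by move=> f0; rewrite -sim_app_comp sim_compVr// sim_app_id. Qed.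

Lemma sim_app_ltr f x y : 0 < f.1 -> (sim_app f x < sim_app f y) = (x < y).
Proof. by move=> f0; rewrite /sim_app ltrD2r ltr_pM2l. Qed.

Lemma sim_app_ler f x y : 0 < f.1 -> (sim_app f x <= sim_app f y) = (x <= y).
Proof. by move=> f0; rewrite /sim_app lerD2r ler_pM2l. Qed.

Lemma sim_app01 f x a b : 0 <= x <= 1 -> a <= sim_app f 0 <= b ->
  a <= sim_app f 1 <= b -> a <= sim_app f x <= b.
Proof.
rewrite /sim_app mulr0 add0r mulr1 => /andP[x0 x1] /andP[h1 h2] /andP[h3 h4].
by apply/andP; split; nra.
Qed.

Lemma sim_app_dist f x y : `|sim_app f x - sim_app f y| = `|f.1| * `|x - y|.
Proof. by rewrite -normrM /sim_app; congr (`|_|); ring. Qed.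

End SimilarityAlgebra.

(** * Suprema and uniform bounds over finite sets *)

Lemma sup_max {R : realType} (A : set R) x :
  A x -> (forall y, A y -> y <= x) -> sup A = x.
Proof.
move=> Ax xA; apply/eqP; rewrite eq_le; apply/andP; split.
  by apply: ge_sup => //; exists x.
by apply: ub_le_sup => //; exists x.
Qed.

Lemma finite_max {R : realType} (T : choiceType) (A : set T) (f : T -> R) :
  finite_set A -> A !=set0 -> exists2 x, A x & forall y, A y -> f y <= f x.
Proof.
move=> /finite_seqP[s ->] []; elim: s => [//|a s IH] x0 _.
case: s IH => [|b s] IH.
  by exists a => [|y]; rewrite /= inE// => /eqP ->.
have [|x /= xs xP] := IH b; first by rewrite /= inE eqxx.
have [fax|fxa] := leP (f a) (f x).
  exists x => [|y]; rewrite /= in_cons ?xs ?orbT// => /orP[/eqP ->//|].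
  exact: xP.
exists a => [|y]; rewrite /= in_cons ?eqxx// => /orP[/eqP ->//|/xP yx].
exact: le_trans yx (ltW fxa).
Qed.

(** Turns constants depending on a vertex, an edge or a letter into uniform
    ones; finiteness of the transition graph is used through this lemma. *)
Lemma finite_uniform (T : choiceType) (A : set T) (P : T -> nat -> Prop) :
  finite_set A -> (forall x n k, (n <= k)%N -> P x n -> P x k) ->
  (forall x, A x -> exists n, P x n) -> exists n, forall x, A x -> P x n.
Proof.
move=> /finite_seqP[s ->] Pmono; elim: s => [|a s IH] AP.
  by exists 0%N.
have [|n nP] := IH; first by move=> x xs; apply: AP; rewrite /= inE xs orbT.
have [|k kP] := AP a; first by rewrite /= inE eqxx.
exists (maxn n k) => x; rewrite /= inE => /orP[/eqP ->|xs].
  exact: Pmono (leq_maxr _ _) kP.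
exact: Pmono (leq_maxl _ _) (nP _ xs).
Qed.

Lemma finite_lower_bound {R : realType} (T : choiceType) (A : set T) (P : T -> R -> Prop) :
  finite_set A -> (forall x c d, 0 < c -> c <= d -> P x d -> P x c) ->
  (forall x, A x -> exists2 c, 0 < c & P x c) ->
  exists2 c, 0 < c & forall x, A x -> P x c.
Proof.
move=> finA Pmono AP.
have [//| | |n nP] := @finite_uniform T A (fun x n => P x n.+1%:R^-1).
- move=> x n k nk; apply: Pmono; first by rewrite invr_gt0.
  by rewrite lef_pV2 ?posrE// ler_nat ltnS.
- move=> x /AP[c c0 cP]; exists (Num.truncn c^-1).
  by apply: Pmono (inv_nat_le c0) cP; rewrite invr_gt0.
by exists n.+1%:R^-1; rewrite ?invr_gt0.
Qed.

(** * Sequences of quadratic growth *)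

Section QuadraticGrowth.
Context {R : realType}.
Implicit Types (e C a : R) (w y : nat -> R).

Lemma linear_le_quadratic C e : 0 < e ->
  exists k0, forall k, (k0 <= k)%N -> C * k.+1%:R <= e * k%:R ^+ 2.
Proof.
move=> e0; have [u0 u01 u0P] := const_le_linear (2 * `|C|) e0.
exists (Num.truncn u0).+1 => k uk.
have ku : u0 <= k%:R by exact: nat_above.
have := u0P _ ku; have : 1 <= k%:R :> R by exact: le_trans ku.
rewrite -(natr1 k); move: (k%:R : R) => x x1 h.
have := ler_norm C; have := normr_ge0 C; move: `|C| h => c h c0 cC.
apply: (@le_trans _ _ (2 * c * x)); last by rewrite expr2 mulrA; apply: ler_wpM2r; lra.
rewrite [2 * c]mulrC -mulrA; apply: (@le_trans _ _ (c * (x + 1))).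
  by apply: ler_wpM2r; lra.
by apply: ler_wpM2l; lra.
Qed.

Lemma quadratic_infty w C : (forall k, `|w k - k%:R ^+ 2| <= C * k.+1%:R) ->
  forall u, exists k0, forall k, (k0 <= k)%N -> u <= w k.
Proof.
move=> wC u; have h0 : 0 < 2^-1 :> R by rewrite invr_gt0.
have [k0 k0P] := linear_le_quadratic (C + `|u|) h0.
exists (maxn 1 k0) => k; rewrite geq_max => /andP[k1 /k0P h].
have := wC k; rewrite ler_norml => /andP[wk _].
have := ler_norm u; have := normr_ge0 u.
have k1' : 1 <= k%:R :> R by rewrite ler1n.
move: h wk; rewrite -(natr1 k); move: (k%:R : R) k1' (w k) => x x1 z; rewrite mulrDl => h wk u0 uu.
have h' : `|u| <= `|u| * (x + 1) by rewrite ler_peMr//; lra.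
have := sqr_ge0 x; move: (`|u| * (x + 1)) (C * (x + 1)) (x ^+ 2) h h' wk => *; lra.
Qed.

(** The difference w k.+1 - w k is at most linear in k, and w k is quadratic. *)
Lemma quadratic_slow w C : (forall k, `|w k - k%:R ^+ 2| <= C * k.+1%:R) ->
  forall e, 0 < e -> exists k0, forall k, (k0 <= k)%N -> w k.+1 <= (1 + e) * w k.
Proof.
move=> wC e e0; pose c := `|C|.
have c0 : 0 <= c by exact: normr_ge0.
have [k0 k0P] := linear_le_quadratic (2 + 3 * c + e * c) e0.
exists k0 => k /k0P h.
have := wC k; have := wC k.+1; rewrite !ler_norml => /andP[_ h1] /andP[h2 _].
have n1 : k.+1%:R = k%:R + 1 :> R by rewrite natr1.
have n2 : k.+2%:R = k%:R + 2 :> R by rewrite -natr1 n1; ring.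
have Cc : C <= c by exact: ler_norm.
have k0' : 0 <= k%:R :> R by [].
move: h h1 h2; rewrite n1 n2; move: (k%:R : R) k0' (w k) (w k.+1) => x x0 z z' h h1 h2.
have h3' : C * (x + 2) <= c * (x + 2) by apply: ler_wpM2r => //; lra.
have h3 : z' <= (x + 1) ^+ 2 + c * (x + 2) by lra.
have h4' : C * (x + 1) <= c * (x + 1) by apply: ler_wpM2r => //; lra.
have h4 : x ^+ 2 - c * (x + 1) <= z by lra.
have h5 : (1 + e) * (x ^+ 2 - c * (x + 1)) <= (1 + e) * z by apply: ler_wpM2l => //; lra.
nra.
Qed.

(** A sequence asymptotic to a k ^+ 2 is asymptotic to a w k, as w k differs
    from k ^+ 2 by O(k). *)
Lemma quadratic_compare w y a C : (forall k, `|w k - k%:R ^+ 2| <= C * k.+1%:R) ->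
  (forall e, 0 < e -> exists k0, forall k, (k0 <= k)%N -> `|y k - a * k%:R ^+ 2| <= e * k%:R ^+ 2) ->
  forall e, 0 < e -> exists k0, forall k, (k0 <= k)%N -> `|y k - a * w k| <= e * w k.
Proof.
move=> wC ya e e0; have e2 : 0 < e / 2 by lra.
have [k1 k1P] := ya _ e2.
have [k2 k2P] := linear_le_quadratic ((`|a| + e) * `|C|) e2.
exists (maxn k1 k2) => k; rewrite geq_max => /andP[/k1P h1 /k2P h2].
have := wC k => h3.
have h4 : `|w k - k%:R ^+ 2| <= `|C| * k.+1%:R.
  by apply: le_trans h3 _; apply: ler_wpM2r => //; exact: ler_norm.
have h5 : `|a * k%:R ^+ 2 - a * w k| <= `|a| * (`|C| * k.+1%:R).
  by rewrite -mulrBr normrM distrC ler_wpM2l.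
have h6 : e * (k%:R ^+ 2 - w k) <= e * (`|C| * k.+1%:R).
  apply: ler_wpM2l; first exact: ltW.
  by apply: le_trans h4; rewrite -normrN opprB ler_norm.
have h7 := ler_distD (a * k%:R ^+ 2) (y k) (a * w k).
apply: le_trans h7 _; apply: le_trans (lerD h1 h5) _.
have h2' : `|a| * (`|C| * k.+1%:R) + e * (`|C| * k.+1%:R) <= e / 2 * k%:R ^+ 2.
  by rewrite -mulrDl mulrA.
rewrite mulrBr in h6; lra.
Qed.

End QuadraticGrowth.

(** * Words and the attractor *)

Record ifs_attractor (R : realType) (m : nat) (S : 'I_m -> sim R) (K : set R) :
    Prop := IfsAttractor {
  ifs_ratio : forall i, 0 < `|(S i).1| < 1;
  ifs_inj : injective S;
  ifs_compact : compact K;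
  ifs_nonempty : K !=set0;
  ifs_invariant : K = \bigcup_i (sim_app (S i) @` K);
  ifs_hull : convex_hull K = `[0, 1]%classic }.

Section SelfSimilarMeasure.
Context {R : realType} {m : nat} {S : 'I_m -> sim R} {K : set R}.
Context (HS : ifs_attractor S K).
Context {p : 'I_m -> R} {mu : probability (measurableTypeR R) R}.
Context (p_gt0 : forall i, 0 < p i) (p_sum1 : \sum_i p i = 1).
Context (mu_invariant : forall E : set (measurableTypeR R), measurable E ->
  mu E = (\sum_i (p i)%:E * mu (sim_app (S i) @^-1` E))%E).
Context (fnc : finite_neighbour_condition S K) (le : rel (sim R)).

Local Notation GV := (graph_vertices S K).
Local Notation GE := (graph_edges S K).
Local Notation amin := (alpha_min S K le p).
Local Notation amax := (alpha_max S K le p).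
Local Notation root := [set sim_id : sim R].

Section Words.
Implicit Types (s u w : seq 'I_m) (t : R).

Lemma word_map_cat s u : word_map S (s ++ u) = sim_comp (word_map S s) (word_map S u).
Proof. by elim: s => [|i s IH] /=; rewrite ?sim_comp1l// IH sim_compA. Qed.

Lemma word_map_rcons s l : word_map S (rcons s l) = sim_comp (word_map S s) (S l).
Proof. by rewrite -cats1 word_map_cat /= sim_comp1r. Qed.

Lemma ratio_word_map s : (word_map S s).1 = word_ratio S s.
Proof.
by elim: s => [|i s IH] /=; rewrite ?IH /word_ratio ?big_nil// big_cons.
Qed.

Lemma word_ratio_cat s u : word_ratio S (s ++ u) = word_ratio S s * word_ratio S u.
Proof. by rewrite /word_ratio big_cat. Qed.

Lemma word_ratio_nil : word_ratio S [::] = 1.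
Proof. by rewrite /word_ratio big_nil. Qed.

Lemma ifs_ratio_bound : exists rho, [/\ 0 < rho, rho < 1 & forall i, `|(S i).1| <= rho].
Proof.
have [|||n nP] := @finite_uniform 'I_m setT
    (fun i n => `|(S i).1| <= 1 - n.+2%:R^-1).
- exact: finite_finset.
- move=> i n k nk /le_trans; apply; rewrite lerD2l lerN2 lef_pV2 ?posrE//.
  by rewrite ler_nat !ltnS.
- move=> i _; have /andP[_ r1] := ifs_ratio HS i.
  exists (Num.truncn (1 - `|(S i).1|)^-1).+1; rewrite lerBrDl -lerBrDr.
  have d0 : 0 < 1 - `|(S i).1| by rewrite subr_gt0.
  by apply: le_trans (inv_nat_le d0); rewrite lef_pV2 ?posrE// ler_nat !ltnS ltnW.
exists (1 - n.+2%:R^-1); split => [||i]; last exact: nP.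
- by rewrite subr_gt0 invf_lt1// ltr1n.
- by rewrite ltrBlDr ltrDl invr_gt0.
Qed.

Lemma word_ratio_neq0 s : word_ratio S s != 0.
Proof.
rewrite /word_ratio prodf_seq_neq0; apply/allP => i _ /=.
by have /andP[] := ifs_ratio HS i; rewrite normr_gt0.
Qed.

Lemma ratio_word_map_neq0 s : (word_map S s).1 != 0.
Proof. by rewrite ratio_word_map word_ratio_neq0. Qed.

Lemma word_ratio_gt0 s : 0 < `|word_ratio S s|.
Proof. by rewrite normr_gt0 word_ratio_neq0. Qed.

Lemma word_ratio_le1 s : `|word_ratio S s| <= 1.
Proof.
elim: s => [|i s IH]; first by rewrite word_ratio_nil normr1.
rewrite -cat1s word_ratio_cat normrM /word_ratio big_seq1 mulr_ile1//.
by have /andP[_ /ltW] := ifs_ratio HS i.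
Qed.

Lemma word_ratio_lt1 s : s <> [::] -> `|word_ratio S s| < 1.
Proof.
case: s => // i s _; rewrite -cat1s word_ratio_cat normrM {1}/word_ratio big_seq1.
have /andP[i0 i1] := ifs_ratio HS i.
by apply: le_lt_trans i1; rewrite ler_piMr// word_ratio_le1.
Qed.

Lemma word_ratio_prefix s u : `|word_ratio S (s ++ u)| <= `|word_ratio S s|.
Proof. by rewrite word_ratio_cat normrM ler_piMr// word_ratio_le1. Qed.

Lemma word_ratio_prefix_lt s u : u <> [::] ->
  `|word_ratio S (s ++ u)| < `|word_ratio S s|.
Proof.
by move=> u0; rewrite word_ratio_cat normrM gtr_pMr ?word_ratio_gt0// word_ratio_lt1.
Qed.

Lemma long_words_small t : 0 < t ->
  exists n, forall s, (n <= size s)%N -> `|word_ratio S s| < t.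
Proof.
move=> t0; have [rho [rho0 rho1 rhoP]] := ifs_ratio_bound.
have [n nP] := exp_small rho0 rho1 t0.
exists n => s /nP; apply: le_lt_trans.
elim: s => [|i s IH]; first by rewrite word_ratio_nil normr1 expr0.
rewrite -cat1s word_ratio_cat normrM /word_ratio big_seq1 exprS.
by apply: ler_pM.
Qed.

Lemma LambdaP t s : Lambda S t s <->
  `|word_ratio S s| < t /\ (forall s' l, s = rcons s' l -> t <= `|word_ratio S s'|).
Proof.
rewrite /Lambda; case: ltP => t1 /=.
  split=> [->|[_ h]].
    by rewrite word_ratio_nil normr1; split => // -[].
  case/lastP: s h => // s l /(_ s l erefl) /(lt_le_trans t1).
  by rewrite ltNge word_ratio_le1.
split=> [[s' [l [-> /andP[h1 h2]]]]|[h1 h2]].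
  by split=> // s1 l1 /rcons_inj[<- _].
case/lastP: s h1 h2 => [|s l] h1 h2.
  by move: h1; rewrite word_ratio_nil normr1; lra.
by exists s, l; split => //; rewrite h1; apply: h2.
Qed.

Lemma Lambda_prefix t s : `|word_ratio S s| < t ->
  exists s' u, s = s' ++ u /\ Lambda S t s'.
Proof.
elim/last_ind: s => [|s l IH] st.
  by exists [::], [::]; split => //; apply/LambdaP; split => // -[].
have [/IH[s' [u [-> h]]]|ts] := ltP (`|word_ratio S s|) t.
  by exists s', (rcons u l); rewrite rcons_cat.
exists (rcons s l), [::]; rewrite cats0; split => //.
by apply/LambdaP; split => // s' l' /rcons_inj[<- _].
Qed.

(** Words of one generation are pairwise incomparable for the prefix order. *)
Lemma Lambda_ext t s u : `|word_ratio S s| < t -> Lambda S t (s ++ u) -> u = [::].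
Proof.
move=> st; case/lastP: u => // u l.
rewrite -rcons_cat => /LambdaP[_ /(_ _ _ erefl)] h.
by have := le_lt_trans (word_ratio_prefix s u) st; rewrite ltNge h.
Qed.

Lemma finite_words n : finite_set [set s : seq 'I_m | (size s <= n)%N].
Proof.
elim: n => [|n IH].
  by apply: (@sub_finite_set _ _ [set [::]]) => // -[].
apply: (@sub_finite_set _ _ ([set [::]] `|`
    (fun x => x.1 :: x.2) @` ([set: 'I_m] `*` [set s : seq 'I_m | (size s <= n)%N]))).
  by case=> [|i s] /= sn; [left|right; exists (i, s)].
rewrite finite_setU; split => //; apply: finite_image; apply: finite_setX => //.
Qed.

Lemma finite_Lambda t : 0 < t -> finite_set (Lambda S t).
Proof.
move=> t0; have [n nP] := long_words_small t0.
apply: sub_finite_set (finite_words n) => s /LambdaP[_ sP] /=.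
case/lastP: s sP => // s l /(_ _ _ erefl); rewrite size_rcons.
by rewrite leNgt; apply: contraNltn => h; apply: nP.
Qed.

Lemma attractor01 x : K x -> 0 <= x <= 1.
Proof.
move=> Kx; have : `[0%R, 1%R]%classic x.
  by rewrite -(ifs_hull HS); exact: sub_gen_smallest.
by rewrite /= in_itv.
Qed.

(** The interval between the minimum and the maximum of K is convex, so it
    contains the hull [0, 1]. *)
Lemma attractor_extrema : K 0 /\ K 1.
Proof.
have cid : {within K, continuous (@id R)} by apply: continuous_subspaceT => x.
have [a /set_mem Ka aK] := compact_EVT_min (ifs_nonempty HS) (ifs_compact HS) cid.
have [b /set_mem Kb bK] := compact_EVT_max (ifs_nonempty HS) (ifs_compact HS) cid.
have sub : `[0%R, 1%R]%classic `<=` `[a, b]%classic.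
  rewrite -(ifs_hull HS); apply: smallest_sub; last first.
    by move=> x Kx /=; rewrite in_itv/= aK ?bK ?inE.
  move=> x y l; rewrite !inE /= !in_itv/= => /andP[x1 x2] /andP[y1 y2].
  have l0 : 0 <= l%:num by [].
  have l1 : l%:num <= 1 by [].
  change (a <= l%:num * x + (1 - l%:num) * y <= b).
  move: (l%:num) l0 l1 => c c0 c1; apply/andP; split; nra.
have /= : `[a, b]%classic 0 by apply: sub; rewrite /= in_itv /= lexx ler01.
have /= : `[a, b]%classic 1 by apply: sub; rewrite /= in_itv /= lexx ler01.
rewrite !in_itv /= => /andP[_ b1] /andP[a0 _].
have /andP[a0' _] := attractor01 Ka; have /andP[_ b1'] := attractor01 Kb.
have a00 : a = 0 by lra.
have b11 : b = 1 by lra.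
by split; [rewrite -a00|rewrite -b11].
Qed.

Lemma attractor_map s x : K x -> K (sim_app (word_map S s) x).
Proof.
elim: s x => [|i s IH] x Kx /=; first by rewrite sim_app_id.
rewrite sim_app_comp (ifs_invariant HS); exists i => //.
by exists (sim_app (word_map S s) x) => //; exact: IH.
Qed.

Lemma word_map01 s x : 0 <= x <= 1 -> 0 <= sim_app (word_map S s) x <= 1.
Proof.
have [K0 K1] := attractor_extrema.
by move=> x01; apply: sim_app01 => //; apply: attractor01; exact: attractor_map.
Qed.

(** The images of 0 and 1 under one of the maps are points of K at a distance
    in ]0, 1[ from each other, so they are not both ends of [0, 1], and the
    one that is not lies inside. *)
Lemma attractor_inner : exists2 x, K x & 0 < x < 1.
Proof.
have [K0 K1] := attractor_extrema.
have [i _ _] : (\bigcup_i (sim_app (S i) @` K)) 0 by rewrite -(ifs_invariant HS).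
pose y := sim_app (word_map S [:: i]) 0; pose z := sim_app (word_map S [:: i]) 1.
have Ky : K y := attractor_map _ K0; have Kz : K z := attractor_map _ K1.
have /andP[i0 i1] := ifs_ratio HS i.
have yz : `|y - z| = `|(S i).1|.
  by rewrite sim_app_dist ratio_word_map /word_ratio big_seq1 sub0r normrN1 mulr1.
have [/andP[]|y01] := boolP (0 < y < 1); first by exists y => //; apply/andP.
exists z => //; have /andP[y0 y1] := attractor01 Ky; have /andP[z0 z1] := attractor01 Kz.
move: yz y01; rewrite negb_and -!leNgt => yz /orP[h|h].
- have y00 : y = 0 by lra.
  by move: yz; rewrite y00 sub0r normrN ger0_norm//; lra.
- have y00 : y = 1 by lra.
  by move: yz; rewrite y00 ger0_norm; lra.
Qed.

Lemma attractor_words n x : K x ->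
  exists s, size s = n /\ (sim_app (word_map S s) @` K) x.
Proof.
elim: n x => [|n IH] x Kx.
  by exists [::]; split => //; exists x => //=; rewrite sim_app_id.
move: Kx; rewrite {1}(ifs_invariant HS) => -[i _ [y Ky <-]].
have [s [<- [z Kz zy]]] := IH _ Ky.
by exists (i :: s); split => //; exists z => //=; rewrite sim_app_comp zy.
Qed.

Lemma attractor_cover t x : 0 < t -> K x ->
  exists2 s, Lambda S t s & (sim_app (word_map S s) @` K) x.
Proof.
move=> t0 Kx; have [n nP] := long_words_small t0.
have [s [sn [y Ky yx]]] := attractor_words n Kx.
have st : `|word_ratio S s| < t by apply: nP; rewrite sn.
have [s' [u [su s'L]]] := Lambda_prefix st.
exists s' => //; exists (sim_app (word_map S u) y); first exact: attractor_map.
by rewrite -sim_app_comp -word_map_cat -su.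
Qed.

End Words.

(** * Net intervals and their children in normalized coordinates *)

Section NormalizedChildren.
Implicit Types (D I : R * R) (f g h : sim R) (v A : vertex R).

(** In the coordinate in which a net interval D is [0, 1], that is after
    T_ D ^-1, everything about its children is determined by its neighbour
    set: the words of the next generation which meet the interior of D give
    the similarities in refine v, and the children are the slots between
    consecutive end points of their images. *)
Definition hits g I : Prop := (sim_app g @` K) `&` open_segment I !=set0.

(** By tg_scale this is the transition generation divided by the diameter. *)
Definition scale v : R := sup [set `|f.1| | f in v].

(** Neighbours of maximal ratio are cut into their first level pieces and the
    others are kept, provided that they still meet the open interval. *)
Definition refine v : vertex R := [set g | hits g (0, 1) /\
  ((v g /\ `|g.1| < scale v) \/
   exists f l, [/\ v f, `|f.1| = scale v & g = sim_comp f (S l)])].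

Definition ends A : set R :=
  [set y | exists2 g, A g & y = sim_app g 0 \/ y = sim_app g 1].

Definition slot A I : Prop :=
  [/\ [/\ 0 <= I.1, I.1 < I.2 & I.2 <= 1], I.1 = 0 \/ ends A I.1,
      I.2 = 1 \/ ends A I.2, open_segment I `&` ends A = set0 &
      exists2 g, A g & hits g I].

(** The neighbour set of the child occupying the slot I. *)
Definition slot_nb A I : vertex R :=
  [set h | exists g, [/\ A g, hits g I & h = sim_comp (sim_inv (T_ I)) g]].

Definition place D I : R * R := (sim_app (T_ D) I.1, sim_app (T_ D) I.2).

Definition unplace D I : R * R :=
  (sim_app (sim_inv (T_ D)) I.1, sim_app (sim_inv (T_ D)) I.2).

End NormalizedChildren.

Section NetIntervalGeometry.
Implicit Types (s u w : seq 'I_m) (t : R) (D I : R * R) (f g h : sim R)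
  (v A : vertex R).

Lemma open_segmentE I x : open_segment I x <-> I.1 < x < I.2.
Proof. by rewrite /open_segment /= in_itv. Qed.

Lemma segmentE I x : segment I x <-> I.1 <= x <= I.2.
Proof. by rewrite /segment /= in_itv. Qed.

Lemma ratio_T D : (T_ D).1 = D.2 - D.1. Proof. by []. Qed.

Lemma ratio_T_gt0 D : D.1 < D.2 -> 0 < (T_ D).1.
Proof. by rewrite ratio_T subr_gt0. Qed.

Lemma ratio_T_neq0 D : D.1 < D.2 -> (T_ D).1 != 0.
Proof. by move=> /ratio_T_gt0 /lt0r_neq0. Qed.

Lemma T_place D I : T_ (place D I) = sim_comp (T_ D) (T_ I).
Proof.
case: D I => [a b] [c d]; apply: sim_eq; cbv [T_ place sim_comp sim_app diam fst snd]; ring.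
Qed.

Lemma place_unit D : place D (0, 1) = D.
Proof. by case: D => a b; rewrite /place /sim_app /= /diam /= mulr0 add0r mulr1 subrK. Qed.

Lemma unplaceK D I : D.1 < D.2 -> place D (unplace D I) = I.
Proof. by move=> DD; case: I => a b; rewrite /place !sim_appVK ?ratio_T_neq0. Qed.

Lemma open_segment_place D I x : D.1 < D.2 ->
  open_segment (place D I) (sim_app (T_ D) x) <-> open_segment I x.
Proof. by move=> DD; rewrite !open_segmentE !sim_app_ltr ?ratio_T_gt0. Qed.

Lemma hits_place D I g : D.1 < D.2 -> hits (sim_comp (T_ D) g) (place D I) <-> hits g I.
Proof.
move=> DD; split=> -[y [[x Kx <-]]].
- rewrite sim_app_comp open_segment_place// => h.
  by exists (sim_app g x); split => //; exists x.
- move=> h; exists (sim_app (T_ D) (sim_app g x)); split.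
    by exists x => //; rewrite sim_app_comp.
  by rewrite open_segment_place.
Qed.

(** 0 and 1 belong to K. *)
Lemma endpoint_hits s D y : y = sim_app (word_map S s) 0 \/ y = sim_app (word_map S s) 1 ->
  open_segment D y -> hits (word_map S s) D.
Proof.
have [K0 K1] := attractor_extrema.
case=> -> h.
  by exists (sim_app (word_map S s) 0); split => //; exists 0.
by exists (sim_app (word_map S s) 1); split => //; exists 1.
Qed.

Lemma hits_sub s D D' : open_segment D `<=` open_segment D' ->
  hits (word_map S s) D -> hits (word_map S s) D'.
Proof. by move=> DD' [x [h /DD']]; exists x. Qed.

Lemma hits_prefix s u D : hits (word_map S (s ++ u)) D -> hits (word_map S s) D.
Proof.
move=> [x [[k Kk <-] h]]; exists (sim_app (word_map S (s ++ u)) k); split => //.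
exists (sim_app (word_map S u) k); first exact: attractor_map.
by rewrite word_map_cat sim_app_comp.
Qed.

Lemma finite_endpoints t : 0 < t -> finite_set (endpoints S t).
Proof.
move=> t0; apply: (@sub_finite_set _ _
  ((fun s => sim_app (word_map S s) 0) @` Lambda S t `|`
   (fun s => sim_app (word_map S s) 1) @` Lambda S t)).
  by move=> y [s sL [->|->]]; [left|right]; exists s.
by rewrite finite_setU; split; apply: finite_image; apply: finite_Lambda _ _.
Qed.

(** An extreme point of [0, 1] belongs to some S_l(K), and as S_l maps [0, 1]
    into itself, it can only be the image of an extreme point. *)
Lemma letter_onto_extreme y : y = 0 \/ y = 1 ->
  exists l, y = sim_app (S l) 0 \/ y = sim_app (S l) 1.
Proof.
have [K0 K1] := attractor_extrema => y01.
have Ky : K y by case: y01 => ->.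
move: Ky; rewrite {1}(ifs_invariant HS) => -[l _ [k Kk ky]]; exists l.
have /andP[k0 k1] := attractor01 Kk.
have := word_map01 [:: l] (x := 0); rewrite /= sim_comp1r lexx ler01 => /(_ isT).
have := word_map01 [:: l] (x := 1); rewrite /= sim_comp1r lexx ler01 => /(_ isT).
have : (S l).1 != 0 by have /andP[] := ifs_ratio HS l; rewrite normr_gt0.
move: ky; rewrite /sim_app; move: (S l).1 (S l).2 => r d ky r0 h1 h2.
have rp : (0 < r) || (r < 0) by rewrite orbC -neq_lt.
have [k00|k00] := eqVneq k 0; first by left; rewrite -ky k00.
have [k11|k11] := eqVneq k 1; first by right; rewrite -ky k11.
have k0' : 0 < k by rewrite lt_neqAle eq_sym k00.
have k1' : k < 1 by rewrite lt_neqAle k11.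
case: y01 => yE; subst y; case/orP: rp => rr; exfalso; nra.
Qed.

(** By letter_onto_extreme an end point of the image under S_s is an end point
    of the image under S_(s l) for some letter l; extend the word in this way
    until its ratio falls below t'. *)
Lemma endpoints_mono t t' : 0 < t' -> t' <= t -> endpoints S t `<=` endpoints S t'.
Proof.
move=> t'0 t't y [s sL ysE].
have [n nP] := long_words_small t'0.
have {nP} step k : forall s', Lambda S t s -> (exists u, s' = s ++ u) ->
   t' <= `|word_ratio S s'| \/ Lambda S t' s' -> (n - size s' <= k)%N ->
   (y = sim_app (word_map S s') 0 \/ y = sim_app (word_map S s') 1) ->
   endpoints S t' y.
  elim: k => [|k IH] s' sL' [u su] [h|h] ns ys'; try by exists s'.
    have /nP : (n <= size s')%N by rewrite -subn_eq0 -leqn0.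
    by rewrite ltNge h.
  have [z z01 yz] : exists2 z, z = 0 \/ z = 1 & y = sim_app (word_map S s') z.
    by case: ys' => ->; [exists 0|exists 1]; auto.
  have [l lz] := letter_onto_extreme z01.
  apply: (IH (rcons s' l)) => //.
  - by exists (rcons u l); rewrite su rcons_cat.
  - have [?|?] := leP t' `|word_ratio S (rcons s' l)|; [by left|right].
    by apply/LambdaP; split => // s1 l1 /rcons_inj[<- _].
  - by rewrite size_rcons; lia.
  - by rewrite word_map_rcons !sim_app_comp yz; case: lz => ->; auto.
apply: (step _ s) => //; first by exists [::]; rewrite cats0.
have [?|st'] := leP t' `|word_ratio S s|; [by left|right].
apply/LambdaP; split => // s' l sE.
by move/LambdaP: sL => -[_ /(_ _ _ sE)]; exact: le_trans.
Qed.

Lemma endpoints01 t : 0 < t -> endpoints S t 0 /\ endpoints S t 1.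
Proof.
move=> t0; have h : endpoints S 2 `|` endpoints S (t + 2) `<=` endpoints S t.
  have : endpoints S (t + 2) `<=` endpoints S t.
    by apply: endpoints_mono; lra.
  have [t2|t2] := leP t 2.
    have h2 : endpoints S 2 `<=` endpoints S t by apply: endpoints_mono.
    by move=> h y [/h2|/h].
  move=> h y [|/h//]; move=> [s]; rewrite /Lambda.
  rewrite ltr1n /= => -> h'; exists [::] => //.
  by rewrite /Lambda ifT//; lra.
split; apply: h; left; exists [::]; rewrite /Lambda ?ltr1n//=.
- by left; rewrite sim_app_id.
- by right; rewrite sim_app_id.
Qed.

End NetIntervalGeometry.

Section Children.
Implicit Types (s u w : seq 'I_m) (t : R) (D I : R * R) (f g h : sim R)
  (v A : vertex R).

Section OneNetInterval.
Context {t : R} {D : R * R} (t0 : 0 < t) (netD : net_interval S K t D).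
Let v := neighbour_set S K t D.

Lemma net_lt : D.1 < D.2.
Proof. by case: netD. Qed.

Lemma contributes_nonempty : (contributes S K t D) !=set0.
Proof.
case: netD => _ _ _ _ [x [xD Kx]].
by have [s sL sx] := attractor_cover t0 Kx; exists s; split => //; exists x.
Qed.

Lemma finite_contributes : finite_set (contributes S K t D).
Proof. by apply: sub_finite_set (finite_Lambda t0) => s []. Qed.

Lemma tg_attained : (exists2 s, contributes S K t D s & `|word_ratio S s| = tg S K t D) /\
  forall s, contributes S K t D s -> `|word_ratio S s| <= tg S K t D.
Proof.
have [s sc smax] := finite_max (fun s => `|word_ratio S s|)
  finite_contributes contributes_nonempty.
have -> : tg S K t D = `|word_ratio S s|.
  by apply: sup_max => [|_ [u uc <-]]; [exists s|exact: smax].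
by split=> //; exists s.
Qed.

Lemma tg_gt0 : 0 < tg S K t D.
Proof. by have [[s _ <-] _] := tg_attained; exact: word_ratio_gt0 _. Qed.

Lemma tg_lt : tg S K t D < t.
Proof. by have [[s [/LambdaP[st _] _] <-] _] := tg_attained. Qed.

Lemma tg_le1 : tg S K t D <= 1.
Proof. by have [[s _ <-] _] := tg_attained; exact: word_ratio_le1 _. Qed.

Lemma neighbourP f : v f <-> exists2 s, contributes S K t D s &
  f = sim_comp (sim_inv (T_ D)) (word_map S s).
Proof. by split=> [[s [sc ->]]|[s sc ->]]; exists s. Qed.

Lemma neighbour_place f : v f -> exists2 s, contributes S K t D s &
  word_map S s = sim_comp (T_ D) f.
Proof. by move=> /neighbourP[s sc ->]; exists s => //; rewrite sim_compKV// ratio_T_neq0// net_lt. Qed.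

Lemma neighbour_hits f : v f -> hits f (0, 1).
Proof.
move=> /neighbour_place[s [_ sh] sE].
by apply/(hits_place (0,1) f net_lt); rewrite place_unit -sE.
Qed.

Lemma neighbour_neq0 f : v f -> f.1 != 0.
Proof.
move=> /neighbour_place[s _ sE]; have := ratio_word_map_neq0 s.
by rewrite sE /= mulf_eq0 negb_or => /andP[].
Qed.

Lemma neighbour_nonempty : v !=set0.
Proof.
have [s sc] := contributes_nonempty; exists (sim_comp (sim_inv (T_ D)) (word_map S s)).
by apply/neighbourP; exists s.
Qed.

Lemma finite_neighbour_set : finite_set v.
Proof.
apply: (@sub_finite_set _ _
  ((fun s => sim_comp (sim_inv (T_ D)) (word_map S s)) @` contributes S K t D)).
  by move=> f /neighbourP[s sc ->]; exists s.
by apply: finite_image; exact: finite_contributes.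
Qed.

Lemma neighbour_ratio s :
  `|(sim_comp (sim_inv (T_ D)) (word_map S s)).1| = `|word_ratio S s| / diam D.
Proof.
rewrite [X in `|X|]/= -/(diam D) normrM ratio_word_map normfV mulrC.
by rewrite (gtr0_norm (x := diam D))// /diam subr_gt0 net_lt.
Qed.

Lemma diam_gt0 : 0 < diam D.
Proof. by rewrite subr_gt0 net_lt. Qed.

Lemma scale_max : (exists2 f, v f & `|f.1| = scale v) /\
  forall f, v f -> `|f.1| <= scale v.
Proof.
have [f vf fmax] := finite_max (fun f => `|f.1|) finite_neighbour_set neighbour_nonempty.
have -> : scale v = `|f.1| by apply: sup_max => [|_ [g vg <-]]; [exists f|exact: fmax].
by split => //; exists f.
Qed.

Lemma tg_scale : tg S K t D = scale v * diam D.
Proof.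
have [[s sc sE] smax] := tg_attained.
suff -> : scale v = tg S K t D / diam D by rewrite divfK// gt_eqF// diam_gt0.
apply: sup_max => [|_ [g /neighbourP[u uc ->] <-]].
  exists (sim_comp (sim_inv (T_ D)) (word_map S s)).
    by apply/neighbourP; exists s.
  by rewrite neighbour_ratio sE.
by rewrite neighbour_ratio ler_pM2r ?invr_gt0 ?diam_gt0// smax.
Qed.

Lemma scale_gt0 : 0 < scale v.
Proof. by have := tg_gt0; rewrite tg_scale pmulr_lgt0// diam_gt0. Qed.

(** A word of generation tg D extends a contributing word s of generation t.
    If the ratio of s is below tg D then s itself is of generation tg D, and
    otherwise this ratio equals tg D, which is maximal, so that one more
    letter is enough. *)
Lemma contributes_next w : contributes S K (tg S K t D) D w <->
  hits (word_map S w) D /\ exists2 s, contributes S K t D s &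
    (w = s /\ `|word_ratio S s| < tg S K t D) \/
    (exists l, w = rcons s l /\ `|word_ratio S s| = tg S K t D).
Proof.
have [_ tgmax] := tg_attained.
split=> [[wL wh]|[wh [s sc [[wE st]|[l [wE sE]]]]]]; rewrite ?wE in wh *; split => //.
- have /LambdaP[wtg _] := wL.
  have [s [u [wE sL]]] := Lambda_prefix (lt_trans wtg tg_lt).
  have sc : contributes S K t D s.
    by split => //; rewrite wE in wh; exact: hits_prefix _ _ _ wh.
  exists s => //; have := tgmax _ sc; rewrite le_eqVlt => /orP[/eqP sE|st].
    right; case: u wE => [|l u] wE.
      by move: wtg; rewrite wE cats0 sE ltxx.
    exists l; split=> //; move: wE; rewrite -cat_rcons => wE.
    suff u0 : u = [::] by rewrite wE u0 cats0.
    apply: (Lambda_ext (t := tg S K t D) (s := rcons s l)); last by rewrite -wE.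
    by rewrite -sE -cats1 word_ratio_prefix_lt.
  left; split=> //; rewrite wE -[RHS]cats0; congr (_ ++ _).
  by apply: (Lambda_ext st); rewrite -wE.
- by case: sc => /LambdaP[_ h] _; apply/LambdaP; split => // s' l /h; apply: le_trans; exact: ltW tg_lt.
- apply/LambdaP; split; first by rewrite -sE -cats1 word_ratio_prefix_lt.
  by move=> s' l' /rcons_inj[<- _]; rewrite sE.
Qed.

Lemma refineP g : refine v g <-> exists2 w, contributes S K (tg S K t D) D w &
  g = sim_comp (sim_inv (T_ D)) (word_map S w).
Proof.
have DD := net_lt; have tgE := tg_scale; have dD := diam_gt0.
have sD (r : R) : (r / diam D < scale v) = (r < tg S K t D).
  by rewrite ltr_pdivrMr// tgE.
have sDe (r : R) : (r / diam D == scale v) = (r == tg S K t D).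
  by rewrite tgE -(inj_eq (mulIf (lt0r_neq0 dD))) divfK// gt_eqF.
have hitE w : hits (sim_comp (sim_inv (T_ D)) (word_map S w)) (0, 1) <-> hits (word_map S w) D.
  rewrite -(hits_place (D := D))// place_unit sim_compKV// ratio_T_neq0//.
split=> [[gh [[/neighbourP[s sc gE] gs]|[f [l [/neighbourP[s sc fE] fs gE]]]]]|].
- exists s => //; apply/contributes_next; split.
    by apply/hitE; rewrite -gE.
  by exists s => //; left; split => //; rewrite -sD -neighbour_ratio -gE.
- have gE' : g = sim_comp (sim_inv (T_ D)) (word_map S (rcons s l)).
    by rewrite word_map_rcons sim_compA -fE.
  exists (rcons s l) => //; apply/contributes_next; split.
    by apply/hitE; rewrite -gE'.
  exists s => //; right; exists l; split => //.
  by apply/eqP; rewrite -sDe -neighbour_ratio -fE fs.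
- move=> [w /contributes_next[wh [s sc wP]] ->]; split; first exact/hitE.
  case: wP => [[-> st]|[l [-> sE]]].
    by left; split; [apply/neighbourP; exists s|rewrite neighbour_ratio sD].
  right; exists (sim_comp (sim_inv (T_ D)) (word_map S s)), l; split.
  + by apply/neighbourP; exists s.
  + by rewrite neighbour_ratio; apply/eqP; rewrite sDe sE.
  + by rewrite word_map_rcons sim_compA.
Qed.

Lemma endpoints_inside y : open_segment D y ->
  endpoints S (tg S K t D) y <-> exists2 w, contributes S K (tg S K t D) D w &
    y = sim_app (word_map S w) 0 \/ y = sim_app (word_map S w) 1.
Proof.
move=> yD; split=> [[w wL yw]|[w [wL _] yw]]; exists w => //.
by split => //; exact: (endpoint_hits yw yD).
Qed.

Lemma endsP y : ends (refine v) y <-> exists2 w, contributes S K (tg S K t D) D w &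
  sim_app (T_ D) y = sim_app (word_map S w) 0 \/ sim_app (T_ D) y = sim_app (word_map S w) 1.
Proof.
have DD := ratio_T_neq0 net_lt.
split=> [[g /refineP[w wc ->] yE]|[w wc yE]].
  by exists w => //; case: yE => ->; rewrite sim_app_comp sim_appVK//; auto.
exists (sim_comp (sim_inv (T_ D)) (word_map S w)); first by apply/refineP; exists w.
by rewrite !sim_app_comp -(sim_appK y DD); case: yE => ->; auto.
Qed.

Lemma net_endpoints_next : endpoints S (tg S K t D) D.1 /\ endpoints S (tg S K t D) D.2.
Proof.
by case: netD => e1 e2 _ _ _; split; apply: (endpoints_mono tg_gt0 (ltW tg_lt)).
Qed.

Lemma place_inner I : 0 <= I.1 -> I.2 <= 1 -> forall y,
  open_segment I y -> open_segment D (sim_app (T_ D) y).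
Proof.
move=> I1 I2 y /open_segmentE/andP[y1 y2].
have : open_segment (0, 1) y by apply/open_segmentE; apply/andP; split => /=; lra.
by move/(open_segment_place _ _ net_lt); rewrite place_unit.
Qed.

(** The relative positions of the children of D are the slots of refine v, so
    they depend on the neighbour set only. *)
Lemma child_place I : child S K t D (place D I) <-> slot (refine v) I.
Proof.
have DD := net_lt; have Dp := ratio_T_gt0 DD; have Dn := ratio_T_neq0 DD.
have [eD1 eD2] := net_endpoints_next.
have app0 : sim_app (T_ D) 0 = D.1 by rewrite /sim_app mulr0 add0r.
have app1 : sim_app (T_ D) 1 = D.2 by rewrite /sim_app mulr1 /= /diam subrK.
have openD y : 0 < y < 1 -> open_segment D (sim_app (T_ D) y).
  by move=> y01; apply/open_segmentE; rewrite -[D.1]app0 -[D.2]app1 !sim_app_ltr.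
have endsE y : 0 < y < 1 -> endpoints S (tg S K t D) (sim_app (T_ D) y) <-> ends (refine v) y.
  by move=> /openD yD; rewrite endpoints_inside// endsP.
have ends_endpoints y : ends (refine v) y -> endpoints S (tg S K t D) (sim_app (T_ D) y).
  by move=> /endsP[w [wL _] yw]; exists w.
split.
- move=> [[e1 e2 I12 Ie [x [xI Kx]]] sub].
  have {}I12 : I.1 < I.2 by move: I12; rewrite sim_app_ltr.
  have /sub/segmentE : segment (place D I) (place D I).1.
    by apply/segmentE; rewrite lexx /= sim_app_ler// ltW.
  have /sub/segmentE : segment (place D I) (place D I).2.
    by apply/segmentE; rewrite lexx andbT /= sim_app_ler// ltW.
  rewrite -[D.1]app0 -[D.2]app1 !sim_app_ler// => /andP[h1 h2] /andP[h3 h4].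
  have endE y : 0 <= y -> y <= 1 -> endpoints S (tg S K t D) (sim_app (T_ D) y) ->
    [\/ y = 0, y = 1 | ends (refine v) y].
    move=> y0 y1 ye; have [->|yn0] := eqVneq y 0; first by constructor 1.
    have [->|yn1] := eqVneq y 1; first by constructor 2.
    by constructor 3; apply/endsE => //; rewrite !lt_neqAle yn1 eq_sym yn0 y0 y1.
  split => //.
  + by have [||] := endE _ h3 h4 e1; auto; lra.
  + by have [||] := endE _ h1 h2 e2; auto; lra.
  + apply/seteqP; split => // y [yI /ends_endpoints ye].
    have : (open_segment (place D I) `&` endpoints S (tg S K t D)) (sim_app (T_ D) y).
      by split=> //; rewrite open_segment_place.
    by rewrite Ie.
  + have [w wL wx] := attractor_cover tg_gt0 Kx.
    have wI : hits (word_map S w) (place D I) by exists x.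
    exists (sim_comp (sim_inv (T_ D)) (word_map S w)).
      apply/refineP; exists w => //; split => //.
      apply: hits_sub wI => y /open_segmentE y12; apply/open_segmentE.
      move: y12; rewrite -[y](sim_appVK _ Dn) !sim_app_ltr// -[D.1]app0 -[D.2]app1 !sim_app_ltr//; lra.
    by rewrite -(hits_place (D := D))// sim_compKV.
- move=> [[I1 I12 I2] e1 e2 Ie [g /refineP[w [wL wh] gE] gI]].
  have sub : segment (place D I) `<=` segment D.
    move=> y /segmentE y12; apply/segmentE; move: y12.
    by rewrite -[y](sim_appVK _ Dn) !sim_app_ler// -[D.1]app0 -[D.2]app1 !sim_app_ler//; lra.
  split => //; split.
  + by rewrite /place /=; case: e1 => [->|/ends_endpoints//]; rewrite app0.
  + by rewrite /place /=; case: e2 => [->|/ends_endpoints//]; rewrite app1.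
  + by rewrite /= sim_app_ltr.
  + apply/seteqP; split => // y [yI ye].
    have yE : sim_app (T_ D) (sim_app (sim_inv (T_ D)) y) = y by rewrite sim_appVK.
    have yI' : open_segment I (sim_app (sim_inv (T_ D)) y).
      by rewrite -(open_segment_place _ _ DD) yE.
    have : (open_segment I `&` ends (refine v)) (sim_app (sim_inv (T_ D)) y).
      split => //; apply/endsE; last by rewrite yE.
      by move/open_segmentE: yI' => /andP[]; lra.
    by rewrite Ie.
  + have : hits (sim_comp (T_ D) g) (place D I) by rewrite hits_place.
    rewrite gE sim_compKV// => -[x [[k Kk <-] h]].
    exists (sim_app (word_map S w) k); split => //; exact: attractor_map.
Qed.

Lemma child_slot D1 : child S K t D D1 -> slot (refine v) (unplace D D1).
Proof. by move=> h; apply/child_place; rewrite unplaceK// net_lt. Qed.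

(** As for the positions, the neighbour sets of the children are functions of
    the neighbour set of D. *)
Lemma child_neighbours I : slot (refine v) I ->
  neighbour_set S K (tg S K t D) (place D I) = slot_nb (refine v) I.
Proof.
move=> [[I1 I12 I2] _ _ _ _]; have DD := net_lt.
have Dn := ratio_T_neq0 DD; have In := ratio_T_neq0 I12.
have TDI : (T_ (place D I)).1 != 0 by rewrite T_place mulf_neq0.
have key g : sim_comp (sim_inv (T_ (place D I))) (sim_comp (T_ D) g) = sim_comp (sim_inv (T_ I)) g.
  apply: (sim_comp_inj TDI); rewrite sim_compKV//.
  by rewrite T_place -sim_compA sim_compKV.
apply/seteqP; split=> h.
- move=> [w [[wL wh] ->]].
  exists (sim_comp (sim_inv (T_ D)) (word_map S w)); split.
  + apply/refineP; exists w => //; split => //.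
    apply: hits_sub wh => y yI.
    rewrite -[y](sim_appVK _ Dn); apply: place_inner I1 I2 _ _.
    by rewrite -(open_segment_place _ _ DD) sim_appVK.
  + by rewrite -(hits_place (D := D))// sim_compKV.
  + by rewrite -key sim_compKV.
- move=> [g [/refineP[w [wL wh] gE] gI ->]].
  exists w; split; last by rewrite -key gE sim_compKV.
  by split => //; move: gI; rewrite -(hits_place (D := D))// gE sim_compKV.
Qed.

End OneNetInterval.
End Children.

(** * Edges, weights and transition entries *)

Definition edge_slot (e : edge R) (I : R * R) : Prop :=
  [/\ slot (refine e.1.1) I, e.1.2 = slot_nb (refine e.1.1) I & e.2 = I.1].

Section Edges.
Implicit Types (s u w : seq 'I_m) (t : R) (D I : R * R) (f g h : sim R)
  (v A : vertex R) (e : edge R).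

(** The right end of a slot is the first end point after its left end; hence
    the relative position q determines the child. *)
Lemma slot_left_inj A I I' : slot A I -> slot A I' -> I.1 = I'.1 -> I = I'.
Proof.
move=> [[I1 I12 I2] _ e2 Io _] [[J1 J12 J2] _ f2 Jo _] IJ.
suff h : I.2 = I'.2 by case: I I' IJ h {I1 I12 I2 e2 Io J1 J12 J2 f2 Jo} => [a b] [c d] /= -> ->.
apply/eqP; rewrite eq_le !leNgt; apply/andP; split; apply/negP => lt2.
- have : (open_segment I `&` ends A) I'.2.
    split; first by apply/open_segmentE; rewrite IJ J12.
    by case: f2 => // J21; move: I2; rewrite leNgt -J21 lt2.
  by rewrite Io.
- have : (open_segment I' `&` ends A) I.2.
    split; first by apply/open_segmentE; rewrite -IJ I12.
    by case: e2 => // J21; move: J2; rewrite leNgt -J21 lt2.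
  by rewrite Jo.
Qed.

Lemma slot_le A I I' : slot A I -> slot A I' -> I.1 < I'.1 -> I.2 <= I'.1.
Proof.
move=> [[I1 I12 I2] _ e2 Io _] [[J1 J12 J2] f1 f2 Jo _] IJ.
rewrite leNgt; apply/negP => lt2.
have : (open_segment I `&` ends A) I'.1.
  split; first by apply/open_segmentE; rewrite IJ.
  by case: f1 => // J0; move: IJ; rewrite J0 ltNge I1.
by rewrite Io.
Qed.

Lemma edge_slot_inj e I I' : edge_slot e I -> edge_slot e I' -> I = I'.
Proof. by move=> [sI _ eI] [sI' _ eI']; apply: slot_left_inj sI sI' _; rewrite -eI. Qed.

Lemma relative_position D x : D.1 < D.2 ->
  (x - D.1) / diam D = sim_app (sim_inv (T_ D)) x.
Proof.
move=> DD; have := ratio_T_neq0 DD; rewrite /sim_app /= => d0.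
by rewrite mulrBl mulrC.
Qed.

Lemma realizes_slot e t D D1 : realizes S K e t D D1 ->
  [/\ neighbour_set S K t D = e.1.1, neighbour_set S K (tg S K t D) D1 = e.1.2 &
      exists2 I, edge_slot e I & D1 = place D I].
Proof.
move=> [t0 netD ch ->]; split => //; exists (unplace D D1).
  split=> /=; first exact: child_slot.
  - rewrite -child_neighbours ?unplaceK//; last exact: child_slot.
    exact: net_lt netD.
  - by rewrite relative_position// (net_lt netD).
by rewrite unplaceK// (net_lt netD).
Qed.

Lemma realizes_place e t D D1 I : realizes S K e t D D1 -> edge_slot e I -> D1 = place D I.
Proof. by move=> /realizes_slot[_ _ [J eJ ->]] /(edge_slot_inj eJ) ->. Qed.

Lemma slot_realizes e t D I : 0 < t -> net_interval S K t D ->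
  neighbour_set S K t D = e.1.1 -> edge_slot e I -> realizes S K e t D (place D I).
Proof.
move=> t0 netD vE [sI wE qE]; have sI' := sI; rewrite -vE in sI'.
split => //; first by apply/child_place.
rewrite /child_edge child_neighbours// vE -wE.
rewrite relative_position ?(net_lt netD)//= sim_appK ?ratio_T_neq0 ?(net_lt netD)//.
by rewrite -qE; case: (e) => -[].
Qed.

Lemma graph_edge_slot e : GE e -> exists I, edge_slot e I.
Proof. by move=> [t [D [D1 /realizes_slot[_ _ [I eI _]]]]]; exists I. Qed.

Lemma edge_realizable e t D : GE e -> 0 < t -> net_interval S K t D ->
  neighbour_set S K t D = e.1.1 -> exists D1, realizes S K e t D D1.
Proof.
move=> /graph_edge_slot[I eI] t0 netD vE; exists (place D I).
exact: slot_realizes.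
Qed.

Lemma diam_place D I : diam (place D I) = diam D * diam I.
Proof. by have := T_place D I => /(congr1 fst). Qed.

Lemma child_net t D D1 : 0 < t -> net_interval S K t D -> child S K t D D1 ->
  0 < tg S K t D /\ net_interval S K (tg S K t D) D1.
Proof. by move=> t0 netD []; split => //; exact: tg_gt0. Qed.

(** The right hand side depends on the edge alone, hence so does the weight. *)
Lemma realizes_weight e t D D1 I : realizes S K e t D D1 -> edge_slot e I ->
  tg S K (tg S K t D) D1 / tg S K t D = scale e.1.2 * diam I / scale e.1.1.
Proof.
move=> r eI; have [vE wE _] := realizes_slot r; have D1E := realizes_place r eI.
have [t0 netD ch _] := r; have [tg0 netD1] := child_net t0 netD ch.
rewrite (tg_scale tg0 netD1) {2}(tg_scale t0 netD) wE vE D1E diam_place.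
have dD := diam_gt0 netD; have sD := scale_gt0 t0 netD.
by rewrite vE in sD; field; rewrite !gt_eqF.
Qed.

Lemma edge_weight_slot e I : GE e -> edge_slot e I ->
  edge_weight S K e = scale e.1.2 * diam I / scale e.1.1.
Proof.
move=> [t [D [D1 r]]] eI; rewrite /edge_weight; case: xgetP => [x _|/= h].
  by move=> [t' [D' [D1' [r' ->]]]]; exact: realizes_weight r' eI.
exfalso; apply: (h (tg S K (tg S K t D) D1 / tg S K t D)); by exists t, D, D1.
Qed.

Lemma edge_weight_tg e t D D1 : realizes S K e t D D1 ->
  edge_weight S K e = tg S K (tg S K t D) D1 / tg S K t D.
Proof.
move=> r; have [_ _ [I eI _]] := realizes_slot r.
rewrite (realizes_weight r eI); apply: edge_weight_slot => //.
by exists t, D, D1.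
Qed.

Lemma edge_weight_gt0 e : GE e -> 0 < edge_weight S K e.
Proof.
move=> [t [D [D1 r]]]; rewrite (edge_weight_tg r); have [t0 netD ch _] := r.
have [tg0 netD1] := child_net t0 netD ch.
by rewrite divr_gt0// (tg_gt0 tg0 netD1).
Qed.

Lemma edge_weight_lt1 e : GE e -> edge_weight S K e < 1.
Proof.
move=> [t [D [D1 r]]]; rewrite (edge_weight_tg r); have [t0 netD ch _] := r.
have [tg0 netD1] := child_net t0 netD ch.
by rewrite ltr_pdivrMr// mul1r (tg_lt tg0 netD1).
Qed.

Section TransitionEntries.
Context (e : edge R) (I : R * R)
  (ge : GE e) (eI : edge_slot e I).

Let v := e.1.1.
Let w := e.1.2.

Lemma slot_T_neq0 : (T_ I).1 != 0.
Proof. by case: eI => -[[_ I12 _] _ _ _ _] _ _; exact: ratio_T_neq0. Qed.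

Lemma neighbour_generates t D f s : net_interval S K t D ->
  word_map S s = sim_comp (T_ D) f -> contributes S K t D s -> generates S K t D s f.
Proof. by move=> netD sE sc; split => //; rewrite sE sim_compK// ratio_T_neq0// (net_lt netD). Qed.

(** An existential statement on the realizations of an edge becomes an
    equation between similarities in the coordinate of the slot. The same
    holds for same_transition. *)
Lemma letter_transition f g l : v f -> w g ->
  (exists t D D1 s, [/\ realizes S K e t D D1, generates S K t D s f &
      generates S K (tg S K t D) D1 (rcons s l) g]) <->
  `|f.1| = scale v /\ sim_comp (T_ I) g = sim_comp f (S l).
Proof.
move=> vf wg; split.
- move=> [t [D [D1 [s [r [sc fE] [[wL wh] gE]]]]]].
  have [t0 netD ch _] := r; have D1E := realizes_place r eI.
  have [vE _ _] := realizes_slot r.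
  have [_ tgmax] := tg_attained t0 netD.
  have sE : `|word_ratio S s| = tg S K t D.
    apply/eqP; rewrite eq_le tgmax//=.
    by have [_ /(_ _ _ erefl)] := (LambdaP _ _).1 wL.
  split.
    by rewrite fE (neighbour_ratio netD) sE (tg_scale t0 netD) vE mulfK// gt_eqF// (diam_gt0 netD).
  have TDn := ratio_T_neq0 (net_lt netD).
  apply: (sim_comp_inj TDn); rewrite sim_compA -T_place -D1E gE sim_compKV.
    by rewrite fE word_map_rcons sim_compA sim_compKV.
  by rewrite D1E T_place mulf_neq0// slot_T_neq0.
- move=> [fs gfl]; have [t [D [D1 r]]] := ge.
  have [t0 netD ch _] := r; have D1E := realizes_place r eI.
  have [tg0 netD1] := child_net t0 netD ch.
  have [vE wE _] := realizes_slot r.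
  have [s sc sE] : exists2 s, contributes S K t D s & word_map S s = sim_comp (T_ D) f.
    by apply: (neighbour_place netD); rewrite vE.
  have slE : word_map S (rcons s l) = sim_comp (T_ D1) g.
    by rewrite word_map_rcons sE D1E T_place -!sim_compA gfl.
  exists t, D, D1, s; split => //; first exact: neighbour_generates.
  apply: neighbour_generates => //; split.
    have rE : `|word_ratio S s| = tg S K t D.
      rewrite (tg_scale t0 netD) vE -fs -ratio_word_map sE normrM mulrC.
      by rewrite (gtr0_norm (ratio_T_gt0 (net_lt netD))).
    apply/LambdaP; split; first by rewrite -rE -cats1 word_ratio_prefix_lt.
    by move=> s' l' /rcons_inj[<- _]; rewrite rE.
  rewrite slE; have := (hits_place (0, 1) g (net_lt netD1)).2.
  by rewrite place_unit; apply; apply: (neighbour_hits netD1); rewrite wE.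
Qed.

Lemma same_transition f g : v f -> w g ->
  (exists t D D1 s, [/\ realizes S K e t D D1, generates S K t D s f &
      generates S K (tg S K t D) D1 s g]) <->
  `|f.1| < scale v /\ sim_comp (T_ I) g = f.
Proof.
move=> vf wg; split.
- move=> [t [D [D1 [s [r [sc fE] [[wL wh] gE]]]]]].
  have [t0 netD ch _] := r; have D1E := realizes_place r eI.
  have [vE _ _] := realizes_slot r.
  have [sE _] := (LambdaP _ _).1 wL.
  split.
    rewrite fE (neighbour_ratio netD) ltr_pdivrMr ?(diam_gt0 netD)//.
    by move: sE; rewrite (tg_scale t0 netD) vE.
  have TDn := ratio_T_neq0 (net_lt netD).
  apply: (sim_comp_inj TDn); rewrite sim_compA -T_place -D1E gE sim_compKV.
    by rewrite fE sim_compKV.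
  by rewrite D1E T_place mulf_neq0// slot_T_neq0.
- move=> [fs gf]; have [t [D [D1 r]]] := ge.
  have [t0 netD ch _] := r; have D1E := realizes_place r eI.
  have [tg0 netD1] := child_net t0 netD ch.
  have [vE wE _] := realizes_slot r.
  have [s sc sE] : exists2 s, contributes S K t D s & word_map S s = sim_comp (T_ D) f.
    by apply: (neighbour_place netD); rewrite vE.
  have slE : word_map S s = sim_comp (T_ D1) g.
    by rewrite sE D1E T_place -!sim_compA gf.
  exists t, D, D1, s; split => //; first exact: neighbour_generates.
  apply: neighbour_generates => //; split.
    have rE : `|word_ratio S s| < tg S K t D.
      rewrite (tg_scale t0 netD) vE -ratio_word_map sE normrM mulrC.
      by rewrite (gtr0_norm (ratio_T_gt0 (net_lt netD))) ltr_pM2r// (diam_gt0 netD).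
    apply/LambdaP; split => // s' l' s'E.
    have [/LambdaP[_ h] _] := sc.
    by apply: le_trans (h _ _ s'E); rewrite ltW// (tg_lt t0 netD).
  rewrite slE; have := (hits_place (0, 1) g (net_lt netD1)).2.
  by rewrite place_unit; apply; apply: (neighbour_hits netD1); rewrite wE.
Qed.

Lemma edge_source_net : exists t D, [/\ 0 < t, net_interval S K t D & v = neighbour_set S K t D].
Proof.
have [t [D [D1 r]]] := ge; have [vE _ _] := realizes_slot r.
by case: r => t0 netD _ _; exists t, D.
Qed.

(** At most one term of the sum is different from zero because the S l are
    distinct. Sums over letters are the form in which self-similarity of the
    measure produces these entries. *)
Lemma trans_entry_big f g : v f -> w g -> trans_entry S K p e f g =
  if `|f.1| == scale v then \sum_l p l * (sim_comp (T_ I) g == sim_comp f (S l))%:R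
  else (sim_comp (T_ I) g == f)%:R.
Proof.
move=> vf wg; rewrite /trans_entry.
have [t [D [t0 netD vE]]] := edge_source_net.
have fnz : f.1 != 0 by apply: (neighbour_neq0 netD); rewrite -vE.
have fle : `|f.1| <= scale v by have [_] := scale_max t0 netD; rewrite -vE; apply.
case: pickP => [l /asboolP/(letter_transition _ vf wg)[fs gE]|nol].
  rewrite fs eqxx (bigD1 l)//= gE eqxx mulr1 big1 ?addr0// => l' l'l.
  have [/(sim_comp_inj fnz)/(ifs_inj HS) ll|_] := eqVneq; last by rewrite mulr0.
  by rewrite ll eqxx in l'l.
have nol' l : `|f.1| = scale v -> sim_comp (T_ I) g <> sim_comp f (S l).
  by move=> fs gE; have /asboolP := nol l; apply; apply/letter_transition.
case: asboolP => [/(same_transition vf wg)[fs gE]|nos].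
  by rewrite lt_eqF// gE eqxx.
have [fs|fs] := eqVneq `|f.1| (scale v).
  by rewrite big1// => l _; case: eqP => [/nol'//|_]; rewrite mulr0.
case: eqP => // gE; exfalso; apply: nos; apply/same_transition => //.
by split => //; rewrite lt_neqAle fs.
Qed.

(** This makes every column of a transition matrix nonzero. *)
Lemma neighbour_parent g : w g -> exists2 f, v f &
  (`|f.1| == scale v) && [exists l, sim_comp (T_ I) g == sim_comp f (S l)] ||
  (`|f.1| < scale v) && (sim_comp (T_ I) g == f).
Proof.
case: eI => _ wE _; rewrite /w wE => -[h [[hh hP] hI ->]].
rewrite sim_compKV ?slot_T_neq0//; case: hP => [[vh hs]|[f [l [vf fs ->]]]].
  by exists h => //; rewrite hs eqxx orbT.
by exists f => //; rewrite fs eqxx /=; apply/orP; left; apply/existsP; exists l.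
Qed.

End TransitionEntries.
End Edges.

(** * The self-similar measure *)

Definition mass (E : set (measurableTypeR R)) : R := fine (mu E).

Section Mass.
Implicit Types (E : set (measurableTypeR R)) (s : seq 'I_m) (f g : sim R).

Lemma mass_ge0 E : 0 <= mass E.
Proof. by apply: fine_ge0. Qed.

Lemma massE E : measurable E -> mu E = (mass E)%:E.
Proof. by move=> mE; rewrite fineK// fin_num_measure. Qed.

Lemma mass_le1 E : measurable E -> mass E <= 1.
Proof. by move=> mE; rewrite -lee_fin -massE//; exact: probability_le1. Qed.

Lemma mass_le E E' : measurable E -> measurable E' -> E `<=` E' -> mass E <= mass E'.
Proof. exact: fine_mu_le. Qed.

Lemma measurable_sim f E : measurable E -> measurable (sim_app f @^-1` E).
Proof.
move=> mE; have mf : measurable_fun [set: measurableTypeR R] (sim_app f : measurableTypeR R -> measurableTypeR R).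
  apply: measurable_funD; last exact: measurable_cst.
  by apply: measurable_funM; [exact: measurable_cst|exact: measurable_id].
by rewrite -[X in measurable X]setTI; exact: mf.
Qed.

Lemma mass_invariant E : measurable E ->
  mass E = \sum_i p i * mass (sim_app (S i) @^-1` E).
Proof.
move=> mE; apply: EFin_inj; rewrite -massE// mu_invariant//.
rewrite -sumEFin; apply: eq_bigr => i _; rewrite EFinM massE//.
exact: measurable_sim.
Qed.

Lemma sim_app_preimage f g E :
  sim_app (sim_comp f g) @^-1` E = sim_app g @^-1` (sim_app f @^-1` E).
Proof. by apply/seteqP; split=> x /=; rewrite sim_app_comp. Qed.

Definition word_prob s : R := \prod_(i <- s) p i.

Lemma word_prob_gt0 s : 0 < word_prob s.
Proof. by rewrite /word_prob; elim: s => [|i s IH]; rewrite ?big_nil// big_cons mulr_gt0. Qed.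

Lemma prob_le1 i : p i <= 1.
Proof. by rewrite -p_sum1 (bigD1 i)//= lerDl sumr_ge0// => j _; exact: ltW. Qed.

Lemma mass_word s E : measurable E ->
  word_prob s * mass (sim_app (word_map S s) @^-1` E) <= mass E.
Proof.
elim: s E => [|i s IH] E mE.
  rewrite /word_prob big_nil mul1r /=.
  by rewrite (_ : _ @^-1` _ = E)//; apply/seteqP; split=> x /=; rewrite sim_app_id.
rewrite (mass_invariant mE) /word_prob big_cons -/(word_prob s) /= sim_app_preimage -mulrA.
rewrite (bigD1 i)//=; apply: (@le_trans _ _ (p i * mass (sim_app (S i) @^-1` E))).
  by rewrite ler_pM2l//; apply: IH; exact: measurable_sim.
by rewrite lerDl sumr_ge0// => j _; rewrite mulr_ge0 ?mass_ge0// ltW.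
Qed.

Let far (d : R) : set (measurableTypeR R) := [set x | forall k, K k -> d <= `|x - k|].

Let measurable_far d : measurable (far d).
Proof.
have -> : far d = ~` (\bigcup_(k in K) ball k d).
  apply/seteqP; split=> x /=.
    by move=> h [k Kk]; rewrite /ball /= ltNge distrC h.
  move=> h k Kk; rewrite leNgt; apply/negP => xk; apply: h; exists k => //.
  by rewrite /ball /= distrC.
apply: measurableC; apply: open_measurable; apply: bigcup_open => k _.
exact: ball_open.
Qed.

(** If x is at distance at least d from K, then its preimages under the S i
    are at distance at least d / rho from K. *)
Let far_expand rho d : 0 < rho -> 0 <= d -> (forall i, `|(S i).1| <= rho) ->
  mass (far d) <= mass (far (d / rho)).
Proof.
move=> rho0 d0 rhoP; rewrite (mass_invariant (measurable_far d)).
apply: (@le_trans _ _ (\sum_i p i * mass (far (d / rho)))); last first.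
  by rewrite -mulr_suml p_sum1 mul1r.
apply: ler_sum => i _; rewrite ler_pM2l//; apply: mass_le => //.
  exact: measurable_sim.
move=> x /= h k Kk; rewrite ler_pdivrMr//.
have /h : K (sim_app (S i) k).
  by have := attractor_map [:: i] Kk; rewrite /= sim_comp1r.
rewrite sim_app_dist => /le_trans; apply.
by rewrite mulrC ler_wpM2l.
Qed.

(** By far_expand the mass of the points at distance at least d from K is at
    most the mass at distance at least d / rho ^+ n for all n, and these sets
    decrease to the empty set. The complement of K is a countable union of
    such sets. *)
Lemma mass_off_attractor E : measurable E -> E `&` K = set0 -> mass E = 0.
Proof.
move=> mE EK.
have [rho [rho0 rho1 rhoP]] := ifs_ratio_bound.
have far0 d : 0 < d -> mass (far d) = 0.
  move=> d0.
  have lefar n : mass (far d) <= mass (far (d / rho ^+ n)).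
    elim: n => [|n IH]; first by rewrite expr0 divr1.
    apply: le_trans IH _; rewrite exprSr invfM mulrA.
    by apply: far_expand => //; rewrite divr_ge0 ?exprn_ge0// ltW.
  have cv : (mu \o (fun n => far (d / rho ^+ n))) @ \oo --> mu (\bigcap_n (far (d / rho ^+ n))).
    apply: nonincreasing_cvg_mu.
    - exact: le_lt_trans (probability_le1 mu (measurable_far _)) (ltry _).
    - by move=> n.
    - exact: bigcapT_measurable.
    - apply/nonincreasing_seqP => n; rewrite subsetEset => x h k Kk.
      apply: le_trans (h _ Kk); rewrite ler_pM2l// lef_pV2 ?posrE ?exprn_gt0//.
      by rewrite exprS ler_piMl ?exprn_ge0// ltW.
  have e0 : \bigcap_n (far (d / rho ^+ n)) = set0.
    apply/seteqP; split => // x h; have [k Kk] := ifs_nonempty HS.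
    have c0 : 0 < d / (`|x - k| + 1) by rewrite divr_gt0// ltr_pwDr.
    have [n /(_ n (leqnn n))] := exp_small rho0 rho1 c0.
    rewrite ltr_pdivlMr ?ltr_pwDr//.
    have := h n I k Kk; rewrite ler_pdivrMr ?exprn_gt0//.
    have := exprn_gt0 n rho0; have := normr_ge0 (x - k); nra.
  rewrite e0 measure0 in cv.
  apply/eqP; rewrite eq_le mass_ge0 andbT -lee_fin.
  rewrite -[leRHS](cvg_lim (@ereal_hausdorff R) cv); apply: lime_ge.
    by apply/cvg_ex; exists 0%E.
  by apply: nearW => n; rewrite /= massE// lee_fin.
have cK : closed K by apply: compact_closed; [exact: Rhausdorff|exact: ifs_compact HS].
have EU : E `<=` \bigcup_n far n.+1%:R^-1.
  move=> x Ex; have : (~` K) x by move=> Kx; have : (E `&` K) x by []; rewrite EK.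
  move=> nKx; have : nbhs x (~` K).
    by apply: open_nbhs_nbhs; split => //; exact: closed_openC.
  move=> /nbhs_ballP[d /= d0 dK]; exists (Num.truncn d^-1) => // k Kk.
  rewrite leNgt; apply/negP => xk; apply: (dK k) => //=.
  exact: lt_le_trans xk (inv_nat_le d0).
apply/eqP; rewrite eq_le mass_ge0 andbT -lee_fin -massE//.
apply: le_trans (le_measure _ _ _ EU) _; rewrite ?inE//.
  by apply: bigcup_measurable => n _.
apply: le_trans (measure_sigma_subadditive _ _ _ (@subset_refl _ _)) _ => //.
  by apply: bigcup_measurable => n _.
by rewrite eseries0// => n _ _; rewrite /= massE// far0// invr_gt0.
Qed.

Lemma mass_attractor E : measurable E -> K `<=` E -> mass E = 1.
Proof.
move=> mE KE; apply: EFin_inj; rewrite -massE//.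
have : (mu (~` E) = 0)%E.
  rewrite massE; last exact: measurableC.
  by rewrite mass_off_attractor//; [exact: measurableC|apply/seteqP; split=> x //= [nE /KE]].
rewrite probability_setC// massE// -EFinB => -[h].
by congr (_%:E); lra.
Qed.

Lemma mass_open_gt0 (a b x : R) : K x -> a < x < b -> 0 < mass `]a, b[%classic.
Proof.
move=> Kx /andP[ax xb].
pose t := Num.min (x - a) (b - x).
have t0 : 0 < t by rewrite lt_min !subr_gt0 ax.
have [s /LambdaP[st _] [k Kk kx]] := attractor_cover t0 Kx.
have mE : measurable (`]a, b[%classic : set (measurableTypeR R)) by exact: measurable_itv.
apply: lt_le_trans (mass_word s mE).
rewrite mass_attractor ?mulr1 ?word_prob_gt0//; first exact: measurable_sim.
move=> y Ky; rewrite /= in_itv /=.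
have : `|sim_app (word_map S s) y - x| < t.
  rewrite -kx sim_app_dist ratio_word_map; apply: le_lt_trans st.
  rewrite ler_piMr// ler_norml.
  have /andP[] := attractor01 Ky; have /andP[] := attractor01 Kk.
  by move=> ????; apply/andP; split; lra.
by rewrite lt_min ltr_norml ltr_norml => /andP[/andP[h1 h2] /andP[h3 h4]]; apply/andP; split; lra.
Qed.

(** Apply the self-similarity equation along s, and bound by M the mass of all
    the other preimages, which are points too. *)
Lemma mass_atom_word s (M : R) x : (forall y, mass [set y] <= M) ->
  mass [set x] <= word_prob s * mass (sim_app (word_map S s) @^-1` [set x]) + (1 - word_prob s) * M.
Proof.
move=> MP.
have pre f y : f.1 != 0 -> sim_app f @^-1` [set y] = [set sim_app (sim_inv f) y].
  move=> f0; apply/seteqP; split=> z /=; first by move=> <-; rewrite sim_appK.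
  by move=> ->; rewrite sim_appVK.
elim: s x => [|i s IH] x.
  rewrite /word_prob big_nil mul1r subrr mul0r addr0 /= pre ?oner_eq0//.
  by rewrite [sim_app _ x](_ : _ = x)// /sim_app /=; field.
have ri : (S i).1 != 0 by have /andP[] := ifs_ratio HS i; rewrite normr_gt0.
have mx : measurable ([set x] : set (measurableTypeR R)) by exact: measurable_set1.
rewrite (mass_invariant mx) (bigD1 i)//= /word_prob big_cons -/(word_prob s).
have h1 : \sum_(j < m | j != i) p j * mass (sim_app (S j) @^-1` [set x]) <= (1 - p i) * M.
  have -> : 1 - p i = \sum_(j < m | j != i) p j.
    by apply/eqP; rewrite subr_eq addrC -p_sum1 (bigD1 i).
  rewrite mulr_suml; apply: ler_sum => j _; rewrite ler_pM2l// pre//.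
  by have /andP[] := ifs_ratio HS j; rewrite normr_gt0.
rewrite sim_app_preimage pre//; have := IH (sim_app (sim_inv (S i)) x).
rewrite -(ler_pM2l (p_gt0 i)) => h2; apply: le_trans (lerD h2 h1) _.
by rewrite le_eqVlt; apply/orP; left; apply/eqP; ring.
Qed.

(** Let M be the largest mass of a point. Some piece of K lies near 0 and
    another one near 1, and a point misses one of them, which then contributes
    nothing in mass_atom_word: hence M <= (1 - c) M with c > 0. *)
Lemma mass_atom x : mass [set x] = 0.
Proof.
have [K0 K1] := attractor_extrema.
have half0 : 0 < 2^-1 :> R by rewrite invr_gt0.
have [s0 /LambdaP[r0 _] [k0 Kk0 e0]] := attractor_cover half0 K0.
have [s1 /LambdaP[r1 _] [k1 Kk1 e1]] := attractor_cover half0 K1.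
have near s k y : `|word_ratio S s| < 2^-1 -> K k -> K y ->
    `|sim_app (word_map S s) y - sim_app (word_map S s) k| < 2^-1.
  move=> st Kk Ky; rewrite sim_app_dist ratio_word_map; apply: le_lt_trans st.
  rewrite ler_piMr// ler_norml.
  have /andP[] := attractor01 Ky; have /andP[] := attractor01 Kk.
  by move=> ????; apply/andP; split; lra.
pose M := sup [set mass [set y] | y in [set: R]].
have m1 (y : R) : measurable ([set y] : set (measurableTypeR R)) by exact: measurable_set1.
have Mub : has_sup [set mass [set y] | y in [set: R]].
  split; first by exists (mass [set x]), x.
  by exists 1 => _ [y _ <-]; apply: mass_le1.
have MP y : mass [set y] <= M by apply: sup_upper_bound => //; exists y.
have M0 : 0 <= M by exact: le_trans (mass_ge0 _) (MP x).
pose c := Num.min (word_prob s0) (word_prob s1).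
have c0 : 0 < c by rewrite lt_min !word_prob_gt0.
have bound y : mass [set y] <= (1 - c) * M.
  have null s : (forall k, K k -> sim_app (word_map S s) k <> y) -> c <= word_prob s ->
      mass [set y] <= (1 - c) * M.
    move=> h cs; apply: le_trans (mass_atom_word s y MP) _.
    rewrite mass_off_attractor ?mulr0 ?add0r; last 2 first.
      - exact: measurable_sim.
      - by apply/seteqP; split=> k //= [ky Kk]; exact: h Kk ky.
    by apply: ler_wpM2r => //; rewrite lerD2l lerN2.
  have [y2|y2] := leP y 2^-1.
    apply: (null s1); last by rewrite ge_min lexx orbT.
    move=> k Kk ky; have := near s1 k1 k r1 Kk1 Kk; rewrite ky e1 ltr_norml => /andP[]; lra.
  apply: (null s0); last by rewrite ge_min lexx.
  move=> k Kk ky; have := near s0 k0 k r0 Kk0 Kk; rewrite ky e0 ltr_norml => /andP[]; lra.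
have : M <= (1 - c) * M.
  by apply: ge_sup; [exists (mass [set x]), x|move=> _ [y _ <-]].
have := MP x; have := mass_ge0 [set x]; nra.
Qed.

End Mass.

(** * Path matrices and their norms *)

Section Paths.
Implicit Types (v w : vertex R) (h : seq (@step R)) (L : set (vertex R)).

Lemma path_end_cat v h h' : path_end v (h ++ h') = path_end (path_end v h) h'.
Proof. by elim: h v => //= a h IH v. Qed.

Lemma path_in_start L v h : path_in S K L v h -> L v.
Proof. by case: h => [|a h] []. Qed.

Lemma path_in_end L v h : path_in S K L v h -> L (path_end v h).
Proof. by elim: h v => [|a h IH] v [] // Lv [_ /IH]. Qed.

Lemma path_in_cat L v h h' : path_in S K L v (h ++ h') <->
  path_in S K L v h /\ path_in S K L (path_end v h) h'.
Proof.
elim: h v => [|a h IH] v /=; first by split=> [h'P|[]//]; split=> //; split=> //; exact: path_in_start h'P.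
by rewrite IH; tauto.
Qed.

Lemma path_in_sub L L' v h : L `<=` L' -> path_in S K L v h -> path_in S K L' v h.
Proof. by move=> LL'; elim: h v => [|a h IH] v /= [/LL' ? // [? /IH]]. Qed.

Lemma path_weight_cat v h h' : path_weight S K v (h ++ h') =
  path_weight S K v h * path_weight S K (path_end v h) h'.
Proof. by elim: h v => [|a h IH] v /=; rewrite ?mul1r// IH mulrA. Qed.

End Paths.

Section PathEntries.
Implicit Types (v : vertex R) (h : seq (@step R)) (f g : sim R).

(** The entries of path_mx indexed by similarities. In this way the index
    types do not depend on the end of the path. *)
Fixpoint path_entry v h f g : R :=
  if h is a :: h' then \sum_(f' <- neighbours le a.1)
    trans_entry S K p (v, a.1, a.2) f f' * path_entry a.1 h' f' g
  else (f == g)%:R.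

Definition path_norm v h : R := mx_norm1 (path_mx S K le p v h).

End PathEntries.

Local Notation entry := path_entry.
Local Notation norm := path_norm.

Section WeightsAndNorms.
Implicit Types (v w : vertex R) (h : seq (@step R)) (f g : sim R) (L : set (vertex R)).

Lemma vertex_finite v : GV v -> finite_set v.
Proof. by move=> [t [D [t0 netD ->]]]; exact: finite_neighbour_set. Qed.

Lemma vertex_nonempty v : GV v -> v !=set0.
Proof. by move=> [t [D [t0 netD ->]]]; exact: neighbour_nonempty. Qed.

Lemma edge_target v w q : GE (v, w, q) -> GV w.
Proof.
move=> [t [D [D1 [t0 netD ch [_ -> _]]]]]; have [tg0 netD1] := child_net t0 netD ch.
by exists (tg S K t D), D1.
Qed.

Lemma mem_neighbours v f : GV v -> f \in neighbours le v <-> v f.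
Proof.
by move=> /vertex_finite fv; rewrite mem_sort in_fset_set// inE.
Qed.

Lemma uniq_neighbours v : uniq (neighbours le v).
Proof. by rewrite sort_uniq; exact: fset_uniq. Qed.

Lemma path_mxE v h i j : path_mx S K le p v h i j = entry v h (nb i) (nb j).
Proof.
elim: h v i j => [|a h IH] v i j /=.
  by rewrite mxE /nb nth_uniq ?uniq_neighbours//; case: i j => [? ?] [? ?].
rewrite mxE (big_nth sim_id) big_mkord; apply: eq_bigr => k _.
by rewrite IH mxE.
Qed.

Lemma sum_neighbours v (F : sim R -> R) :
  \sum_(f <- neighbours le v) F f = \sum_(i < card_nb le v) F (nb i).
Proof. by rewrite (big_nth sim_id) big_mkord. Qed.

Lemma path_normE v h : norm v h = \sum_(f <- neighbours le v)
  \sum_(g <- neighbours le (path_end v h)) entry v h f g.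
Proof.
rewrite /path_norm /mx_norm1 sum_neighbours; apply: eq_bigr => i _.
by rewrite sum_neighbours; apply: eq_bigr => j _; rewrite path_mxE.
Qed.

Lemma trans_entry_ge0 e f g : 0 <= trans_entry S K p e f g.
Proof. by rewrite /trans_entry; case: pickP => [l _|_]; [exact: ltW|case: ifP]. Qed.

Lemma trans_entry_le1 e f g : trans_entry S K p e f g <= 1.
Proof. by rewrite /trans_entry; case: pickP => [l _|_]; [exact: prob_le1|case: ifP]. Qed.

Lemma path_entry_ge0 v h f g : 0 <= entry v h f g.
Proof.
elim: h v f => [|a h IH] v f /=; first by case: eqP.
by apply: sumr_ge0 => f' _; rewrite mulr_ge0 ?trans_entry_ge0.
Qed.

Lemma path_norm_ge0 v h : 0 <= norm v h.
Proof.
by rewrite path_normE; apply: sumr_ge0 => f _; apply: sumr_ge0 => g _; exact: path_entry_ge0.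
Qed.

Lemma sum_delta_seq (T : eqType) (s : seq T) (x : T) (F : T -> R) :
  uniq s -> x \in s -> \sum_(y <- s) (x == y)%:R * F y = F x.
Proof.
move=> us xs; rewrite (bigD1_seq x)//= eqxx mul1r big1 ?addr0// => y yx.
by rewrite eq_sym (negbTE yx) mul0r.
Qed.

Lemma path_entry_cat v h h' f g : f \in neighbours le v ->
  entry v (h ++ h') f g = \sum_(f' <- neighbours le (path_end v h))
    entry v h f f' * entry (path_end v h) h' f' g.
Proof.
elim: h v f => [|a h IH] v f fv /=.
  by rewrite (sum_delta_seq (entry v h' ^~ g)) ?uniq_neighbours.
rewrite [RHS](eq_bigr (fun f' => \sum_(f1 <- neighbours le a.1)
    trans_entry S K p (v, a.1, a.2) f f1 *
    (entry a.1 h f1 f' * entry (path_end a.1 h) h' f' g))); last first.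
  by move=> f' _; rewrite mulr_suml; apply: eq_bigr => f1 _; rewrite mulrA.
rewrite exchange_big /= big_seq [RHS]big_seq; apply: eq_bigr => f1 f1a.
by rewrite IH// mulr_sumr.
Qed.

Lemma ler_sum_term (T : eqType) (s : seq T) (F : T -> R) x :
  (forall y, 0 <= F y) -> x \in s -> F x <= \sum_(y <- s) F y.
Proof.
move=> F0; elim: s => // a s IH; rewrite in_cons big_cons => /orP[/eqP ->|/IH h].
  by rewrite lerDl; apply: sumr_ge0.
by apply: le_trans h _; rewrite lerDr.
Qed.

Lemma sum_le_size_max (T : eqType) (s : seq T) (F : T -> R) : s != [::] ->
  exists2 x, x \in s & \sum_(y <- s) F y <= (size s)%:R * F x.
Proof.
elim: s => // a s IH _; have [->|/IH[x xs xP]] := eqVneq s [::].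
  by exists a; rewrite ?mem_head// big_seq1 mul1r.
rewrite big_cons [size _]/= -natr1.
have [ax|xa] := leP (F a) (F x).
  by exists x; [rewrite in_cons xs orbT|lra].
exists a; rewrite ?mem_head//.
have : (size s)%:R * F x <= (size s)%:R * F a by apply: ler_wpM2l => //; exact: ltW.
lra.
Qed.

Lemma path_norm_cat v h h' : norm v (h ++ h') =
  \sum_(f' <- neighbours le (path_end v h))
    (\sum_(f <- neighbours le v) entry v h f f') *
    (\sum_(g <- neighbours le (path_end (path_end v h) h')) entry (path_end v h) h' f' g).
Proof.
rewrite path_normE path_end_cat; set e := path_end v h.
rewrite (eq_big_seq (fun f => \sum_(f' <- neighbours le e) entry v h f f' *
    (\sum_(g <- neighbours le (path_end e h')) entry e h' f' g))); last first.
  move=> f fv /=; rewrite (eq_bigr _ (fun g _ => path_entry_cat h h' g fv)).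
  by rewrite exchange_big /=; apply: eq_bigr => f' _; rewrite mulr_sumr.
by rewrite exchange_big /=; apply: eq_bigr => f' _; rewrite mulr_suml.
Qed.

(** In the product of two nonnegative matrices the sum of every row of the
    second factor is at most its norm. *)
Lemma path_norm_cat_le v h h' : norm v (h ++ h') <= norm v h * norm (path_end v h) h'.
Proof.
rewrite path_norm_cat !path_normE [X in _ <= X * _]exchange_big mulr_suml.
rewrite big_seq [leRHS]big_seq; apply: ler_sum => f' f'e.
apply: ler_wpM2l; first by apply: sumr_ge0 => f _; exact: path_entry_ge0.
apply: (ler_sum_term (F := fun f' => \sum_(g <- _) entry _ h' f' g)) => // y.
by apply: sumr_ge0 => g _; exact: path_entry_ge0.
Qed.

(** Keep the contributions of the paths of neighbours through f and g only. *)
Lemma path_norm_cat_ge v h nu h' f g :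
  f \in neighbours le (path_end v h) -> g \in neighbours le (path_end v (h ++ nu)) ->
  (\sum_(f0 <- neighbours le v) entry v h f0 f) *
    entry (path_end v h) nu f g *
    (\sum_(g1 <- neighbours le (path_end v (h ++ nu ++ h'))) entry (path_end v (h ++ nu)) h' g g1)
  <= norm v (h ++ nu ++ h').
Proof.
move=> fe ge; rewrite path_normE -mulrA mulr_suml big_seq [leRHS]big_seq.
apply: ler_sum => f0 f0v; rewrite mulrA mulr_sumr; apply: ler_sum => g1 _.
rewrite catA path_entry_cat//.
apply: (@le_trans _ _ (entry v (h ++ nu) f0 g * entry (path_end v (h ++ nu)) h' g g1)); last first.
  apply: (ler_sum_term (F := fun g => entry v (h ++ nu) f0 g * entry (path_end v (h ++ nu)) h' g g1)) => // y.
  by rewrite mulr_ge0 ?path_entry_ge0.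
apply: ler_wpM2r; first exact: path_entry_ge0.
rewrite path_entry_cat//.
apply: (ler_sum_term (F := fun f => entry v h f0 f * entry (path_end v h) nu f g)) => // y.
by rewrite mulr_ge0 ?path_entry_ge0.
Qed.

Lemma prob_lower_bound : exists2 c, 0 < c & c <= 1 /\ forall i, c <= p i.
Proof.
have [i0 _ _] : (\bigcup_i (sim_app (S i) @` K)) 0.
  by rewrite -(ifs_invariant HS); have [] := attractor_extrema.
have [i _ iP] := @finite_max R 'I_m setT (fun i => - p i) finite_finset (ex_intro _ i0 I).
exists (p i) => //; split; first exact: prob_le1.
by move=> j; have := iP j I; rewrite lerN2.
Qed.

Lemma edge_column c v w q g : 0 < c -> c <= 1 -> (forall i, c <= p i) ->
  GE (v, w, q) -> w g -> exists2 f, v f & c <= trans_entry S K p (v, w, q) f g.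
Proof.
move=> c0 c1 cp ge wg; have [I eI] := graph_edge_slot ge.
have [f vf fg] := neighbour_parent eI wg; exists f => //.
rewrite (trans_entry_big ge eI vf wg).
case/orP: fg => /andP[fs fgE].
  rewrite fs; have /existsP[l lP] := fgE.
  rewrite (bigD1 l)//= lP mulr1; apply: le_trans (cp l) _; rewrite lerDl.
  by apply: sumr_ge0 => l' _; rewrite mulr_ge0// ltW.
by rewrite lt_eqF// fgE.
Qed.

(** From g go back along h, at every step to a neighbour of the parent given
    by edge_column. *)
Lemma path_column c v h g : 0 < c -> c <= 1 -> (forall i, c <= p i) ->
  path_in S K GV v h -> path_end v h g ->
  exists2 f, f \in neighbours le v & c ^+ size h <= entry v h f g.
Proof.
move=> c0 c1 cp; elim: h v => [|a h IH] v [GVv]; rewrite [path_end _ _]/=.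
  by move=> _ vg; exists g; [exact/mem_neighbours|rewrite /= eqxx].
move=> [ge pa] /(IH _ pa)[f' f'a f'P].
have GVa := edge_target ge.
have [f vf fP] := edge_column c0 c1 cp ge ((mem_neighbours _ GVa).1 f'a).
exists f; first exact/mem_neighbours.
rewrite /= exprS; apply: (@le_trans _ _ (trans_entry S K p (v, a.1, a.2) f f' * entry a.1 h f' g)).
  by apply: ler_pM => //; rewrite ?exprn_ge0// ltW.
apply: (ler_sum_term (F := fun f' => trans_entry S K p (v, a.1, a.2) f f' * entry a.1 h f' g)) => // y.
by rewrite mulr_ge0 ?trans_entry_ge0 ?path_entry_ge0.
Qed.

Lemma path_norm_lower : exists2 c, 0 < c & c <= 1 /\
  forall v h, path_in S K GV v h -> c ^+ size h <= norm v h.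
Proof.
have [c c0 [c1 cp]] := prob_lower_bound; exists c => //; split=> // v h vh.
have [g eg] := vertex_nonempty (path_in_end vh).
have [f fv fP] := path_column c0 c1 cp vh eg.
apply: le_trans fP _; rewrite path_normE.
apply: (@le_trans _ _ (\sum_(g <- neighbours le (path_end v h)) entry v h f g)).
  apply: (ler_sum_term (F := entry v h f)); first by move=> y; exact: path_entry_ge0.
  by apply/mem_neighbours => //; exact: path_in_end vh.
apply: (ler_sum_term (F := fun f => \sum_(g <- neighbours le (path_end v h)) entry v h f g)) => // y.
by apply: sumr_ge0 => ? _; exact: path_entry_ge0.
Qed.

Lemma path_norm_gt0 v h : path_in S K GV v h -> 0 < norm v h.
Proof.
move=> vh; have [c c0 [_ cP]] := path_norm_lower.
by apply: lt_le_trans (cP _ _ vh); rewrite exprn_gt0.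
Qed.

Lemma path_norm_upper : exists2 C, 1 <= C & (forall v, GV v -> (card_nb le v)%:R <= C) /\
  forall v h, path_in S K GV v h -> norm v h <= C ^+ (size h).+1.
Proof.
have [|||n nP] := @finite_uniform (set (sim R)) GV (fun v n => (card_nb le v <= n)%N).
- by case: fnc.
- by move=> x n k nk /leq_trans; apply.
- by move=> v _; exists (card_nb le v).
pose C : R := (n.+1%:R) ^+ 2.
have n1 : 1 <= n.+1%:R :> R by rewrite ler1n.
have cardC v : GV v -> (card_nb le v)%:R <= n.+1%:R :> R.
  by move=> /nP h; rewrite ler_nat leqW.
have nC : n.+1%:R <= C by rewrite /C expr2 ler_peMl.
exists C; first exact: le_trans nC.
split=> [v /cardC/le_trans|]; first exact.
move=> v h; elim: h v => [|a h IH] v.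
  move=> [GVv _]; rewrite path_normE expr1.
  apply: le_trans nC; apply: le_trans (cardC _ GVv).
  rewrite /= (eq_big_seq (fun => 1)).
    by rewrite big_const_seq count_predT iter_addr addr0.
  move=> f fv; rewrite -[RHS](sum_delta_seq (fun => 1) (uniq_neighbours v) fv).
  by apply: eq_bigr => g _; rewrite mulr1.
move=> [GVv [ge pa]]; have GVa := edge_target ge.
apply: le_trans (path_norm_cat_le v [:: a] h) _; rewrite /= exprS.
apply: ler_pM; rewrite ?path_norm_ge0//; last exact: IH.
rewrite path_normE [path_end _ _]/=.
apply: (@le_trans _ _ (\sum_(f <- neighbours le v) n.+1%:R)).
  apply: ler_sum => f _; apply: le_trans (cardC _ GVa).
  apply: (@le_trans _ _ (\sum_(g <- neighbours le a.1) 1)); last first.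
    by rewrite big_const_seq count_predT iter_addr addr0.
  rewrite big_seq [leRHS]big_seq; apply: ler_sum => g ga /=.
  rewrite (eq_bigr (fun f' => (g == f')%:R * trans_entry S K p (v, a.1, a.2) f f')).
    by rewrite (sum_delta_seq (trans_entry S K p (v, a.1, a.2) f)) ?uniq_neighbours// trans_entry_le1.
  by move=> f' _; rewrite mulrC eq_sym.
rewrite big_const_seq count_predT iter_addr addr0 -(mulr_natl n.+1%:R (size _)) /C expr2.
by apply: ler_wpM2r => //; exact: cardC.
Qed.

Lemma weight_bounds : exists rho0 rho1, [/\ 0 < rho0, rho0 <= rho1, rho1 < 1 &
  forall e, GE e -> rho0 <= edge_weight S K e <= rho1].
Proof.
have [|||n nP] := @finite_uniform (set (sim R) * set (sim R) * R)%type GE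
  (fun e n => n.+2%:R^-1 <= edge_weight S K e <= 1 - n.+2%:R^-1).
- by case: fnc.
- move=> e n k nk /andP[h1 h2].
  have kn : k.+2%:R^-1 <= n.+2%:R^-1 :> R by rewrite lef_pV2 ?posrE// ler_nat !ltnS.
  by rewrite (le_trans kn h1) (le_trans h2)// lerD2l lerN2.
- move=> e ge; have w0 := edge_weight_gt0 ge; have w1 := edge_weight_lt1 ge.
  pose a := Num.min (edge_weight S K e) (1 - edge_weight S K e).
  have a0 : 0 < a by rewrite lt_min w0 subr_gt0.
  exists (Num.truncn a^-1).
  have h : (Num.truncn a^-1).+2%:R^-1 <= a.
    by apply: le_trans (inv_nat_le a0); rewrite lef_pV2 ?posrE// ler_nat.
  by move: (_.+2%:R^-1) h => z; rewrite le_min => /andP[h1 h2]; apply/andP; split; lra.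
have n2 : n.+2%:R^-1 <= 1 - n.+2%:R^-1 :> R.
  have : n.+2%:R^-1 <= 2^-1 :> R by rewrite lef_pV2 ?posrE// ler_nat.
  by move: (n.+2%:R^-1) => z; lra.
exists n.+2%:R^-1, (1 - n.+2%:R^-1); split=> //.
Qed.

Lemma path_weight_gt0 v h : path_in S K GV v h -> 0 < path_weight S K v h.
Proof.
by elim: h v => [|a h IH] v //= [_ [ge /IH h0]]; rewrite mulr_gt0// edge_weight_gt0.
Qed.

Lemma path_weight_le_exp rho v h : (forall e, GE e -> edge_weight S K e <= rho) ->
  path_in S K GV v h -> path_weight S K v h <= rho ^+ size h.
Proof.
move=> rhoP; elim: h v => [|a h IH] v //= [GVv [ge ph]]; rewrite exprS.
by apply: ler_pM; rewrite ?rhoP ?IH// ltW// ?edge_weight_gt0// path_weight_gt0.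
Qed.

Lemma path_weight_ge_exp rho v h : 0 <= rho -> (forall e, GE e -> rho <= edge_weight S K e) ->
  path_in S K GV v h -> rho ^+ size h <= path_weight S K v h.
Proof.
move=> rho0 rhoP; elim: h v => [|a h IH] v //= [GVv [ge ph]]; rewrite exprS.
by apply: ler_pM; rewrite ?rhoP ?IH// exprn_ge0.
Qed.

Lemma path_weight_le1 v h : path_in S K GV v h -> path_weight S K v h <= 1.
Proof.
move=> vh; rewrite -(expr1n R (size h)); apply: path_weight_le_exp vh => e ge.
exact: ltW (edge_weight_lt1 ge).
Qed.

End WeightsAndNorms.

(** * Cost and decay of paths, and the exponents of a loop class *)

Section PathLogarithms.
Implicit Types (v : vertex R) (h : seq (@step R)) (L : set (vertex R)) (u : R).

(** In logarithmic scale the cost is additive along paths and the decay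
    superadditive, and alpha_min and alpha_max become the extreme rates of
    decay per unit of cost. *)
Definition path_cost v h : R := - ln (path_weight S K v h).

Definition path_decay v h : R := - ln (path_norm v h).

(** The paths of Sigma_t for t = exp (- u). *)
Definition crossing L u v h : Prop := path_in S K L v h /\
  exists k a, [/\ h = rcons k a, path_cost v k <= u & u < path_cost v h].

Definition least_decay L u : R := u * inf (log_ratios S K le p L (expR (- u))).

Definition greatest_decay L u : R := u * sup (log_ratios S K le p L (expR (- u))).

End PathLogarithms.

Local Notation cost := path_cost.
Local Notation decay := path_decay.
Local Notation weight := (path_weight S K).

Section LoopClassExponents.
Implicit Types (v w : vertex R) (h : seq (@step R)) (f g : sim R).

Lemma cost_cat v h h' : path_in S K GV v (h ++ h') ->
  cost v (h ++ h') = cost v h + cost (path_end v h) h'.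
Proof.
move=> /path_in_cat[vh vh']; rewrite /path_cost path_weight_cat lnM ?opprD//.
- by rewrite posrE; exact: path_weight_gt0.
- by rewrite posrE; exact: path_weight_gt0.
Qed.

Lemma cost_nil v : cost v [::] = 0.
Proof. by rewrite /path_cost /= ln1 oppr0. Qed.

Lemma cost_ge0 v h : path_in S K GV v h -> 0 <= cost v h.
Proof. by move=> vh; rewrite oppr_ge0 -ln1 ler_ln ?posrE// ?path_weight_le1// path_weight_gt0. Qed.

Lemma decay_cat v h h' : path_in S K GV v (h ++ h') ->
  decay v h + decay (path_end v h) h' <= decay v (h ++ h').
Proof.
move=> vhh'; have /path_in_cat[vh vh'] := vhh'.
have n0 := path_norm_gt0 vh.
have n1 := path_norm_gt0 vh'.
have n2 := path_norm_gt0 vhh'.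
by rewrite /path_decay -opprD lerN2 -lnM ?posrE// ler_ln ?posrE ?mulr_gt0// path_norm_cat_le.
Qed.

Lemma cost_size : exists2 A, 0 < A & exists2 a, 0 < a & forall v h, path_in S K GV v h ->
  a * (size h)%:R <= cost v h <= A * (size h)%:R.
Proof.
have [r0 [r1 [r00 r01 r11 rP]]] := weight_bounds.
have r10 : 0 < r1 by lra.
exists (- ln r0); first by rewrite oppr_gt0 -ln1 ltr_ln ?posrE//; lra.
exists (- ln r1); first by rewrite oppr_gt0 -ln1 ltr_ln ?posrE//; lra.
move=> v h vh; rewrite /path_cost !mulNr !lerN2 !mulr_natr -!lnXn//.
rewrite !ler_ln ?posrE ?exprn_gt0 ?path_weight_gt0//.
apply/andP; split.
  by apply: path_weight_le_exp vh => // e /rP/andP[].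
by apply: path_weight_ge_exp vh => // [|e /rP/andP[]//]; exact: ltW.
Qed.

Lemma decay_bound : exists2 B, 0 < B & forall v h, path_in S K GV v h ->
  `|decay v h| <= B * (1 + cost v h).
Proof.
have [C C1 [_ CP]] := path_norm_upper.
have [c c0 [c1 cP]] := path_norm_lower.
have [A A0 [a a0 aP]] := cost_size.
have C0 : 0 < C by lra.
have lC : 0 <= ln C by rewrite ln_ge0.
have lc : 0 <= - ln c by rewrite oppr_ge0 -ln1 ler_ln ?posrE.
pose B := (ln C - ln c + 1) * (1 + a^-1).
have a1 : 0 < a^-1 by rewrite invr_gt0.
exists B; first by rewrite mulr_gt0//; lra.
move=> v h vh; have n0 := path_norm_gt0 vh.
have /andP[h1 _] := aP _ _ vh.
have sz : (size h)%:R <= a^-1 * cost v h by rewrite mulrC ler_pdivlMr// mulrC.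
have up : - decay v h <= ln C * (1 + (size h)%:R).
  rewrite opprK addrC natr1 mulr_natr -lnXn// ler_ln ?posrE ?exprn_gt0//.
  exact: CP.
have lo : decay v h <= - ln c * (size h)%:R.
  rewrite /path_decay mulNr lerN2 mulr_natr -lnXn// ler_ln ?posrE ?exprn_gt0//.
  exact: cP.
have ch := cost_ge0 vh.
have s0 : 0 <= (size h)%:R :> R by [].
have key : (ln C - ln c + 1) * (1 + (size h)%:R) <= B * (1 + cost v h).
  rewrite /B -mulrA; apply: ler_wpM2l; first lra.
  by rewrite mulrDl mul1r mulrDr mulr1; nra.
rewrite ler_norml lerNl; apply/andP; split; nra.
Qed.

Lemma first_crossing v h (u : R) : 0 <= u -> u < cost v h -> path_in S K GV v h ->
  exists k a h', [/\ h = rcons k a ++ h', cost v k <= u & u < cost v (rcons k a)].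
Proof.
move=> u0; elim/last_ind: h => [|h a IH]; first by rewrite cost_nil; lra.
move=> uh vh; have vh' : path_in S K GV v h by move: vh; rewrite -cats1 => /path_in_cat[].
have [/IH/(_ vh')[k [b [h' [-> h1 h2]]]]|hu] := ltP u (cost v h).
  by exists k, b, (rcons h' a); rewrite rcons_cat.
by exists h, a, [::]; rewrite cats0.
Qed.

Section LoopClass.
Context {L : set (vertex R)} (L_loop : loop_class S K L) (L_nonempty : L !=set0)
  (L_irr : irreducible_class S K le p L).

Let LGV : L `<=` GV. Proof. by case: L_loop. Qed.
Let inGV v h : path_in S K L v h -> path_in S K GV v h.
Proof. exact: path_in_sub. Qed.

(** Irreducibility with uniform bounds: there are finitely many pairs of
    vertices and of neighbours. *)
Lemma connecting_path : exists2 n : nat, (0 < n)%N &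
  forall v1 v2 f g, L v1 -> L v2 -> v1 f -> v2 g ->
  exists nu, [/\ path_in S K L v1 nu, path_end v1 nu = v2, cost v1 nu <= n%:R,
     norm v1 nu <= n%:R & n%:R^-1 <= path_entry v1 nu f g].
Proof.
have finL : finite_set L by apply: sub_finite_set LGV _; case: fnc.
pose U := \bigcup_(v in L) v.
have finU : finite_set U by apply: bigcup_finite => // v /LGV; exact: vertex_finite _.
pose Q (x : (set (sim R) * set (sim R)) * (sim R * sim R)) (n : nat) :=
  exists nu, [/\ path_in S K L x.1.1 nu, path_end x.1.1 nu = x.1.2, cost x.1.1 nu <= n%:R,
     norm x.1.1 nu <= n%:R & n.+1%:R^-1 <= path_entry x.1.1 nu x.2.1 x.2.2].
have [|||n nP] := @finite_uniform _
   (((L `*` L) `*` (U `*` U)) `&` [set x | x.1.1 x.2.1 /\ x.1.2 x.2.2]) Q.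
- by apply: finite_setIl; do !apply: finite_setX.
- move=> x n k nk [nu [h1 h2 h3 h4 h5]]; exists nu; split => //.
  + by apply: le_trans h3 _; rewrite ler_nat.
  + by apply: le_trans h4 _; rewrite ler_nat.
  + by apply: le_trans h5; rewrite lef_pV2 ?posrE// ler_nat.
- move=> [[v1 v2] [f g]] [[[/= Lv1 Lv2] _] [/= v1f v2g]].
  have fI : (index f (neighbours le v1) < card_nb le v1)%N.
    by rewrite index_mem; apply/mem_neighbours => //; exact: LGV.
  have gI : (index g (neighbours le v2) < card_nb le v2)%N.
    by rewrite index_mem; apply/mem_neighbours => //; exact: LGV.
  have [nu [_ nuL nuE [j jE nu0]]] := L_irr Lv1 Lv2 (Ordinal fI) (Ordinal gI).
  have nbf : nb (Ordinal fI) = f.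
    by rewrite /nb nth_index//; apply/mem_neighbours => //; exact: LGV.
  have nbg : nb j = g.
    by rewrite /nb jE nuE nth_index//; apply/mem_neighbours => //; exact: LGV.
  rewrite path_mxE nbf nbg in nu0.
  set x := path_entry _ _ _ _ in nu0.
  exists (maxn (Num.truncn x^-1) (maxn (Num.truncn (cost v1 nu)).+1 (Num.truncn (norm v1 nu)).+1)).
  exists nu; split => //=.
  + by apply: nat_above; rewrite !leq_max leqnn !orbT.
  + by apply: nat_above; rewrite !leq_max leqnn !orbT.
  + apply: le_trans (inv_nat_le nu0).
    by rewrite lef_pV2 ?posrE// ler_nat ltnS leq_max leqnn.
exists n.+1 => // v1 v2 f g Lv1 Lv2 v1f v2g.
have [|nu [h1 h2 h3 h4 h5]] := nP ((v1, v2), (f, g)).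
  by split => //=; split => //=; split => /=; [exists v1|exists v2].
exists nu; split => //.
+ by apply: le_trans h3 _; rewrite ler_nat.
+ by apply: le_trans h4 _; rewrite ler_nat.
Qed.

(** The inequality of path_norm_cat_le is reversed up to a constant by
    inserting a connecting path. By the pigeonhole principle some column f of
    the first matrix and some row g of the last carry a fixed proportion of
    the norms, and the inserted path joins f to g. *)
Lemma path_gluing : exists2 C, 0 < C & forall v h v' h',
  path_in S K GV v h -> L (path_end v h) -> path_in S K L v' h' ->
  exists nu, [/\ path_in S K L (path_end v h) nu, path_end (path_end v h) nu = v',
    cost (path_end v h) nu <= C, - C <= decay (path_end v h) nu &
    decay v (h ++ nu ++ h') <= decay v h + decay v' h' + C].
Proof.
have [n n0 nP] := connecting_path.
have [C C1 [cardC _]] := path_norm_upper.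
have n1 : 1 <= n%:R :> R by rewrite ler1n.
have np : 0 < n%:R :> R by lra.
have C0 : 0 < C by lra.
have lC : 0 <= ln C by rewrite ln_ge0.
have ln0 : 0 <= ln n%:R :> R by rewrite ln_ge0.
exists (n%:R + ln n%:R + 2 * ln C); first by lra.
move=> v h v' h' vh Le vh'; have Lv' := path_in_start vh'.
have ne w : GV w -> neighbours le w != [::].
  move=> GVw; have [f wf] := vertex_nonempty GVw.
  by apply/eqP => e; have := (mem_neighbours f GVw).2 wf; rewrite e.
have Ge := LGV Le; have Gv' := LGV Lv'.
have [f fe fP] := sum_le_size_max (fun f => \sum_(f0 <- neighbours le v) path_entry v h f0 f) (ne _ Ge).
have [g gv gP] := sum_le_size_max (fun g => \sum_(g1 <- neighbours le (path_end v' h')) path_entry v' h' g g1) (ne _ Gv').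
have fe' := (mem_neighbours f Ge).1 fe; have gv' := (mem_neighbours g Gv').1 gv.
have [nu [nuL nuE nuc nun nue]] := nP _ _ _ _ Le Lv' fe' gv'.
have nuG := inGV nuL.
have pos := path_norm_gt0.
have Nv0 := pos _ _ vh; have Nv'0 := pos _ _ (inGV vh'); have Nnu := pos _ _ nuG.
exists nu; split => //; first lra.
  rewrite lerN2; have : ln (norm (path_end v h) nu) <= ln n%:R by rewrite ler_ln ?posrE.
  lra.
have all : path_in S K GV v (h ++ nu ++ h').
  apply/path_in_cat; split=> //; apply/path_in_cat; split=> //.
  by rewrite nuE; exact: inGV.
have nuE' : path_end v (h ++ nu) = v' by rewrite path_end_cat.
have := path_norm_cat_ge (v := v) (h := h) (nu := nu) h' (f := f) (g := g) fe.
rewrite (catA h nu h') (path_end_cat v (h ++ nu) h') nuE' -(catA h nu h') => /(_ gv).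
set X := \sum_(f0 <- _) _; set Y := \sum_(g1 <- _) _ => key.
have hX : norm v h <= C * X.
  rewrite path_normE exchange_big /=; apply: le_trans fP _; apply: ler_wpM2r; last exact: cardC.
  by apply: sumr_ge0 => ? _; exact: path_entry_ge0.
have hY : norm v' h' <= C * Y.
  rewrite path_normE; apply: le_trans gP _; apply: ler_wpM2r; last exact: cardC.
  by apply: sumr_ge0 => ? _; exact: path_entry_ge0.
have X0 : 0 < X by rewrite -(pmulr_rgt0 _ C0); exact: lt_le_trans hX.
have Y0 : 0 < Y by rewrite -(pmulr_rgt0 _ C0); exact: lt_le_trans hY.
have nV : 0 < n%:R^-1 :> R by rewrite invr_gt0.
have lX : ln (norm v h) <= ln C + ln X by rewrite -lnM ?posrE// ler_ln ?posrE// mulr_gt0.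
have lY : ln (norm v' h') <= ln C + ln Y by rewrite -lnM ?posrE// ler_ln ?posrE// mulr_gt0.
have lk : ln X - ln n%:R + ln Y <= ln (norm v (h ++ nu ++ h')).
  rewrite -lnV ?posrE// -lnM ?posrE// -lnM ?posrE ?mulr_gt0//.
  rewrite ler_ln ?posrE ?mulr_gt0// ?pos//.
  apply: le_trans key; apply: ler_wpM2r; first exact: ltW.
  by apply: ler_wpM2l => //; exact: ltW.
rewrite /path_decay; lra.
Qed.

Lemma long_path v k : L v -> exists2 h, path_in S K L v h & size h = k.
Proof.
elim: k v => [|k IH] v Lv; first by exists [::].
have [_ /(_ v v Lv Lv)[h0 [h0ne h0L _]]] := L_loop.
case: h0 h0ne h0L => [//|a h] _ [_ [ge ha]].
have [h' h'L h's] := IH _ (path_in_start ha).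
by exists (a :: h') => //=; rewrite h's.
Qed.

Lemma crossing_exists v (u : R) : L v -> 0 <= u -> exists h, crossing L u v h.
Proof.
move=> Lv u0; have [A A0 [a a0 aP]] := cost_size.
have [h vh sh] := long_path (Num.truncn (u / a)).+1 Lv.
have uh : u < cost v h.
  have /andP[h1 _] := aP _ _ (inGV vh); apply: lt_le_trans h1.
  by rewrite -ltr_pdivrMl// mulrC sh truncnS_gt.
have [k [b [h' [hE h1 h2]]]] := first_crossing u0 uh (inGV vh).
by move: vh; rewrite hE => /path_in_cat[vk _]; exists (rcons k b); split => //; exists k, b.
Qed.

(** One edge costs a bounded amount, so the level is exceeded by a bounded
    amount. *)
Lemma crossing_cost : exists2 A, 0 < A & forall u v h, 0 <= u -> crossing L u v h -> cost v h <= u + A.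
Proof.
have [A A0 [a a0 aP]] := cost_size; exists A => // u v h u0 [vh [k [b [hE h1 h2]]]].
move: (inGV vh); rewrite hE -cats1 => vkb; rewrite cost_cat//.
have /path_in_cat[_ vb] := vkb; have /andP[_] := aP _ _ vb.
by rewrite mulr1; lra.
Qed.

Lemma log_ratiosP u r : 0 < u -> log_ratios S K le p L (expR (- u)) r <->
  exists v h, crossing L u v h /\ r = decay v h / u.
Proof.
move=> u0.
have wE v h : path_in S K L v h -> (weight v h < expR (- u)) = (u < cost v h).
  move=> vh; rewrite -ltr_ln ?posrE ?expR_gt0//; last exact: path_weight_gt0 _ _ (inGV vh).
  by rewrite expRK ltrNr.
have wE' v h : path_in S K L v h -> (expR (- u) <= weight v h) = (cost v h <= u).
  by move=> vh; rewrite leNgt wE// -leNgt.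
split=> [[[v h] /= [vh [k [b [hE /andP[h1 h2]]]]] <-]|[v [h [[vh [k [b [hE h1 h2]]]] ->]]]].
  exists v, h; split; last by rewrite expRK /path_decay invrN mulrN mulNr.
  split => //; exists k, b; split => //; last by rewrite -wE.
  by rewrite -wE'//; move: vh; rewrite hE -cats1 => /path_in_cat[].
exists (v, h) => /=; last by rewrite expRK /path_decay invrN mulrN mulNr.
split => //; exists k, b; split => //=; rewrite wE// h2 wE'//.
by move: vh; rewrite hE -cats1 => /path_in_cat[].
Qed.

Lemma crossing_bound : exists2 B, 0 < B & forall u v h, 1 <= u -> crossing L u v h ->
  `|decay v h| <= B * u.
Proof.
have [A A0 AP] := crossing_cost; have [B B0 BP] := decay_bound.
exists (B * (2 + A)); first by rewrite mulr_gt0//; lra.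
move=> u v h u1 cr; apply: le_trans (BP _ _ (inGV cr.1)) _.
have := AP _ _ _ (le_trans ler01 u1) cr; rewrite -mulrA ler_pM2l//; nra.
Qed.

Lemma log_ratios_bounded u : 1 <= u ->
  has_sup (log_ratios S K le p L (expR (- u))) /\ has_inf (log_ratios S K le p L (expR (- u))).
Proof.
move=> u1; have u0 : 0 < u by lra.
have [B B0 BP] := crossing_bound.
have [v Lv] := L_nonempty; have [h vh] := crossing_exists Lv (ltW u0).
have ne : log_ratios S K le p L (expR (- u)) !=set0.
  by exists (decay v h / u); apply/log_ratiosP => //; exists v, h.
split; split => //; [exists B|exists (- B)] => r /(log_ratiosP _ u0)[w [k [wk ->]]];
  have := BP _ _ _ u1 wk; rewrite ler_norml => /andP[h1 h2].
  by rewrite ler_pdivrMr.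
by rewrite ler_pdivlMr// mulNr.
Qed.

Lemma least_decay_le u v h : 1 <= u -> crossing L u v h -> least_decay L u <= decay v h.
Proof.
move=> u1 vh; have u0 : 0 < u by lra.
have [_ [_ hi]] := log_ratios_bounded u1.
rewrite /least_decay -ler_pdivlMl// mulrC; apply: ge_inf => //.
by apply/log_ratiosP => //; exists v, h.
Qed.

Lemma greatest_decay_ge u v h : 1 <= u -> crossing L u v h -> decay v h <= greatest_decay L u.
Proof.
move=> u1 vh; have u0 : 0 < u by lra.
have [[_ hi] _] := log_ratios_bounded u1.
rewrite /greatest_decay -ler_pdivrMl// mulrC; apply: ub_le_sup => //.
by apply/log_ratiosP => //; exists v, h.
Qed.

Lemma least_decay_adherent u e : 1 <= u -> 0 < e ->
  exists v h, crossing L u v h /\ decay v h <= least_decay L u + e.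
Proof.
move=> u1 e0; have u0 : 0 < u by lra.
have [_ hi] := log_ratios_bounded u1.
have [r /(log_ratiosP _ u0)[v [h [vh ->]]] rP] := inf_adherent (divr_gt0 e0 u0) hi.
exists v, h; split => //; move: rP; rewrite ltr_pdivrMr// mulrDl divfK ?gt_eqF//.
by rewrite mulrC => /ltW.
Qed.

Lemma greatest_decay_adherent u e : 1 <= u -> 0 < e ->
  exists v h, crossing L u v h /\ greatest_decay L u - e <= decay v h.
Proof.
move=> u1 e0; have u0 : 0 < u by lra.
have [hi _] := log_ratios_bounded u1.
have [r /(log_ratiosP _ u0)[v [h [vh ->]]] rP] := sup_adherent (divr_gt0 e0 u0) hi.
exists v, h; split => //; move: rP; rewrite ltr_pdivlMr// mulrBl divfK ?gt_eqF//.
by rewrite mulrC => /ltW.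
Qed.

Lemma decay_linear_bound (H : R -> R) :
  (forall u, 1 <= u -> exists v h, crossing L u v h /\ `|H u - decay v h| <= 1) ->
  exists B, forall u, 1 <= u -> `|H u| <= B * u.
Proof.
move=> HP; have [B B0 BP] := crossing_bound; exists (B + 1) => u u1.
have [v [h [vh hH]]] := HP _ u1; have := BP _ _ _ u1 vh.
move: hH; rewrite !ler_norml => /andP[? ?] /andP[? ?]; apply/andP; split; nra.
Qed.

(** A path of nearly least decay at the level u1 + u2 + A begins with a
    crossing of the level u1 followed by a crossing of the level u2, and what
    remains has bounded cost and bounded decay. As the decay is superadditive,
    least_decay is superadditive up to a constant. *)
Lemma least_decay_limit : exists l, forall e, 0 < e -> exists u0, forall u, u0 <= u ->
  `|least_decay L u - l * u| <= e * u.
Proof.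
have [A A0 AP] := crossing_cost; have [B B0 BP] := decay_bound.
have [B' HB] : exists B', forall u, 1 <= u -> `|least_decay L u| <= B' * u.
  apply: decay_linear_bound => u u1; have [v [h [vh hP]]] := least_decay_adherent u1 ltr01.
  by exists v, h; split => //; have := least_decay_le u1 vh; rewrite ler_norml => ?; apply/andP; split; lra.
pose C' := B * (1 + 2 * A).
have C'0 : 0 <= C' by rewrite mulr_ge0//; lra.
apply: (almost_superadditive_limit (C := A) (C' := C') (ltW A0) C'0 HB).
move=> u1 u2 u11 u21; apply/ler_addgt0Pr => e e0.
have u121 : 1 <= u1 + u2 + A by lra.
have [v [h [vh hP]]] := least_decay_adherent u121 e0.
apply: le_trans hP; have ch := AP _ _ _ (le_trans ler01 u121) vh.
have [hL [k0 [b0 [_ _ uh]]]] := vh.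
have [||k1 [b1 [h1 [hE c1 c1']]]] := first_crossing (u := u1) _ _ (inGV hL); [lra|lra|].
move: (hL); rewrite hE => /path_in_cat[hL1 hL2].
have cE := cost_cat (v := v) (h := rcons k1 b1) (h' := h1).
have cE' := cE ltac:(by rewrite -hE; exact: inGV).
have cr1 : crossing L u1 v (rcons k1 b1) by split => //; exists k1, b1.
have ch1 := AP _ _ _ (le_trans ler01 u11) cr1.
have [||k2 [b2 [h2 [h1E c2 c2']]]] := first_crossing (u := u2) _ _ (inGV hL2); [lra|rewrite hE in uh; lra|].
move: (hL2); rewrite h1E => /path_in_cat[hL21 hL22].
have cr2 : crossing L u2 (path_end v (rcons k1 b1)) (rcons k2 b2) by split => //; exists k2, b2.
have cE2 := cost_cat (v := path_end v (rcons k1 b1)) (h := rcons k2 b2) (h' := h2).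
have cE2' := cE2 ltac:(by rewrite -h1E; exact: inGV).
have d1 : decay v (rcons k1 b1) + decay (path_end v (rcons k1 b1)) h1 <= decay v h.
  by rewrite hE; apply: decay_cat; rewrite -hE; exact: inGV.
have d2 := @decay_cat (path_end v (rcons k1 b1)) (rcons k2 b2) h2.
have d2' := d2 ltac:(by rewrite -h1E; exact: inGV).
have := BP _ _ (inGV hL22); rewrite ler_norml => /andP[d3 _].
have m1 := least_decay_le u11 cr1; have m2 := least_decay_le u21 cr2.
rewrite -h1E in d2' cE2'; rewrite -hE in cE'.
have : B * (1 + cost (path_end (path_end v (rcons k1 b1)) (rcons k2 b2)) h2) <= C'.
  by rewrite /C' ler_pM2l//; clear - fnc L_loop L_nonempty L_irr LGV inGV cE' cE2' ch c1' c2'; lra.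
rewrite -h1E -hE; clear - fnc L_loop L_nonempty L_irr LGV inGV d1 d2' d3 m1 m2; lra.
Qed.

(** Join paths of nearly greatest decay at the levels u1 and u2 and prolong
    the result at its end until it crosses the level u1 + u2 + C. Only the
    superadditivity of the decay is used, so that added edges, which may be
    any edges of bounded total cost, can lower the decay by a constant at
    most. *)
Lemma greatest_decay_limit : exists l, forall e, 0 < e -> exists u0, forall u, u0 <= u ->
  `|greatest_decay L u - l * u| <= e * u.
Proof.
have [A A0 AP] := crossing_cost; have [B B0 BP] := decay_bound.
have [n n0 nP] := connecting_path.
have [B' HB] : exists B', forall u, 1 <= u -> `|greatest_decay L u| <= B' * u.
  apply: decay_linear_bound => u u1; have [v [h [vh hP]]] := greatest_decay_adherent u1 ltr01.
  by exists v, h; split => //; have := greatest_decay_ge u1 vh; rewrite ler_norml => ?; apply/andP; split; lra.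
pose C := 2 * A + n%:R.
have Cp : 0 <= C by rewrite addr_ge0// mulr_ge0// ltW.
have n1 : 0 <= n%:R :> R by [].
pose C' := B * (1 + n%:R) + B * (1 + C + A).
have C'0 : 0 <= C' by rewrite addr_ge0// mulr_ge0//; lra.
apply: (almost_superadditive_limit (C := C) (C' := C') Cp C'0 HB).
move=> u1 u2 u11 u21; apply/ler_addgt0Pr => e e0.
have e2 : 0 < e / 2 by lra.
have [v1 [h1 [vh1 hP1]]] := greatest_decay_adherent u11 e2.
have [v2 [h2 [vh2 hP2]]] := greatest_decay_adherent u21 e2.
have [h1L [_ [_ [_ _ uh1]]]] := vh1; have [h2L [_ [_ [_ _ uh2]]]] := vh2.
have ch1 := AP _ _ _ (le_trans ler01 u11) vh1; have ch2 := AP _ _ _ (le_trans ler01 u21) vh2.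
have Le1 := path_in_end h1L; have Lv2 := path_in_start h2L.
have [f fe] := vertex_nonempty (LGV Le1); have [g gv] := vertex_nonempty (LGV Lv2).
have [nu [nuL nuE nuc _ _]] := nP _ _ _ _ Le1 Lv2 fe gv.
pose h := h1 ++ nu ++ h2.
have nuh2 : path_in S K L (path_end v1 h1) (nu ++ h2).
  by apply/path_in_cat; rewrite nuE.
have hL : path_in S K L v1 h by apply/path_in_cat.
have cE : cost v1 h = cost v1 h1 + (cost (path_end v1 h1) nu + cost v2 h2).
  by rewrite cost_cat ?cost_cat ?nuE//; exact: inGV.
have cnu := cost_ge0 (inGV nuL).
have u'0 : 0 <= u1 + u2 + C - cost v1 h by rewrite /C; lra.
have [k kc] := crossing_exists (path_in_end hL) u'0.
have hkL : path_in S K L v1 (h ++ k) by apply/path_in_cat; split=> //; case: kc.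
have ck := AP _ _ _ u'0 kc.
have hkE := cost_cat (inGV hkL).
have hkc : crossing L (u1 + u2 + C) v1 (h ++ k).
  split=> //; have [kL [k' [b [kE k1 k2]]]] := kc.
  exists (h ++ k'), b; rewrite kE -rcons_cat; split => //.
    rewrite cost_cat; first lra.
    by move: (inGV hkL); rewrite kE -rcons_cat -cats1 => /path_in_cat[].
  by rewrite rcons_cat -kE hkE; lra.
have uu : 1 <= u1 + u2 + C by clear - fnc L_loop L_nonempty L_irr LGV inGV u11 u21 Cp; lra.
have := greatest_decay_ge uu hkc.
have d1 := decay_cat (inGV hkL).
have d2 := decay_cat (inGV hL).
have d3 := decay_cat (inGV nuh2); rewrite nuE in d3.
have := BP _ _ (inGV kc.1); rewrite ler_norml => /andP[d4 _].
have := BP _ _ (inGV nuL); rewrite ler_norml => /andP[d5 _].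
have b1 : B * (1 + cost (path_end v1 h) k) <= B * (1 + C + A).
  by rewrite ler_pM2l//; clear - fnc L_loop L_nonempty L_irr LGV inGV ck cE uh1 uh2 cnu; lra.
have b2 : B * (1 + cost (path_end v1 h1) nu) <= B * (1 + n%:R).
  by rewrite ler_pM2l// lerD2l.
rewrite /C'.
clear - fnc L_loop L_nonempty L_irr LGV inGV hP1 hP2 d1 d2 d3 d4 d5 b1 b2; lra.
Qed.

(** Applied to inf and to sup, which define alpha_min and alpha_max. *)
Lemma lim_from_decay (F : set R -> R) (l : R) :
  (forall e, 0 < e -> exists u0, forall u, u0 <= u ->
    `|u * F (log_ratios S K le p L (expR (- u))) - l * u| <= e * u) ->
  lim (F (log_ratios S K le p L t) @[t --> 0^'+]) = l.
Proof.
move=> h; apply: cvg_lim; first exact: Rhausdorff.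
apply/cvgrPdist_le => e /h[u0 u0P].
near=> t.
have : 0 < t /\ Num.max u0 1 <= - ln t by near: t; exact: log_near0.
move=> [t0]; rewrite ge_max => /andP[/u0P + t1].
rewrite opprK lnK//; move: t1; move: (- ln t) => u u1.
set r := F _; rewrite (_ : u * r - l * u = (r - l) * u); last by ring.
have up : 0 < u by exact: lt_le_trans ltr01 u1.
by rewrite normrM (gtr0_norm up) (ler_pM2r up) distrC.
Unshelve. all: by end_near. Qed.

Lemma alpha_min_limit e : 0 < e -> exists u0, forall u, u0 <= u ->
  `|least_decay L u - amin L * u| <= e * u.
Proof.
have [l lP] := least_decay_limit.
have -> : amin L = l by apply: lim_from_decay.
exact: lP.
Qed.

Lemma alpha_max_limit e : 0 < e -> exists u0, forall u, u0 <= u ->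
  `|greatest_decay L u - amax L * u| <= e * u.
Proof.
have [l lP] := greatest_decay_limit.
have -> : amax L = l by apply: lim_from_decay.
exact: lP.
Qed.

End LoopClass.
End LoopClassExponents.

(** An edge determines its slot, and there are finitely many edges. *)
Lemma slot_bounds : exists2 c, 0 < c & forall e, GE e ->
  forall I, edge_slot e I ->
    [/\ I.1 = 0 \/ c <= I.1, I.2 = 1 \/ c <= 1 - I.2 & c <= diam I].
Proof.
apply: (@finite_lower_bound R (set (sim R) * set (sim R) * R)%type).
- by case: fnc.
- move=> e c d c0 cd eP I /eP[h1 h2 h3]; split; last exact: le_trans h3.
    by case: h1; [left|right; exact: le_trans cd _].
  by case: h2; [left|right; exact: le_trans cd _].
- move=> e /graph_edge_slot[I eI].
  have [[I1 I12 I2] _ _ _ _] : slot (refine e.1.1) I by case: eI.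
  have pos (x : R) : 0 <= x -> exists2 y, 0 < y & x = 0 \/ y <= x.
    move=> x0; have [->|xn] := eqVneq x 0; first by exists 1 => //; left.
    by exists x; [rewrite lt_neqAle eq_sym xn|right].
  have [y1 y10 y1P] := pos _ I1.
  have [y2 y20 y2P] := pos (1 - I.2) ltac:(lra).
  exists (Num.min y1 (Num.min y2 (diam I))).
    by rewrite !lt_min y10 y20 subr_gt0.
  move=> J /(edge_slot_inj eI) <-; split.
  + by case: y1P; [left|right; rewrite ge_min; apply/orP; left].
  + case: y2P => h; first by left; lra.
    by right; rewrite !ge_min h orbT.
  + by rewrite !ge_min lexx !orbT.
Qed.

Lemma scale_bounds : exists c C, [/\ 0 < c, 0 < C &
  forall v, GV v -> c <= scale v <= C].
Proof.
have sg v : GV v -> 0 < scale v.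
  by move=> [t [D [t0 netD ->]]]; exact (scale_gt0 t0 netD).
have finV : finite_set (graph_vertices S K) by case: fnc.
have [| |c c0 cP] := @finite_lower_bound R _ _ (fun v c => c <= scale v) finV.
- by move=> v c d _ /le_trans; apply.
- by move=> v /sg v0; exists (scale v).
have [| |d d0 dP] := @finite_lower_bound R _ _ (fun v c => c <= (scale v)^-1) finV.
- by move=> v c' d' _ /le_trans; apply.
- by move=> v /sg v0; exists (scale v)^-1 => //; rewrite invr_gt0.
exists c, d^-1; split => //; first by rewrite invr_gt0.
move=> v Vv; rewrite cP//= -[leLHS]invrK lef_pV2 ?posrE ?invr_gt0 ?sg//; exact: dP.
Qed.

(** * Nested sequences of net intervals *)

(** The nested net intervals of an infinite path from the root. *)
Definition descent (t : nat -> R) (D : nat -> R * R) : Prop :=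
  [/\ t 0%N = 2, D 0%N = (0, 1) & forall n,
    child S K (t n) (D n) (D n.+1) /\ t n.+1 = tg S K (t n) (D n)].

Section Descents.
Context (t : nat -> R) (D : nat -> R * R).

Definition vertex_at n : vertex R := neighbour_set S K (t n) (D n).
Definition step_at n : @step R := (vertex_at n.+1, ((D n.+1).1 - (D n).1) / diam (D n)).
Definition walk a k : seq (@step R) := [seq step_at i | i <- iota a k].

End Descents.

Section DescentTheory.

Lemma root_net : net_interval S K 2 (0, 1).
Proof.
have L2 : Lambda S 2 [::] by rewrite /Lambda ltr1n.
split=> //=.
- by exists [::] => //; left; rewrite sim_app_id.
- by exists [::] => //; right; rewrite sim_app_id.
- apply/seteqP; split => // y [/open_segmentE/andP[/= y0 y1] [s]].
  rewrite /Lambda ltr1n /= => -> [] /=; rewrite sim_app_id => yE; move: y0 y1; rewrite yE ?ltxx//.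
- have [x Kx x01] := attractor_inner.
  by exists x; split => //; apply/open_segmentE.
Qed.

Lemma root_neighbours : neighbour_set S K 2 (0, 1) = [set sim_id].
Proof.
have idE : sim_comp (sim_inv (T_ (0, 1))) sim_id = sim_id :> sim R.
  by apply: sim_eq; rewrite /= /diam /=; field.
apply/seteqP; split=> f.
  by move=> [s [[+ _] ->]]; rewrite /Lambda ltr1n /= => ->.
move=> ->; exists [::]; split => //; split; first by rewrite /Lambda ltr1n.
have [x Kx x01] := attractor_inner.
exists x; split; first by exists x => //=; rewrite sim_app_id.
exact/open_segmentE.
Qed.

Context {t : nat -> R} {D : nat -> R * R} (dsc : descent t D).
Local Notation vert := (vertex_at t D).
Local Notation stp := (step_at t D).
Local Notation seg := (walk t D).

Lemma descent_net n : 0 < t n /\ net_interval S K (t n) (D n).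
Proof.
case: dsc => t0 D0 ch; elim: n => [|n [tn0 netn]].
  by rewrite t0 D0; split => //; exact: root_net.
by have [h ->] := ch n; have [? ?] := child_net tn0 netn h.
Qed.

Lemma descent_realizes n : realizes S K (vert n, (stp n).1, (stp n).2) (t n) (D n) (D n.+1).
Proof.
case: dsc => _ _ /(_ n)[ch tE]; have [t0 netD] := descent_net n.
by split => //; rewrite /child_edge /step_at /= /vertex_at tE.
Qed.

Lemma descent_edge n : GE (vert n, (stp n).1, (stp n).2).
Proof. by exists (t n), (D n), (D n.+1); exact: descent_realizes. Qed.

Lemma vertex_at_graph n : GV (vert n).
Proof. by have [t0 netD] := descent_net n; exists (t n), (D n). Qed.

Lemma vertex_at0 : vert 0%N = [set sim_id].
Proof. by case: dsc => t0 D0 _; rewrite /vertex_at t0 D0 root_neighbours. Qed.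

Lemma walk_end a k : path_end (vert a) (seg a k) = vert (a + k).
Proof. by elim: k a => [|k IH] a /=; rewrite ?addn0// IH addnS. Qed.

Lemma walk_cat a k l : seg a (k + l) = seg a k ++ seg (a + k) l.
Proof. by rewrite /walk iotaD map_cat. Qed.

Lemma walk_in (L : set (vertex R)) a k : (forall i, (a <= i <= a + k)%N -> L (vert i)) ->
  path_in S K L (vert a) (seg a k).
Proof.
elim: k a => [|k IH] a La; first by split => //; apply: La; lia.
split; first by apply: La; lia.
by split; [exact: descent_edge|apply: IH => i ia; apply: La; lia].
Qed.

Lemma walk_graph a k : path_in S K GV (vert a) (seg a k).
Proof. by apply: walk_in => i _; exact: vertex_at_graph. Qed.

Lemma descent_tg n : t n.+1 = tg S K (t n) (D n).
Proof. by case: dsc => _ _ /(_ n)[]. Qed.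

Lemma walk_weight a k : path_weight S K (vert a) (seg a k) = t (a + k).+1 / t a.+1.
Proof.
have tn n : t n != 0 by have [/lt0r_neq0] := descent_net n.
elim: k a => [|k IH] a; first by rewrite addn0 divff.
rewrite /= -/(seg a.+1 k) IH (edge_weight_tg (descent_realizes a)).
by rewrite -descent_tg -descent_tg addnS; field; rewrite !tn.
Qed.

Lemma walk_cost a k : cost (vert a) (seg a k) = ln (t a.+1) - ln (t (a + k).+1).
Proof.
have tn n : 0 < t n by have [] := descent_net n.
by rewrite /path_cost walk_weight ln_div ?posrE// opprB.
Qed.

Lemma descent_scale n : t n.+1 = scale (vert n) * diam (D n).
Proof. by rewrite descent_tg; have [t0 netD] := descent_net n; exact: tg_scale. Qed.

Lemma descent_lt n : (D n).1 < (D n).2.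
Proof. by have [_ netD] := descent_net n; exact: net_lt netD. Qed.

Lemma descent_diam_gt0 n : 0 < diam (D n).
Proof. by rewrite subr_gt0 descent_lt. Qed.

Lemma descent_slot n : exists2 I,
  edge_slot (vert n, (stp n).1, (stp n).2) I & D n.+1 = place (D n) I.
Proof. by have [_ _] := realizes_slot (descent_realizes n). Qed.

Lemma descent_step n : exists2 I, edge_slot (vert n, (stp n).1, (stp n).2) I &
  [/\ (D n.+1).1 = (D n).1 + I.1 * diam (D n), (D n.+1).2 = (D n).2 - (1 - I.2) * diam (D n) &
      diam (D n.+1) = diam I * diam (D n)].
Proof.
have [I eI DE] := descent_slot n; exists I => //; rewrite DE diam_place; split.
- by rewrite /place /sim_app /=; ring.
- by rewrite /place /sim_app /= /diam; ring.
- by rewrite mulrC.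
Qed.

Lemma descent_mono1 n : (D n).1 <= (D n.+1).1 /\ (D n.+1).2 <= (D n).2.
Proof.
have [I [[[I1 I12 I2] _ _ _ _] _ _] [-> -> _]] := descent_step n.
have d0 := descent_diam_gt0 n.
split; first by rewrite lerDl mulr_ge0// ltW.
by rewrite gerDl oppr_le0; apply: mulr_ge0; [rewrite subr_ge0|exact: ltW].
Qed.

Lemma descent_mono n k : (D n).1 <= (D (n + k)).1 /\ (D (n + k)).2 <= (D n).2.
Proof.
elim: k => [|k [h1 h2]]; first by rewrite addn0.
rewrite addnS; have [h3 h4] := descent_mono1 (n + k).
by split; [exact: le_trans h1 h3|exact: le_trans h4 h2].
Qed.

End DescentTheory.

Section DescentGaps.
Implicit Types (t : nat -> R) (D : nat -> R * R).

(** Iterates slot_bounds over k generations. *)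
Lemma descent_gap k : exists2 c, 0 < c & c <= 1 /\ forall t D, descent t D -> forall n,
  [/\ (D (n + k)%N).1 = (D n).1 \/ (D n).1 + c * diam (D n) <= (D (n + k)%N).1,
      (D (n + k)%N).2 = (D n).2 \/ (D (n + k)%N).2 <= (D n).2 - c * diam (D n) &
      c * diam (D n) <= diam (D (n + k)%N)].
Proof.
have [c c0 cP] := slot_bounds.
elim: k => [|k [d d0 [d1 dP]]].
  exists 1 => //; split=> // t D dsc n.
  by rewrite addn0; split; [left|left|rewrite mul1r].
have m0 : 0 < Num.min c 1 by rewrite lt_min c0 ltr01.
have m1 : Num.min c 1 <= 1 by rewrite ge_min lexx orbT.
have mc : Num.min c 1 <= c by rewrite ge_min lexx.
move: (Num.min c 1) m0 m1 mc => z z0 z1 zc.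
have zd : z * d <= d by rewrite ler_piMl// ltW.
exists (z * d); first by rewrite mulr_gt0.
split=> [|t D dsc n]; first exact: le_trans zd d1.
have [h1 h2 h3] := dP t D dsc n.
have [I eI [a1 a2 a3]] := descent_step dsc (n + k).
have [g1 g2 g3] := cP _ (descent_edge dsc (n + k)) _ eI.
have [M1 M2] := descent_mono1 dsc (n + k).
have dn := descent_diam_gt0 dsc n; have dnk := descent_diam_gt0 dsc (n + k).
rewrite addnS.
have zdn : z * d * diam (D n) <= d * diam (D n) by rewrite ler_pM2r.
have step (y : R) : c <= y -> z * d * diam (D n) <= y * diam (D (n + k)%N).
  move=> cy; rewrite -mulrA; apply: (@le_trans _ _ (z * diam (D (n + k)%N))).
    by rewrite ler_pM2l.
  by rewrite ler_pM2r//; exact: le_trans cy.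
split.
- case: h1 => h1; last by right; lra.
  case: g1 => g1; first by left; rewrite a1 g1 mul0r addr0.
  by right; rewrite a1 h1 lerD2l step.
- case: h2 => h2; last by right; lra.
  case: g2 => g2; first by left; rewrite a2 g2 subrr mul0r subr0.
  by right; rewrite a2 h2 lerD2l lerN2 step.
- by rewrite a3 step.
Qed.

Lemma descent_diam_bound : exists c C rho, [/\ 0 < c, 0 < C, 0 < rho < 1 &
  forall t D, descent t D -> forall n,
    [/\ c * t n.+1 <= diam (D n), diam (D n) <= C * t n.+1 &
        forall k, t (n + k)%N.+1 <= rho ^+ k * t n.+1]].
Proof.
have [c [C [c0 C0 sP]]] := scale_bounds.
have [r0 [r1 [r00 r01 r11 rP]]] := weight_bounds.
exists C^-1, c^-1, r1; rewrite !invr_gt0; split => //; first by lra.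
move=> t D dsc n.
have tn k : 0 < t k by have [] := descent_net dsc k.
have /andP[s1 s2] := sP _ (vertex_at_graph dsc n).
have dn := descent_diam_gt0 dsc n.
rewrite (descent_scale dsc n); split.
- by rewrite mulrA; apply: ler_piMl; [exact: ltW|rewrite ler_pdivrMl// mulr1].
- by rewrite mulrA; apply: ler_peMl; [exact: ltW|rewrite ler_pdivlMl// mulr1].
- move=> k; rewrite -(descent_scale dsc n).
  rewrite -ler_pdivrMr// -(walk_weight dsc).
  have wr e : GE e -> edge_weight S K e <= r1 by move=> /rP/andP[].
  by have := path_weight_le_exp wr (walk_graph dsc n k); rewrite size_map size_iota.
Qed.

Lemma descent_shrink : exists k, forall t D, descent t D -> forall n,
  diam (D (n + k)%N) < diam (D n).
Proof.
have [c [C [rho [c0 C0 /andP[rho0 rho1] P]]]] := descent_diam_bound.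
have cC : 0 < c / C by rewrite divr_gt0.
have [k /(_ k (leqnn k)) kP] := exp_small rho0 rho1 cC.
exists k => t D dsc n; have [h1 _ h3] := P t D dsc n; have [_ h2 _] := P t D dsc (n + k)%N.
apply: le_lt_trans h2 _; apply: lt_le_trans h1.
have tn : 0 < t n.+1 by have [] := descent_net dsc n.+1.
apply: (@le_lt_trans _ _ (C * (rho ^+ k * t n.+1))); first by rewrite ler_pM2l.
by rewrite mulrA ltr_pM2r// mulrC -ltr_pdivlMr.
Qed.

Lemma descent_diam_cvg t D (e : R) : descent t D -> 0 < e ->
  exists N, forall n, (N <= n)%N -> diam (D n) < e.
Proof.
move=> dsc e0; have [c [C [rho [c0 C0 /andP[rho0 rho1] P]]]] := descent_diam_bound.
have t10 : 0 < t 1%N by have [] := descent_net dsc 1.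
have cC : 0 < e / (C * t 1%N) by rewrite divr_gt0// mulr_gt0.
have [k kP] := exp_small rho0 rho1 cC; exists k => n /kP nP.
have [_ h2 _] := P t D dsc n; have [_ _ h3] := P t D dsc 0%N.
apply: le_lt_trans h2 _; apply: (@le_lt_trans _ _ (C * (rho ^+ n * t 1%N))).
  by rewrite ler_pM2l//; exact: h3.
by rewrite mulrCA -ltr_pdivlMr// mulr_gt0.
Qed.

Lemma descent_point t D : descent t D ->
  exists2 x, K x & \bigcap_n segment (D n) = [set x].
Proof.
move=> dsc; pose A := [set (D n).1 | n in [set: nat]].
have aleb n k : (D n).1 <= (D k).2.
  have [h1 _] := descent_mono dsc n k; have [_ h2] := descent_mono dsc k n.
  have := descent_lt dsc (n + k); rewrite addnC in h2; lra.
have A1 : has_ubound A by exists (D 0%N).2 => _ [n _ <-].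
have A0 : A !=set0 by exists (D 0%N).1, 0%N.
have xD n : segment (D n) (sup A).
  apply/segmentE; apply/andP; split; first by apply: ub_le_sup => //; exists n.
  by apply: ge_sup => // _ [k _ <-].
exists (sup A); last first.
  apply/seteqP; split=> [y yD|_ -> n _]; last exact: xD.
  apply/eqP; rewrite -subr_eq0 -normr_le0; apply/ler_addgt0Pr => e e0; rewrite add0r.
  have [N /(_ N (leqnn N)) NP] := descent_diam_cvg dsc e0.
  have /segmentE/andP[h1 h2] := xD N; have /segmentE/andP[h3 h4] := yD N I.
  by move: NP; rewrite /diam ler_norml => NP; apply/andP; split; lra.
have cK : closed K by apply: compact_closed; [exact: Rhausdorff|exact: ifs_compact HS].
apply: cK => B /nbhs_ballP[e /= e0 eB].
have [N /(_ N (leqnn N)) NP] := descent_diam_cvg dsc e0.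
have [_ [_ _ _ _ [k [/open_segmentE/andP[k1 k2] Kk]]]] := descent_net dsc N.
exists k; split => //; apply: eB; rewrite /ball /=.
have /segmentE/andP[h1 h2] := xD N.
by move: NP; rewrite /diam ltr_norml => NP; apply/andP; split; lra.
Qed.

(** Net intervals of one generation have disjoint interiors. *)
Lemma net_interval_unique (s x : R) (D1 D2 : R * R) : net_interval S K s D1 ->
  net_interval S K s D2 -> open_segment D1 x -> segment D2 x -> D1 = D2.
Proof.
move=> [a1 b1 l1 o1 _] [a2 b2 l2 o2 _] /open_segmentE/andP[x1 x2] /segmentE/andP[y1 y2].
have no1 z : endpoints S s z -> D1.1 < z < D1.2 -> False.
  by move=> ez zD; suff : set0 z by []; rewrite -o1; split=> //; exact/open_segmentE.
have no2 z : endpoints S s z -> D2.1 < z < D2.2 -> False.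
  by move=> ez zD; suff : set0 z by []; rewrite -o2; split=> //; exact/open_segmentE.
have h1 : D2.1 <= D1.1 by rewrite leNgt; apply/negP => h; apply: (no1 D2.1 a2); lra.
have h2 : D1.2 <= D2.2 by rewrite leNgt; apply/negP => h; apply: (no1 D2.2 b2); lra.
have h3 : D1.1 <= D2.1 by rewrite leNgt; apply/negP => h; apply: (no2 D1.1 a1); lra.
have h4 : D2.2 <= D1.2 by rewrite leNgt; apply/negP => h; apply: (no2 D1.2 b1); lra.
rewrite [LHS]surjective_pairing [RHS]surjective_pairing.
by congr pair; apply/eqP; rewrite eq_le ?h1 ?h2 ?h3 ?h4.
Qed.

(** A point inside all the net intervals of a descent has no other
    representation; this is how interior points are recognized. *)
Lemma descent_unique t D t' D' x : descent t D -> descent t' D' ->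
  (forall n, open_segment (D n) x) -> (forall n, segment (D' n) x) ->
  forall n, t' n = t n /\ D' n = D n.
Proof.
move=> [t0 D0 ch] [t'0 D'0 ch'] xD xD'; elim => [|n [tE DE]]; first by rewrite t0 D0.
have [[net _] ->] := ch n; have [[net' _] ->] := ch' n; rewrite tE DE; split=> //.
by apply/esym; apply: net_interval_unique net _ (xD _) (xD' _); rewrite -tE -DE.
Qed.

Lemma symbolic_descent g x : symbolic_rep S K g x <-> exists t D, [/\ descent t D,
  forall n, g n = (vertex_at t D n, (step_at t D n).1, (step_at t D n).2) &
  \bigcap_n segment (D n) = [set x]].
Proof.
split=> [[t [D [t0 D0 h xD]]]|[t [D [[t0 D0 h] gE xD]]]].
  exists t, D; split => //; first by split=> // n; have [] := h n.
  by move=> n; have [_ tE ->] := h n; rewrite /child_edge -tE.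
exists t, D; split => // n; have [ch tE] := h n; split => //.
by rewrite gE /child_edge -tE.
Qed.

(** Choose at every step the child realizing the next edge. *)
Lemma path_descent (v : nat -> vertex R) (a : nat -> @step R) : v 0%N = [set sim_id] ->
  (forall n, graph_edges S K (v n, (a n).1, (a n).2)) -> (forall n, v n.+1 = (a n).1) ->
  exists t D, descent t D /\ forall n, vertex_at t D n = v n /\ step_at t D n = a n.
Proof.
move=> v0 aP vS.
pose next n (y : R * (R * R)) : R * (R * R) := (tg S K y.1 y.2,
  xget (0, 1) [set D1 | realizes S K (v n, (a n).1, (a n).2) y.1 y.2 D1]).
pose y := fix y n := if n is n'.+1 then next n' (y n') else (2, (0, 1)).
have yP n : [/\ 0 < (y n).1, net_interval S K (y n).1 (y n).2,
    neighbour_set S K (y n).1 (y n).2 = v n &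
    realizes S K (v n, (a n).1, (a n).2) (y n).1 (y n).2 (y n.+1).2].
  have nextP k : 0 < (y k).1 -> net_interval S K (y k).1 (y k).2 ->
      neighbour_set S K (y k).1 (y k).2 = v k ->
      realizes S K (v k, (a k).1, (a k).2) (y k).1 (y k).2 (y k.+1).2.
    move=> t0 netk vk; rewrite /=; case: xgetP => [D1 _ //|no].
    by have [D1 /no] := edge_realizable (aP k) t0 netk vk.
  elim: n => [|n [t0 netn vn rn]].
    have h1 : 0 < (y 0%N).1 by [].
    have h2 : net_interval S K (y 0%N).1 (y 0%N).2 := root_net.
    have h3 : neighbour_set S K (y 0%N).1 (y 0%N).2 = v 0%N by rewrite v0 root_neighbours.
    by split => //; exact: nextP.
  have [_ _ ch _] := rn; have [h1 h2] := child_net t0 netn ch.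
  have [_ h3 _] := realizes_slot rn.
  have h3' : neighbour_set S K (y n.+1).1 (y n.+1).2 = v n.+1 by rewrite vS.
  by split => //; exact: nextP.
exists (fun n => (y n).1), (fun n => (y n).2); split.
  by split => // n; have [_ _ _ [_ _ ch _]] := yP n.
move=> n; have [_ _ vE [_ _ _ eE]] := yP n; split => //.
case: eE => _ h1 h2; transitivity ((a n).1, (a n).2); last by case: (a n).
by congr pair; apply/esym; [exact: h1|exact: h2].
Qed.

End DescentGaps.

(** * The measure of net intervals along a descent *)

Section DescentMass.
Implicit Types (E : set (measurableTypeR R)) (f g : sim R).

(** The piece of the measure carried by f charges a slot only if f hits the
    slot, and then f is given by exactly one neighbour of the slot. *)
Lemma mass_piece (e : edge R) I E f : GV e.1.2 -> (T_ I).1 != 0 -> f.1 != 0 ->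
  measurable E -> E `<=` open_segment I ->
  (hits f I -> e.1.2 (sim_comp (sim_inv (T_ I)) f)) ->
  mass (sim_app f @^-1` E) = \sum_(g <- neighbours le e.1.2)
    (sim_comp (T_ I) g == f)%:R * mass (sim_app (sim_comp (T_ I) g) @^-1` E).
Proof.
move=> GVw In fn mE EI hitf.
have [h|h] := pselect (hits f I).
  have wf := (mem_neighbours _ GVw).2 (hitf h).
  rewrite (bigD1_seq _ wf (uniq_neighbours _))/= sim_compKV// eqxx mul1r.
  rewrite big1 ?addr0// => g gf; case: eqP => [gE|]; last by rewrite mul0r.
  by case/eqP: gf; rewrite -gE sim_compK.
have m0 : mass (sim_app f @^-1` E) = 0.
  apply: (mass_off_attractor); first exact: measurable_sim.
  by rewrite -subset0 => x [/EI xI Kx]; apply: h; exists (sim_app f x); split => //; exists x.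
rewrite m0 big1// => g _; case: eqP => [->|]; last by rewrite mul0r.
by rewrite m0 mulr0.
Qed.

(** A neighbour of maximal ratio is cut once by the self-similarity equation,
    and the pieces are treated by mass_piece; any other neighbour is itself
    such a piece. These are the two forms of the entries in trans_entry_big. *)
Lemma mass_edge (e : edge R) I E f : GE e -> edge_slot e I ->
  measurable E -> E `<=` open_segment I -> e.1.1 f ->
  mass (sim_app f @^-1` E) = \sum_(g <- neighbours le e.1.2)
    trans_entry S K p e f g * mass (sim_app (sim_comp (T_ I) g) @^-1` E).
Proof.
move=> ge eI mE EI vf.
have In := slot_T_neq0 eI.
have GVw : GV e.1.2 by case: e ge {eI vf} => -[v w] q /edge_target.
have [[[I1 I12 I2] _ _ _ _] wE _] := eI.
have hits01 h : hits h I -> hits h (0, 1).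
  move=> [x [hx /open_segmentE/andP[x1 x2]]]; exists x; split => //.
  by apply/open_segmentE; apply/andP; split => /=; lra.
have [t [D [t0 netD vE]]] := edge_source_net ge.
have fnz : f.1 != 0 by apply: (neighbour_neq0 netD); rewrite -vE.
have fle : `|f.1| <= scale e.1.1.
  by have [_] := scale_max t0 netD; rewrite -vE; apply.
under eq_big_seq => g gw do rewrite (trans_entry_big ge eI vf ((mem_neighbours g GVw).1 gw)).
have [fs|fs] := eqVneq `|f.1| (scale e.1.1).
  have Sn l : (S l).1 != 0 by have /andP[] := ifs_ratio HS l; rewrite normr_gt0.
  rewrite (mass_invariant); last exact: measurable_sim.
  rewrite [LHS](eq_bigr (fun l => \sum_(g <- neighbours le e.1.2)
    (p l * (sim_comp (T_ I) g == sim_comp f (S l))%:R) *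
     mass (sim_app (sim_comp (T_ I) g) @^-1` E))); last first.
    move=> l _; rewrite -sim_app_preimage (mass_piece (e := e) (I := I))//.
    - by rewrite mulr_sumr; apply: eq_bigr => g _; rewrite mulrA.
    - by rewrite mulf_neq0.
    - move=> h; rewrite wE; exists (sim_comp f (S l)); split => //.
      split; first exact: hits01.
      by right; exists f, l.
  by rewrite exchange_big /=; apply: eq_bigr => g _; rewrite mulr_suml.
apply: mass_piece => // h; rewrite wE; exists f; split => //.
split; first exact: hits01.
by left; split => //; rewrite lt_neqAle fs.
Qed.

Context {t : nat -> R} {D : nat -> R * R} (dsc : descent t D).
Local Notation vert := (vertex_at t D).
Local Notation stp := (step_at t D).
Local Notation seg := (walk t D).

(** On a net interval the measure is a combination of the pieces given by its
    neighbours, the coefficients being the only row of the matrix of the path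
    that leads to it. *)
Lemma descent_mass n E : measurable E -> E `<=` open_segment (D n) ->
  mass E = \sum_(g <- neighbours le (vert n))
    entry (vert 0%N) (seg 0 n) sim_id g * mass (sim_app (sim_comp (T_ (D n)) g) @^-1` E).
Proof.
have v0 := vertex_at0 dsc.
have GV0 := vertex_at_graph dsc 0%N.
have id0 : sim_id \in neighbours le (vert 0%N) by apply/mem_neighbours => //; rewrite v0.
elim: n E => [|n IH] E mE ED.
  rewrite (sum_delta_seq (fun g => mass (sim_app (sim_comp (T_ (D 0%N)) g) @^-1` E))) ?uniq_neighbours//.
  congr mass; apply/seteqP; split=> x /=; rewrite sim_comp1r;
    have [_ -> _] := dsc; by rewrite /sim_app /= /diam /= subr0 mul1r addr0.
have [M1 M2] := descent_mono1 dsc n.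
have ED' : E `<=` open_segment (D n).
  by move=> x /ED/open_segmentE/andP[x1 x2]; apply/open_segmentE; apply/andP; split; lra.
rewrite (IH _ mE ED').
have [I eI DE] := descent_slot dsc n.
have Dlt := descent_lt dsc n.
have GVn := vertex_at_graph dsc n.
rewrite -addn1 (walk_cat 0 n 1) add0n.
have -> : seg n 1 = [:: stp n] by [].
rewrite [RHS](eq_big_seq (fun g => \sum_(f <- neighbours le (vert n))
   (entry (vert 0%N) (seg 0 n) sim_id f * trans_entry S K p (vert n, (stp n).1, (stp n).2) f g) *
    mass (sim_app (sim_comp (T_ (D n.+1)) g) @^-1` E))); last first.
  move=> g gn; rewrite (path_entry_cat _ _ _ id0) (walk_end 0 n) add0n mulr_suml.
  apply: eq_big_seq => f fn; congr (_ * _ * _); last by rewrite addn1.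
  rewrite /= (eq_bigr (fun f' => (g == f')%:R * trans_entry S K p (vert n, (stp n).1, (stp n).2) f f')).
    by rewrite (sum_delta_seq (trans_entry S K p _ f)) ?uniq_neighbours// -addn1.
  by move=> f' _; rewrite mulrC eq_sym.
rewrite exchange_big /= addn1 big_seq [RHS]big_seq; apply: eq_bigr => f fn.
have vf := (mem_neighbours f GVn).1 fn.
have mF := measurable_sim (T_ (D n)) mE.
rewrite sim_app_preimage (mass_edge (descent_edge dsc n) eI mF _ vf); last first.
  move=> x /ED; rewrite DE => h.
  by apply/(open_segment_place I x Dlt).
rewrite mulr_sumr; apply: eq_bigr => g _; rewrite mulrA.
have -> : T_ (D n.+1) = sim_comp (T_ (D n)) (T_ I) by rewrite DE T_place.
by rewrite -sim_compA !sim_app_preimage.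
Qed.

End DescentMass.

(** * Representations approaching a point from one side *)

(** The child lies between the last end point before a and the first one after
    b. *)
Lemma child_around (t : R) (D : R * R) (a b : R) : 0 < t -> net_interval S K t D ->
  D.1 <= a -> b <= D.2 -> `]a, b[%classic `&` endpoints S (tg S K t D) = set0 ->
  `]a, b[%classic `&` K !=set0 ->
  exists D1, [/\ child S K t D D1, D1.1 <= a & b <= D1.2].
Proof.
move=> t0 netD aD bD ends0 [y [/=]]; rewrite in_itv /= => /andP[ay yb] Ky.
have fin := finite_endpoints (tg_gt0 t0 netD).
have [e1 e2] := net_endpoints_next t0 netD.
have sub1 : finite_set (endpoints S (tg S K t D) `&` [set e | e <= a]) by exact: finite_setIl.
have sub2 : finite_set (endpoints S (tg S K t D) `&` [set e | b <= e]) by exact: finite_setIl.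
have [l [el la] lmax] := finite_max id sub1 (ex_intro _ D.1 (conj e1 aD)).
have [r [er rb] rmin] := finite_max (fun z => - z) sub2 (ex_intro _ D.2 (conj e2 bD)).
have Dl : D.1 <= l by exact: lmax.
have Dr : r <= D.2 by rewrite -lerN2; exact: rmin.
rewrite /= in la rb.
exists (l, r); split => //; split.
  split => //=; first by lra.
    rewrite -subset0 => z [/open_segmentE/andP[/= lz zr] ez].
    have [za|az] := leP z a; first by have := lmax z (conj ez za); rewrite /= leNgt lz.
    have [bz|zb] := leP b z.
      by have := rmin z (conj ez bz); rewrite lerN2 leNgt zr.
    by suff : set0 z by []; rewrite -ends0; split => //=; rewrite in_itv /= az.
  by exists y; split => //; apply/open_segmentE; apply/andP; split => /=; lra.
by move=> z /segmentE/andP[/= z1 z2]; apply/segmentE; apply/andP; split; lra.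
Qed.

(** The side b of x is the left one for true and the right one for false. *)
Definition side (b : bool) (x d : R) : set R := if b then `]x - d, x[%classic else `]x, x + d[%classic.
Definition on_side (b : bool) (x : R) (D : R * R) : Prop :=
  if b then D.1 < x <= D.2 else D.1 <= x < D.2.

Lemma finite_side_gap b x (F : set R) : finite_set F ->
  exists2 d, 0 < d & side b x d `&` F = set0.
Proof.
move=> finF.
have [| |d d0 dP] := @finite_lower_bound R _ F (fun e d => ~ side b x d e) finF.
- move=> e c d c0 cd h hc; apply: h; move: hc; rewrite /side.
  by case: b => /=; rewrite !in_itv /= => /andP[h1 h2]; apply/andP; split; lra.
- move=> e _; have [->|ex] := eqVneq e x.
    exists 1 => //; rewrite /side; case: b => /=; rewrite in_itv /= ?ltxx ?andbF//.
  exists `|e - x|; first by rewrite normr_gt0 subr_eq0.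
  rewrite /side; case: b => /=; rewrite in_itv /= => /andP[h1 h2].
    by move: h1; rewrite ltr0_norm; lra.
  by move: h2; rewrite gtr0_norm; lra.
by exists d => //; rewrite -subset0 => e [h /dP].
Qed.

(** A generation has finitely many end points, so there is none near x
    strictly on the side b, whereas there are points of K: child_around
    applies to a small interval on this side. *)
Lemma child_on_side b x (t : R) (D : R * R) : 0 < t -> net_interval S K t D ->
  (forall d, 0 < d -> side b x d `&` K !=set0) -> on_side b x D ->
  exists2 D1, child S K t D D1 & on_side b x D1.
Proof.
move=> t0 netD acc xD.
have [e1 e2] := net_endpoints_next t0 netD.
have [d d0 dP] := finite_side_gap b x (finite_endpoints (tg_gt0 t0 netD)).
have no z : endpoints S (tg S K t D) z -> ~ side b x d z.
  by move=> ez zs; suff : set0 z by []; rewrite -dP.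
have := acc d d0; move: xD no dP {acc}; rewrite /on_side /side; case: b.
- move=> /andP[D1x xD2] no dP Ks.
  have D1d : D.1 <= x - d.
    by rewrite leNgt; apply/negP => h; apply: (no _ e1); rewrite /= in_itv /= h.
  have [D1 [ch h1 h2]] := child_around t0 netD D1d xD2 dP Ks.
  by exists D1 => //; apply/andP; split; lra.
- move=> /andP[D1x xD2] no dP Ks.
  have D1d : x + d <= D.2.
    by rewrite leNgt; apply/negP => h; apply: (no _ e2); rewrite /= in_itv /= xD2.
  have [D1 [ch h1 h2]] := child_around t0 netD D1x D1d dP Ks.
  by exists D1 => //; apply/andP; split; lra.
Qed.

Lemma descent_on_side b x : (forall d, 0 < d -> side b x d `&` K !=set0) ->
  exists t D, descent t D /\ forall n, on_side b x (D n).
Proof.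
move=> acc.
pose next (y : R * (R * R)) : R * (R * R) := (tg S K y.1 y.2,
  xget (0, 1) [set D1 | child S K y.1 y.2 D1 /\ on_side b x D1]).
pose y := fix y n := if n is n'.+1 then next (y n') else (2, (0, 1)).
have root_side : on_side b x (0, 1).
  (* points of K close to x on one side, and K lies in [0, 1] *)
  rewrite /on_side; case: b acc {next y} => acc.
  + apply/andP; split => /=.
      rewrite ltNge; apply/negP => x0; have [y []] := acc 1 ltr01.
      by rewrite /side /= in_itv /= => /andP[_ yx] /attractor01/andP[y0 _]; lra.
    rewrite leNgt; apply/negP => x1; have [y []] := acc (x - 1) ltac:(lra).
    by rewrite /side /= in_itv /= => /andP[xy _] /attractor01/andP[_ y1]; lra.
  + apply/andP; split => /=.
      rewrite leNgt; apply/negP => x0; have [y []] := acc (- x) ltac:(lra).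
      by rewrite /side /= in_itv /= => /andP[_ yx] /attractor01/andP[y0 _]; lra.
    rewrite ltNge; apply/negP => x1; have [y []] := acc 1 ltr01.
    by rewrite /side /= in_itv /= => /andP[xy _] /attractor01/andP[_ y1]; lra.
have nextP k : 0 < (y k).1 -> net_interval S K (y k).1 (y k).2 -> on_side b x (y k).2 ->
    child S K (y k).1 (y k).2 (y k.+1).2 /\ on_side b x (y k.+1).2.
  move=> t0 netk sk; rewrite /=; case: xgetP => [D1 _ h|no]; first exact: h.
  by have [D1 ch sD1] := child_on_side t0 netk acc sk; case: (no D1).
have yP n : [/\ 0 < (y n).1, net_interval S K (y n).1 (y n).2 & on_side b x (y n).2].
  elim: n => [|n [t0 netn sn]]; first by split => //; exact: root_net.
  have [ch sn'] := nextP n t0 netn sn; have [h1 h2] := child_net t0 netn ch.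
  by split.
exists (fun n => (y n).1), (fun n => (y n).2); split; last by move=> n; have [] := yP n.
by split => // n; have [t0 netn sn] := yP n; have [] := nextP n t0 netn sn.
Qed.

Lemma descent_from_edges (t t' : nat -> R) (D D' : nat -> R * R) :
  descent t D -> descent t' D' ->
  (forall n, (vertex_at t D n, (step_at t D n).1, (step_at t D n).2) =
             (vertex_at t' D' n, (step_at t' D' n).1, (step_at t' D' n).2)) ->
  forall n, t n = t' n /\ D n = D' n.
Proof.
move=> dsc dsc' eE; elim => [|n [tE DE]].
  by case: dsc dsc' => -> -> _ [-> -> _].
have r := descent_realizes dsc n; have r' := descent_realizes dsc' n.
rewrite (descent_tg dsc) (descent_tg dsc') tE DE; split=> //.
have [_ _ [I eI ->]] := realizes_slot r; rewrite eE in eI.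
by rewrite (realizes_place r' eI) DE.
Qed.

(** * Decay of the measure of net intervals in a loop class *)

Section DescentAsymptotics.
Implicit Types (E : set (measurableTypeR R)) (f g : sim R) (t : nat -> R) (D : nat -> R * R).

Lemma measurable_open_segment (I : R * R) : measurable (open_segment I : set (measurableTypeR R)).
Proof. exact: measurable_itv. Qed.

(** A neighbour hits the open unit interval, so it charges this interval;
    there are finitely many neighbours. *)
Lemma piece_mass_bound : exists2 c, 0 < c & forall v, GV v -> forall f, v f ->
  c <= mass (sim_app f @^-1` open_segment (0, 1)).
Proof.
apply: finite_lower_bound; first by case: fnc.
  by move=> v c d _ cd vd f /vd; exact: le_trans.
move=> v GVv; apply: finite_lower_bound; first exact: vertex_finite _ GVv.
  by move=> f c d _ /le_trans; apply.
move=> f vf; exists (mass (sim_app f @^-1` open_segment (0, 1))) => //.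
have [t [D [t0 netD vE]]] := GVv.
have [k [[y Ky yk] /open_segmentE/andP[/= k0 k1]]] : hits f (0, 1).
  by apply: (neighbour_hits netD); rewrite -vE.
have fp : 0 < `|f.1| by rewrite normr_gt0 (neighbour_neq0 netD)// -vE.
pose d := Num.min k (1 - k) / `|f.1|.
have d0 : 0 < d by rewrite divr_gt0// lt_min k0 subr_gt0.
have yd : y - d < y < y + d by apply/andP; split; lra.
apply: lt_le_trans (mass_open_gt0 Ky yd) _.
apply: mass_le; first exact: measurable_itv.
  by apply: measurable_sim; exact: measurable_open_segment.
move=> z /=; rewrite in_itv /= => /andP[z1 z2]; apply/open_segmentE => /=.
have : `|z - y| < d by rewrite ltr_norml; apply/andP; split; lra.
rewrite ltr_pdivlMr// mulrC -sim_app_dist yk lt_min ltr_norml => /andP[/andP[h1 h2]].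
by rewrite ltr_norml => /andP[h3 h4]; apply/andP; split; lra.
Qed.

Lemma root_norm t D n : descent t D ->
  norm (vertex_at t D 0%N) (walk t D 0 n) =
  \sum_(g <- neighbours le (vertex_at t D n)) entry (vertex_at t D 0%N) (walk t D 0 n) sim_id g.
Proof.
move=> dsc; have v0 := vertex_at0 dsc; have GV0 := vertex_at_graph dsc 0%N.
have id0 : sim_id \in neighbours le (vertex_at t D 0%N).
  by apply/mem_neighbours => //; rewrite v0.
rewrite path_normE walk_end add0n.
rewrite -(sum_delta_seq (fun f => \sum_(g <- neighbours le (vertex_at t D n)) entry (vertex_at t D 0%N) (walk t D 0 n) f g) (uniq_neighbours _) id0).
apply: eq_big_seq => f /(mem_neighbours f GV0).
by rewrite v0 => ->; rewrite eqxx mul1r.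
Qed.

(** Each of the pieces in descent_mass has a mass between a positive constant
    and 1. *)
Lemma descent_mass_bounds : exists2 c, 0 < c & forall t D, descent t D -> forall n,
  c * norm (vertex_at t D 0%N) (walk t D 0 n) <= mass (open_segment (D n))
    <= norm (vertex_at t D 0%N) (walk t D 0 n).
Proof.
have [c c0 cP] := piece_mass_bound; exists c => // t D dsc n.
have GVn := vertex_at_graph dsc n; have Dlt := descent_lt dsc n.
have mo := measurable_open_segment (D n).
rewrite (descent_mass dsc mo (@subset_refl _ _)) root_norm//.
have pieceE g : sim_app (sim_comp (T_ (D n)) g) @^-1` open_segment (D n) =
    sim_app g @^-1` open_segment (0, 1).
  apply/seteqP; split=> x /=; rewrite sim_app_comp;
    by have := open_segment_place (0, 1) (sim_app g x) Dlt; rewrite place_unit => -[].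
apply/andP; split.
  rewrite mulr_sumr big_seq [leRHS]big_seq; apply: ler_sum => g gn.
  rewrite mulrC pieceE ler_wpM2l ?path_entry_ge0//.
  exact/cP/(mem_neighbours g GVn).
apply: ler_sum => g _; rewrite ler_piMr ?path_entry_ge0//.
by apply: mass_le1; exact: measurable_sim.
Qed.

Lemma descent_mass_decay : exists2 C, 0 <= C & forall t D, descent t D -> forall n,
  [/\ 0 < mass (open_segment (D n)),
   decay (vertex_at t D 0%N) (walk t D 0 n) <= - ln (mass (open_segment (D n))) &
   - ln (mass (open_segment (D n))) <= decay (vertex_at t D 0%N) (walk t D 0 n) + C].
Proof.
have [c c0 cP] := descent_mass_bounds.
exists `|ln c| => // t D dsc n; have /andP[h1 h2] := cP t D dsc n.
have n0 := path_norm_gt0 (walk_graph dsc 0 n).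
have M0 : 0 < mass (open_segment (D n)) by apply: lt_le_trans h1; rewrite mulr_gt0.
split => //; first by rewrite lerN2 ler_ln ?posrE.
have : ln (c * norm (vertex_at t D 0%N) (walk t D 0 n)) <= ln (mass (open_segment (D n))).
  by rewrite ler_ln ?posrE ?mulr_gt0.
by rewrite lnM ?posrE// /path_decay; have := ler_norm (- ln c); rewrite normrN; lra.
Qed.

Lemma descent_diam_cost : exists2 C, 0 <= C & forall t D, descent t D -> forall n,
  `|- ln (diam (D n)) - cost (vertex_at t D 0%N) (walk t D 0 n)| <= C.
Proof.
have [c [C [rho [c0 C0 _ P]]]] := descent_diam_bound.
exists (`|ln c| + `|ln C| + `|ln (tg S K 2 (0, 1))|); first by rewrite !addr_ge0.
move=> t D dsc n; have [h1 h2 _] := P t D dsc n.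
have tn k : 0 < t k by have [] := descent_net dsc k.
have dn := descent_diam_gt0 dsc n.
have t1 : t 1%N = tg S K 2 (0, 1).
  by rewrite (descent_tg dsc); case: dsc => -> ->.
rewrite (walk_cost dsc) add0n -t1.
have l1 : ln c + ln (t n.+1) <= ln (diam (D n)).
  by rewrite -lnM ?posrE// ler_ln ?posrE ?mulr_gt0.
have l2 : ln (diam (D n)) <= ln C + ln (t n.+1).
  by rewrite -lnM ?posrE// ler_ln ?posrE ?mulr_gt0.
have := ler_norm (ln C); have := ler_norm (- ln c); rewrite normrN.
have := ler_norm (ln (t 1%N)); have := ler_norm (- ln (t 1%N)); rewrite normrN.
have := normr_ge0 (ln c); have := normr_ge0 (ln C).
by move=> *; rewrite ler_norml; apply/andP; split; lra.
Qed.

(** Every column of the matrix of h has an entry bounded below, so multiplying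
    by this matrix on the left reduces the norm by a bounded factor. *)
Lemma decay_prefix v h : path_in S K GV v h ->
  exists C, forall h', path_in S K GV v (h ++ h') ->
    decay v (h ++ h') <= decay (path_end v h) h' + C.
Proof.
have [c c0 [c1 cp]] := prob_lower_bound.
move=> vh; exists (- ln (c ^+ size h)) => h' vhh'.
have /path_in_cat[_ vh'] := vhh'.
have cn : 0 < c ^+ size h by rewrite exprn_gt0.
have n1 := path_norm_gt0 vhh'.
have n2 := path_norm_gt0 vh'.
have GVe := path_in_end vh.
rewrite /path_decay -opprD lerN2 -lnM ?posrE// ler_ln ?posrE ?mulr_gt0//.
rewrite path_norm_cat path_normE mulr_suml.
rewrite big_seq [leRHS]big_seq; apply: ler_sum => f' f'e.
rewrite mulrC; apply: ler_wpM2r; first by apply: sumr_ge0 => g _; exact: path_entry_ge0.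
have [f fv fP] := path_column c0 c1 cp vh ((mem_neighbours f' GVe).1 f'e).
apply: le_trans fP _; apply: (ler_sum_term (F := fun f => entry v h f f')) => // y.
exact: path_entry_ge0.
Qed.

Section Tails.
Context {L : set (vertex R)} (L_loop : loop_class S K L) (L_nonempty : L !=set0)
  (L_irr : irreducible_class S K le p L).

Lemma diam_log_infty t D (u : R) : descent t D ->
  exists n0, forall n, (n0 <= n)%N -> u <= - ln (diam (D n)).
Proof.
move=> dsc; have [N NP] := descent_diam_cvg dsc (expR_gt0 (- u)).
exists N => n /NP dn; have d0 := descent_diam_gt0 dsc n.
by rewrite lerNr -[leRHS]expRK ler_ln ?posrE ?expR_gt0// ltW.
Qed.

Lemma diam_log_step t D : descent t D -> exists2 C, 0 <= C & forall n,
  - ln (diam (D n)) <= - ln (diam (D n.+1)) <= - ln (diam (D n)) + C.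
Proof.
move=> dsc; have [c c0 [c1 cP]] := descent_gap 1.
exists (- ln c); first by rewrite oppr_ge0 -ln1 ler_ln ?posrE.
move=> n; have [_ _] := cP t D dsc n; rewrite addn1 => h.
have d0 := descent_diam_gt0 dsc n; have d1 := descent_diam_gt0 dsc n.+1.
have [M1 M2] := descent_mono1 dsc n.
apply/andP; split; first by rewrite lerN2 ler_ln ?posrE// /diam; lra.
by rewrite -opprD lerN2 addrC -lnM ?posrE// ler_ln ?posrE ?mulr_gt0.
Qed.

(** Without its first N steps, the path to D n is a crossing of L at a level
    that differs from - ln (diam (D n)) by a bounded amount, and its decay
    lies between least_decay and greatest_decay at this level. *)
Lemma tail_decay_range t D N : descent t D ->
  (forall n, (N <= n)%N -> L (vertex_at t D n)) ->
  forall e, 0 < e -> exists n0, forall n, (n0 <= n)%N ->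
    (amin L - e) * - ln (diam (D n)) <= - ln (mass (open_segment (D n))) <=
    (amax L + e) * - ln (diam (D n)).
Proof.
move=> dsc NL e e0.
have e2 : 0 < e / 2 by lra.
have [u1 u1P] := alpha_min_limit L_loop L_nonempty e2.
have [u2 u2P] := alpha_max_limit L_loop L_nonempty L_irr e2.
have [C1 C10 P1] := descent_mass_decay; have [C2 C20 P2] := descent_diam_cost.
have [A A0 AP] := crossing_cost L_loop.
have [C3 P3] := decay_prefix (walk_graph dsc 0 N).
pose v0 := vertex_at t D 0%N; pose c0 := cost v0 (walk t D 0 N).
pose d0 := decay v0 (walk t D 0 N).
pose Q := C2 + `|c0| + A.
have Q0 : 0 <= Q by rewrite !addr_ge0// ltW.
have [v1 v11 v1P] := const_le_linear (`|amax L + e / 2| * Q + `|C3| + C1) e2.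
have [v2 v21 v2P] := const_le_linear (`|amin L - e / 2| * Q + `|d0|) e2.
pose big := Num.max v1 (Num.max v2 (Num.max (u1 + Q) (Num.max (u2 + Q) (1 + Q)))).
have [n1 n1P] := diam_log_infty big dsc.
exists (maxn n1 N.+1) => n; rewrite geq_max => /andP[/n1P + Nn].
set w := - ln (diam (D n)); rewrite !ge_max => /and5P[w1 w2 wu1 wu2 w1Q].
have [M0 m1 m2] := P1 t D dsc n; have := P2 t D dsc n; rewrite -/w ler_norml => /andP[k1 k2].
have nE : (n = N + (n - N.+1).+1)%N by rewrite addnS -addSn subnKC.
set k := (n - N.+1)%N in nE.
pose vN := vertex_at t D N; pose h := walk t D N k.+1.
have segE : walk t D 0 n = walk t D 0 N ++ h by rewrite nE (walk_cat 0 N).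
have hG : path_in S K GV v0 (walk t D 0 N ++ h) by rewrite -segE; exact: (walk_graph dsc).
have endE : path_end v0 (walk t D 0 N) = vN by rewrite walk_end.
have cE : cost v0 (walk t D 0 n) = c0 + cost vN h by rewrite segE cost_cat// endE.
have hL : path_in S K L vN h by apply: walk_in => // i /andP[Ni _]; exact: NL.
have hk : h = rcons (walk t D N k) (step_at t D (N + k)).
  by rewrite /h -addn1 (walk_cat N k) cats1.
pose u := cost vN (walk t D N k).
have u0 : 0 <= u by apply: cost_ge0 => //; exact: (walk_graph dsc).
have cr : crossing L u vN h.
  split=> //; exists (walk t D N k), (step_at t D (N + k)); split; [exact: hk|exact: lexx|].
  rewrite hk -cats1 cost_cat; last by rewrite cats1 -hk; exact: (walk_graph dsc).
  rewrite ltrDl /path_cost oppr_gt0 -ln1 ltr_ln ?posrE//=.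
  - by rewrite mulr1 walk_end edge_weight_lt1//; exact: (descent_edge dsc).
  - by rewrite mulr1 walk_end edge_weight_gt0//; exact: (descent_edge dsc).
have [_ [k1' [b1' [_ _ /ltW uh]]]] := cr.
have hu := AP _ _ _ u0 cr.
have cc := ler_norm c0; have cc' := ler_norm (- c0); rewrite normrN in cc'.
have uw : w - Q <= u <= w + Q by rewrite /Q; apply/andP; split; lra.
have {}uw : `|u - w| <= Q by move/andP: uw => [? ?]; rewrite ler_norml; apply/andP; split; lra.
have := uw; rewrite ler_norml => /andP[uw1 uw2].
have ug1 : 1 <= u by lra.
have mx := greatest_decay_ge L_loop L_nonempty ug1 cr.
have mn := least_decay_le L_loop L_nonempty ug1 cr.
have := u1P u ltac:(lra); rewrite ler_norml => /andP[l1 _].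
have := u2P u ltac:(lra); rewrite ler_norml => /andP[_ l2].
have pre := P3 h ltac:(exact: hG); rewrite endE -segE in pre.
have pre2 := decay_cat hG; rewrite endE -segE -/d0 in pre2.
have lin (a : R) : `|a * u - a * w| <= `|a| * Q.
  by rewrite -mulrBr normrM ler_wpM2l.
have := lin (amax L + e / 2); have := lin (amin L - e / 2).
rewrite !ler_norml => /andP[g1 g1'] /andP[g2 g2'].
have z1 := v1P _ w1; have z2 := v2P _ w2.
have d3 := ler_norm C3; have d4 := ler_norm (- d0); rewrite normrN in d4.
have eq1 : (amax L + e) * w = (amax L + e / 2) * w + e / 2 * w by field.
have eq2 : (amin L - e) * w = (amin L - e / 2) * w - e / 2 * w by field.
rewrite eq1 eq2.
have eq3 : (amax L + e / 2) * u = amax L * u + e / 2 * u by ring.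
have eq4 : (amin L - e / 2) * u = amin L * u - e / 2 * u by ring.
rewrite -/v0 in m1 m2 pre pre2.
clear - fnc L_loop L_nonempty L_irr
  m1 m2 pre pre2 mn mx l1 l2 eq3 eq4 g1 g1' g2 g2' z1 z2 d3 d4 C10.
by apply/andP; split; lra.
Qed.

(** The ball of radius 2 diam (D n) contains D n, and the other radii are
    reached by interpolation. *)
Lemma upper_dim_le_alpha_max t D N x : descent t D ->
  (forall n, (N <= n)%N -> L (vertex_at t D n)) -> (forall n, segment (D n) x) ->
  (forall r, 0 < r -> (0 < mu (ball x r))%E) ->
  (upper_dim_loc mu x <= (amax L)%:E)%E.
Proof.
move=> dsc NL xD xsupp; apply: upper_dim_le.
pose w n := - ln (2 * diam (D n)).
have dn := descent_diam_gt0 dsc.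
have wE n : w n = - ln (diam (D n)) - ln 2 by rewrite /w lnM ?posrE// opprD addrC.
have l2 : 0 <= ln 2 :> R by rewrite ln_ge0// ler1n.
have winf u : exists k0, forall k, (k0 <= k)%N -> u <= w k.
  have [n0 n0P] := diam_log_infty (u + ln 2) dsc; exists n0 => n /n0P.
  by rewrite wE; lra.
have [C C0 CP] := diam_log_step dsc.
apply: (@interpolate_le R (ball_decay mu x) w (amax L)).
- by move=> u _; exact: ball_decay_ge0.
- by move=> u v; exact: ball_decay_homo.
- exact: winf.
- move=> e e0; have [u0 u01 u0P] := const_le_linear C e0.
  have [k0 k0P] := winf u0; exists k0 => k /k0P /u0P h.
  by have /andP[_] := CP k; rewrite !wE; rewrite wE in h; lra.
- move=> e e0; have e2 : 0 < e / 2 by lra.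
  have [n0 n0P] := tail_decay_range dsc NL e2.
  have [u0 u01 u0P] := const_le_linear (`|amax L + e / 2| * ln 2) e2.
  have [k0 k0P] := winf u0.
  exists (maxn n0 k0) => n; rewrite geq_max => /andP[/n0P/andP[_ h1] /k0P/u0P h2].
  apply: (@le_trans _ _ (- ln (mass (open_segment (D n))))).
    rewrite lerN2; have [c [_]] := descent_mass_decay => /(_ t D dsc n)[M0 _ _].
    rewrite ler_ln ?posrE//; last exact: fine_ball_gt0 xsupp _ (expR_gt0 _).
    apply: mass_le; [exact: measurable_itv|exact: ball_measurable|].
    move=> y /open_segmentE/andP[y1 y2]; have /segmentE/andP[x1 x2] := xD n.
    rewrite /ball /= /w opprK lnK ?posrE ?mulr_gt0// ltr_norml /diam.
    by apply/andP; split; lra.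
  apply: le_trans h1 _; rewrite (_ : - ln (diam (D n)) = w n + ln 2); last by rewrite wE; lra.
  have := ler_norm (amax L + e / 2) => h3.
  have : (amax L + e / 2) * ln 2 <= `|amax L + e / 2| * ln 2 by rewrite ler_wpM2r.
  have -> : (amax L + e) * w n = (amax L + e / 2) * w n + e / 2 * w n by field.
  rewrite mulrDr; lra.
Qed.

(** A lower bound of a limit superior needs only one sequence of radii. *)
Lemma upper_dim_ge_alpha_min t D N x c : descent t D ->
  (forall n, (N <= n)%N -> L (vertex_at t D n)) -> (forall n, segment (D n) x) ->
  (forall r, 0 < r -> (0 < mu (ball x r))%E) -> 0 < c -> c <= 1 ->
  (forall k, exists2 n, (k <= n)%N &
     mass (ball x (c * diam (D n))) <= mass (open_segment (D n))) ->
  ((amin L)%:E <= upper_dim_loc mu x)%E.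
Proof.
move=> dsc NL xD xsupp c0 c1 often; apply: upper_dim_ge => e u0 e0.
have dn := descent_diam_gt0 dsc.
have e2 : 0 < e / 2 by lra.
have lc : 0 <= - ln c by rewrite oppr_ge0 -ln1 ler_ln ?posrE.
have [n0 n0P] := tail_decay_range dsc NL e2.
have [u1 u11 u1P] := const_le_linear (`|amin L - e / 2| * - ln c) e2.
have [n1 n1P] := diam_log_infty (Num.max u0 u1) dsc.
have [n] := often (maxn n0 n1); rewrite geq_max => /andP[/n0P/andP[h1 _] /n1P h2] h3.
move: h2; rewrite ge_max => /andP[h2 /u1P h4].
have wE : - ln (c * diam (D n)) = - ln (diam (D n)) - ln c by rewrite lnM ?posrE// opprD addrC.
exists (- ln (c * diam (D n))); first by rewrite wE; lra.
apply: (@le_trans _ _ (- ln (mass (open_segment (D n))))); last first.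
  rewrite /ball_decay opprK lnK ?posrE ?mulr_gt0// lerN2.
  have B0 := fine_ball_gt0 xsupp (mulr_gt0 c0 (dn n)).
  by rewrite ler_ln ?posrE//; exact: lt_le_trans B0 h3.
apply: le_trans h1; rewrite wE.
have h5 : (amin L - e / 2) * - ln c <= `|amin L - e / 2| * - ln c by rewrite ler_wpM2r// ler_norm.
move: (- ln (diam (D n))) h4 => w h4.
have -> : (amin L - e) * (w - ln c) = (amin L - e / 2) * w + (amin L - e / 2) * - ln c - e / 2 * w - e / 2 * - ln c by field.
have : 0 <= e / 2 * - ln c by rewrite mulr_ge0// ltW.
lra.
Qed.

End Tails.

End DescentAsymptotics.

(** * Upper local dimensions at interior points *)

Section InteriorPoints.
Implicit Types (E : set (measurableTypeR R)) (t : nat -> R) (D : nat -> R * R).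

Lemma mass_setU E E' : measurable E -> measurable E' ->
  mass (E `|` E') <= mass E + mass E'.
Proof.
move=> mE mE'; rewrite -lee_fin EFinD -!massE//; last exact: measurableU.
exact: measureU2.
Qed.

Lemma left_end_moves t D x j : descent t D -> (forall n, open_segment (D n) x) ->
  ~ (forall n, (j <= n)%N -> (D n).1 = (D j).1).
Proof.
move=> dsc xD h; have /open_segmentE/andP[jx _] := xD j.
have [N NP] := descent_diam_cvg dsc (e := x - (D j).1) ltac:(lra).
have := NP (maxn N j) (leq_maxl _ _); rewrite /diam h ?leq_maxr//.
by have /open_segmentE/andP[_] := xD (maxn N j); lra.
Qed.

Lemma right_end_moves t D x j : descent t D -> (forall n, open_segment (D n) x) ->
  ~ (forall n, (j <= n)%N -> (D n).2 = (D j).2).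
Proof.
move=> dsc xD h; have /open_segmentE/andP[_ jx] := xD j.
have [N NP] := descent_diam_cvg dsc (e := (D j).2 - x) ltac:(lra).
have := NP (maxn N j) (leq_maxl _ _); rewrite /diam h ?leq_maxr//.
by have /open_segmentE/andP[+ _] := xD (maxn N j); lra.
Qed.

(** The diameter decreases in every window of k generations, so one of the
    ends moves. If both ends moved in no two consecutive windows, then one end
    would be fixed from some generation on, and x would be this end. *)
Lemma strictly_inside_often t D x : descent t D -> (forall n, open_segment (D n) x) ->
  exists k, forall j, exists2 n, (j <= n)%N &
    (D n).1 < (D (n + k)%N).1 /\ (D (n + k)%N).2 < (D n).2.
Proof.
move=> dsc xD; have [k shrink] := descent_shrink; exists (k + k)%N => j.
apply: contrapT => no.
have {}no n : (j <= n)%N -> (D n).1 < (D (n + k + k)%N).1 ->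
    (D (n + k + k)%N).2 < (D n).2 -> False.
  by move=> jn h1 h2; apply: no; exists n => //; rewrite addnA.
have mono n i := descent_mono dsc n i.
pose w i := (j + i * k)%N.
have jw i : (j <= w i)%N by rewrite leq_addr.
have wS i : w i.+1 = (w i + k)%N by rewrite /w mulSn; lia.
have move1 i : (D (w i)).1 < (D (w i.+1)).1 \/ (D (w i.+1)).2 < (D (w i)).2.
  have := shrink t D dsc (w i); rewrite -wS /diam => h.
  have [?|h1] := ltP (D (w i)).1 (D (w i.+1)).1; first by left.
  have [?|h2] := ltP (D (w i.+1)).2 (D (w i)).2; first by right.
  lra.
have le1 i : (D (w i)).1 <= (D (w i.+1)).1 by rewrite wS; have [] := mono (w i) k.
have le2 i : (D (w i.+1)).2 <= (D (w i)).2 by rewrite wS; have [] := mono (w i) k.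
have no2 i : ((D (w i)).1 < (D (w i.+1)).1 \/ (D (w i.+1)).1 < (D (w i.+2)).1) ->
    ((D (w i.+1)).2 < (D (w i)).2 \/ (D (w i.+2)).2 < (D (w i.+1)).2) -> False.
  have := le1 i; have := le1 i.+1; have := le2 i; have := le2 i.+1 => a1 a2 a3 a4 l r.
  apply: (no (w i)) => //; rewrite -wS -wS; first by case: l; lra.
  by case: r; lra.
have cover n : (j <= n)%N -> exists i, (n <= w i)%N.
  have k0 : (0 < k)%N.
    by rewrite lt0n; apply/eqP => k0; have := shrink t D dsc 0%N; rewrite k0 ltxx.
  by move=> jn; exists n; rewrite /w; nia.
case: (move1 0%N) => h0.
- have stay i : (D (w i)).1 < (D (w i.+1)).1 /\ (D (w i.+1)).2 = (D (w i)).2.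
    elim: i => [|i [h1 h2]].
      split=> //; apply/eqP; rewrite eq_le le2 leNgt; apply/negP => h.
      by apply: (no2 0%N); left.
    have h3 : (D (w i.+2)).2 = (D (w i.+1)).2.
      apply/eqP; rewrite eq_le le2 leNgt; apply/negP => h.
      by apply: (no2 i); [left|right].
    by split=> //; case: (move1 i.+1) => //; rewrite h3 ltxx.
  have const i : (D (w i)).2 = (D j).2.
    elim: i => [|i IH]; first by rewrite /w mul0n addn0.
    by have [_ ->] := stay i.
  apply: (right_end_moves (j := j) dsc xD) => n jn; have [i ni] := cover n jn.
  have [_ a1] := mono j (n - j)%N; have [_ a2] := mono n (w i - n)%N.
  rewrite subnKC// in a1; rewrite subnKC// const in a2.
  by apply/eqP; rewrite eq_le a1 a2.
- have stay i : (D (w i.+1)).2 < (D (w i)).2 /\ (D (w i.+1)).1 = (D (w i)).1.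
    elim: i => [|i [h1 h2]].
      split=> //; apply/eqP; rewrite eq_le le1 andbT leNgt; apply/negP => h.
      by apply: (no2 0%N); left.
    have h3 : (D (w i.+2)).1 = (D (w i.+1)).1.
      apply/eqP; rewrite eq_le le1 andbT leNgt; apply/negP => h.
      by apply: (no2 i); [right|left].
    by split=> //; case: (move1 i.+1) => //; rewrite h3 ltxx.
  have const i : (D (w i)).1 = (D j).1.
    elim: i => [|i IH]; first by rewrite /w mul0n addn0.
    by have [_ ->] := stay i.
  apply: (left_end_moves (j := j) dsc xD) => n jn; have [i ni] := cover n jn.
  have [a1 _] := mono j (n - j)%N; have [a2 _] := mono n (w i - n)%N.
  rewrite subnKC// in a1; rewrite subnKC// const in a2.
  by apply/eqP; rewrite eq_le a1 a2.
Qed.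

Lemma strictly_inside_ball t D x : descent t D -> (forall n, segment (D n) x) ->
  forall k, exists2 c, 0 < c & c <= 1 /\ forall n,
    (D n).1 < (D (n + k)%N).1 -> (D (n + k)%N).2 < (D n).2 ->
    ball x (c * diam (D n)) `<=` open_segment (D n).
Proof.
move=> dsc xD k; have [c c0 [c1 cP]] := descent_gap k.
exists c => //; split=> // n h1 h2; have [g1 g2 _] := cP t D dsc n.
have {}g1 : (D n).1 + c * diam (D n) <= (D (n + k)%N).1.
  by case: g1 => // g1; move: h1; rewrite g1 ltxx.
have {}g2 : (D (n + k)%N).2 <= (D n).2 - c * diam (D n).
  by case: g2 => // g2; move: h2; rewrite g2 ltxx.
move=> y; rewrite /ball /= ltr_norml => /andP[y1 y2].
have /segmentE/andP[x1 x2] := xD (n + k)%N.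
by apply/open_segmentE; apply/andP; split; lra.
Qed.

(** If K accumulated at x on the side b, then descent_on_side would yield a
    representation of x different from the given one, which is not on this
    side. *)
Lemma unique_one_sided b x t D : K x -> descent t D -> (forall n, segment (D n) x) ->
  interior_point S K x -> (exists n, ~ on_side b x (D n)) ->
  exists2 d, 0 < d & side b x d `&` K = set0.
Proof.
move=> Kx dsc xD [_ [g [gx guniq]]] [n nside].
have sing t' D' : descent t' D' -> (forall n, segment (D' n) x) ->
    symbolic_rep S K (fun n => (vertex_at t' D' n, (step_at t' D' n).1, (step_at t' D' n).2)) x.
  move=> dsc' xD'; apply/symbolic_descent; exists t', D'; split => //.
  have [y _ yE] := descent_point dsc'; rewrite yE.
  have -> : x = y by have : [set y] x by rewrite -yE => i _; exact: xD'.
  by [].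
apply: contrapT => no.
have acc d : 0 < d -> side b x d `&` K !=set0.
  by move=> d0; apply/set0P/negP => /eqP h; apply: no; exists d.
have [t' [D' [dsc' sD']]] := descent_on_side acc.
have xD' i : segment (D' i) x.
  by have := sD' i; rewrite /on_side; case: (b) => /andP[h1 h2]; apply/segmentE; apply/andP; split; lra.
have e1 := guniq _ (sing _ _ dsc xD); have e2 := guniq _ (sing _ _ dsc' xD').
have eE i : (vertex_at t D i, (step_at t D i).1, (step_at t D i).2) =
    (vertex_at t' D' i, (step_at t' D' i).1, (step_at t' D' i).2).
  by have := congr1 (fun f => f i) (etrans (esym e1) e2).
by have [_ DE] := descent_from_edges dsc dsc' eE n; apply: nside; rewrite DE.
Qed.

(** Either x is inside all the net intervals, and then balls of radius
    comparable to diam (D n) are contained in D n for infinitely many n; or x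
    is an end of D n for large n, and then K misses a neighbourhood of x on
    the other side. In the second case the ball and D n have the same trace on
    K except for x, which is not an atom. *)
Lemma interior_ball_often t D x : interior_point S K x -> descent t D ->
  (forall n, segment (D n) x) ->
  exists2 c, 0 < c & c <= 1 /\ forall k, exists2 n, (k <= n)%N &
    mass (ball x (c * diam (D n))) <= mass (open_segment (D n)).
Proof.
move=> xint dsc xD; have Kx := xint.1.
have mo n : measurable (open_segment (D n) : set (measurableTypeR R)) by exact: measurable_itv.
have [inside|/existsNP[n0 n0P]] := pselect (forall n, open_segment (D n) x).
  have [k kP] := strictly_inside_often dsc inside.
  have [c c0 [c1 cP]] := strictly_inside_ball dsc xD k.
  exists c => //; split=> // j; have [n jn [h1 h2]] := kP j; exists n => //.
  by apply: mass_le => //; [exact: ball_measurable|exact: cP].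
exists 1 => //; split=> // k.
have m0 d b : side b x d `&` K = set0 -> mass (side b x d) = 0.
  move=> h; apply: (mass_off_attractor) => //.
  by rewrite /side; case: (b); exact: measurable_itv.
have ms b d : measurable (side b x d : set (measurableTypeR R)).
  by rewrite /side; case: (b); exact: measurable_itv.
have m1 : measurable ([set x] : set (measurableTypeR R)) by exact: measurable_set1.
have atom : mass [set x] = 0 := mass_atom x.
have fin b d n : side b x d `&` K = set0 ->
    ball x (1 * diam (D n)) `<=` side b x d `|` ([set x] `|` open_segment (D n)) ->
    mass (ball x (1 * diam (D n))) <= mass (open_segment (D n)).
  move=> h sub; apply: (@le_trans _ _ (mass (side b x d `|` ([set x] `|` open_segment (D n))))).
    by apply: mass_le => //; [exact: ball_measurable|do !apply: measurableU].
  apply: le_trans (mass_setU _ _) _ => //; first exact: measurableU.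
  rewrite m0// add0r; apply: le_trans (mass_setU _ _) _ => //.
  by rewrite atom add0r.
have /segmentE/andP[x1 x2] := xD n0.
have [x1e|x1e] := eqVneq (D n0).1 x.
  have ns : ~ on_side true x (D n0) by rewrite /on_side x1e ltxx.
  have [d d0 dK] := unique_one_sided Kx dsc xD xint (ex_intro _ n0 ns).
  have [N NP] := descent_diam_cvg dsc d0.
  exists (maxn k (maxn N n0)); first exact: leq_maxl.
  set n := maxn k (maxn N n0).
  have nN : diam (D n) < d by apply: NP; rewrite !leq_max leqnn orbT.
  have Dn1 : (D n).1 = x.
    have nn0 : (n0 <= n)%N by rewrite !leq_max leqnn !orbT.
    have [a1 _] := descent_mono dsc n0 (n - n0)%N; rewrite subnKC// in a1.
    by have /segmentE/andP[a2 _] := xD n; apply/eqP; rewrite eq_le a2 -x1e a1.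
  apply: (fin true d) => // y; rewrite /ball /= mul1r ltr_norml => /andP[y1 y2].
  have [yx|xy] := ltP y x; first by left; rewrite /= in_itv /= yx andbT; lra.
  have [->|yx] := eqVneq y x; first by right; left.
  right; right; apply/open_segmentE; rewrite Dn1 lt_neqAle eq_sym yx xy /=.
  by move: y1; rewrite /diam Dn1; lra.
have x2e : (D n0).2 = x.
  apply/eqP; rewrite eq_le x2 andbT leNgt; apply/negP => h; apply: n0P.
  by apply/open_segmentE; rewrite h andbT lt_neqAle x1e.
have ns : ~ on_side false x (D n0) by rewrite /on_side x2e ltxx andbF.
have [d d0 dK] := unique_one_sided Kx dsc xD xint (ex_intro _ n0 ns).
have [N NP] := descent_diam_cvg dsc d0.
exists (maxn k (maxn N n0)); first exact: leq_maxl.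
set n := maxn k (maxn N n0).
have nN : diam (D n) < d by apply: NP; rewrite !leq_max leqnn orbT.
have Dn2 : (D n).2 = x.
  have nn0 : (n0 <= n)%N by rewrite !leq_max leqnn !orbT.
  have [_ a1] := descent_mono dsc n0 (n - n0)%N; rewrite subnKC// in a1.
  by have /segmentE/andP[_ a2] := xD n; apply/eqP; rewrite eq_le a2 -x2e a1.
apply: (fin false d) => // y; rewrite /ball /= mul1r ltr_norml => /andP[y1 y2].
have [xy|yx] := ltP x y; first by left; rewrite /= in_itv /= xy /=; lra.
have [->|nyx] := eqVneq y x; first by right; left.
right; right; apply/open_segmentE; rewrite Dn2 [_ < x]lt_neqAle nyx yx andbT /=.
by move: y2; rewrite /diam Dn2; lra.
Qed.

Lemma attractor_ball_gt0 x r : K x -> 0 < r -> (0 < mu (ball x r))%E.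
Proof.
move=> Kx r0; rewrite massE; last exact: ball_measurable.
rewrite lte_fin ball_itv; apply: (mass_open_gt0 Kx).
by apply/andP; split; lra.
Qed.

Theorem upper_dim_in_range (L : set (vertex R)) x : loop_class S K L -> L !=set0 ->
  irreducible_class S K le p L -> K_ S K L x -> interior_point S K x ->
  exists2 a, amin L <= a <= amax L & upper_dim_loc mu x = a%:E.
Proof.
move=> L_loop L_nonempty L_irr [Kx [g gx [N NL]]] xint.
have [t [D [dsc gE xE]]] := (symbolic_descent _ _).1 gx.
have xcap : (\bigcap_n segment (D n)) x by rewrite xE.
have xD n : segment (D n) x by exact: xcap.
have NL' n : (N <= n)%N -> L (vertex_at t D n) by move=> /NL; rewrite gE => -[].
have xsupp r : 0 < r -> (0 < mu (ball x r))%E by exact: attractor_ball_gt0.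
have [c c0 [c1 cP]] := interior_ball_often xint dsc xD.
have up := upper_dim_le_alpha_max L_loop L_nonempty L_irr dsc NL' xD xsupp.
have lo := upper_dim_ge_alpha_min L_loop L_nonempty L_irr dsc NL' xD xsupp c0 c1 cP.
move: up lo; case: (upper_dim_loc mu x) => [a| |]//.
by rewrite !lee_fin => up lo; exists a => //; rewrite lo.
Qed.

End InteriorPoints.

(** * Cycles leading strictly inside *)

Section InnerCycle.
Context {L : set (vertex R)} (L_loop : loop_class S K L).
Implicit Types (v w : vertex R) (h : seq (@step R)) (a : @step R) (e : edge R).

Definition edge_in v a : Prop := [/\ L v, GE (v, a.1, a.2) & L a.1].

Lemma path_edges_in v h e : path_in S K L v h -> path_edges v h e ->
  edge_in e.1.1 (e.1.2, e.2).
Proof.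
elim: h v => [//|a h IH] v [Lv [ge ha]] [->|he]; last exact: IH ha he.
by split => //; exact: path_in_start ha.
Qed.

Lemma path_edges_next v h u w q : path_edges v h (u, w, q) ->
  (exists b, path_edges v h (w, b.1, b.2)) \/ w = path_end v h.
Proof.
elim: h v => [//|a h IH] v [[_ -> _]|/IH[[b bh]|->]]; last by right.
- case: h {IH} => [|b h]; first by right.
  by left; exists b; right; left.
- by left; exists b; right.
Qed.

(** If every vertex has one outgoing edge in L, then a path which starts on a
    cycle stays on it, so any two cycles have the same edges. *)
Lemma deterministic_simple :
  (forall v a b, edge_in v a -> edge_in v b -> a = b) -> simple_class S K L.
Proof.
move=> det.
have sub v h v' h' : cycle_in S K L v h -> cycle_in S K L v' h' ->
    path_edges v' h' `<=` path_edges v h.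
  move=> [hne hL hend] [h'ne h'L h'end].
  pose src u := exists b, path_edges v h (u, b.1, b.2).
  have vsrc : src v by rewrite /src; case: (h) hne => [//|a k] _; exists a; left.
  have follow u k : src u -> path_in S K L u k ->
      path_edges u k `<=` path_edges v h /\ src (path_end u k).
    elim: k u => [|a k IH] u; first by move=> us _; split=> // e [].
    move=> [b ub] [Lu [ge ka]].
    have ab : a = b.
      apply: (det u); first by split => //; exact: path_in_start ka.
      by have := path_edges_in hL ub; case: (b).
    have asrc : src a.1.
      by rewrite ab; have [//|->] := path_edges_next ub; rewrite hend.
    have [k1 k2] := IH _ asrc ka.
    by split=> // e [->|/k1//]; rewrite ab.
  have [_ /(_ v v' (path_in_start hL) (path_in_start h'L))[k [_ kL kend]]] := L_loop.
  have [_ v'src] := follow v k vsrc kL; rewrite kend in v'src.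
  by have [] := follow v' h' v'src h'L.
by move=> v h v' h' c c'; apply/seteqP; split; apply: sub.
Qed.

(** Two edges from one vertex with equal positions are equal, since the
    position determines the slot. *)
Lemma branching : ~ simple_class S K L -> exists v a b,
  [/\ edge_in v a, edge_in v b & a.2 < b.2].
Proof.
move=> ns; apply: contrapT => no; apply: ns; apply: deterministic_simple => v a b va vb.
have {}no c d : edge_in v c -> edge_in v d -> c.2 < d.2 -> False.
  by move=> vc vd cd; apply: no; exists v, c, d.
have ab : a.2 = b.2.
  by apply/eqP; rewrite eq_le !leNgt; apply/andP; split; apply/negP; exact: no.
have [_ ga _] := va; have [_ gb _] := vb.
have [I [sI wI qI]] := graph_edge_slot ga; have [J [sJ wJ qJ]] := graph_edge_slot gb.
have IJ : I = J by apply: slot_left_inj sI sJ _; rewrite -qI -qJ.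
have ab1 : a.1 = b.1 by move: wI wJ => /= -> ->; rewrite IJ.
by case: (a) (b) ab ab1 => [w q] [w' q'] /= -> ->.
Qed.

(** Take two edges from v with slots I and J, I on the left of J, and return
    to v after each of them. The step to I leaves the right end and the step
    to J leaves the left end. *)
Lemma inner_cycle : ~ simple_class S K L -> exists v z,
  [/\ z <> [::], path_in S K L v z, path_end v z = v &
   forall t D, descent t D -> forall n, vertex_at t D n = v ->
     (forall i, (i < size z)%N -> step_at t D (n + i) = nth (v, 0) z i) ->
     (D n).1 < (D (n + size z)%N).1 /\ (D (n + size z)%N).2 < (D n).2].
Proof.
move=> /branching[v [a [b [va vb ab]]]].
have [Lv ga La] := va; have [_ gb Lb] := vb.
have [_ back] := L_loop.
have [h1 [_ h1L h1e]] := back _ _ La Lv; have [h2 [_ h2L h2e]] := back _ _ Lb Lv.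
have [I eI] := graph_edge_slot ga; have [J eJ] := graph_edge_slot gb.
have [sI _ qI] := eI; have [sJ _ qJ] := eJ.
have IJ : I.2 <= J.1 by apply: slot_le sI sJ _; rewrite -qI -qJ.
have [[I1 I12 I2] _ _ _ _] := sI; have [[J1 J12 J2] _ _ _ _] := sJ.
exists v, ((a :: h1) ++ (b :: h2)); split => //.
- apply/path_in_cat; split; first by split.
  by change (path_in S K L (path_end a.1 h1) (b :: h2)); rewrite h1e.
- rewrite path_end_cat; change (path_end (path_end a.1 h1) (b :: h2) = v).
  by rewrite h1e.
move=> t D dsc n vn st; have dn := descent_diam_gt0 dsc.
have sa : step_at t D n = a by have := st 0%N isT; rewrite addn0.
pose n' := (n + (size h1).+1)%N.
have sb : step_at t D n' = b.
  have := st (size h1).+1; rewrite size_cat /= addSn ltnS -[X in (X < _)%N]addn0 ltn_add2l => /(_ isT) ->.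
  by rewrite nth_cat /= ltnn subnn.
have vn' : vertex_at t D n' = v.
  rewrite /n' -(walk_end n (size h1).+1) vn.
  have -> : walk t D n (size h1).+1 = a :: h1.
    apply: (@eq_from_nth _ (v, 0)); first by rewrite size_map size_iota.
    move=> i; rewrite size_map size_iota => ih.
    rewrite (nth_map 0%N) ?size_iota// nth_iota// st; last by rewrite size_cat /= addnS; lia.
    by rewrite nth_cat ih.
  by rewrite /= h1e.
have stepI k (w : vertex R * vertex R) q I' : vertex_at t D k = w.1 -> step_at t D k = (w.2, q) ->
    edge_slot (w.1, w.2, q) I' ->
    (D k.+1).1 = (D k).1 + I'.1 * diam (D k) /\ (D k.+1).2 = (D k).2 - (1 - I'.2) * diam (D k).
  move=> vk sk eI'; have [I'' eI'' [e1 e2 _]] := descent_step dsc k.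
  rewrite vk sk in eI''; have II := edge_slot_inj eI' eI''.
  by rewrite II.
have [_ e1] := stepI n (v, a.1) a.2 I vn ltac:(by rewrite sa; case: (a)) eI.
have [e2 _] := stepI n' (v, b.1) b.2 J vn' ltac:(by rewrite sb; case: (b)) eJ.
have [_ m1] := descent_mono dsc n.+1 (size h1 + size (b :: h2))%N.
have [m2 _] := descent_mono dsc n (size h1).+1.
have [m3 _] := descent_mono dsc n'.+1 (size h2).
have sz : (n + size ((a :: h1) ++ b :: h2))%N = (n.+1 + (size h1 + size (b :: h2)))%N.
  by rewrite size_cat [RHS]addSnnS.
have sz' : (n + size ((a :: h1) ++ b :: h2))%N = (n'.+1 + size h2)%N.
  by rewrite size_cat /n' [RHS]addSnnS addnA.
split.
- rewrite sz'; apply: lt_le_trans m3; rewrite e2; apply: le_lt_trans m2 _.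
  by rewrite ltrDl mulr_gt0//; lra.
- rewrite sz; apply: le_lt_trans m1 _; rewrite e1.
  by rewrite gtrDl oppr_lt0 mulr_gt0//; lra.
Qed.

End InnerCycle.

(** * Every vertex is reached from the root *)

(** While t exceeds tg s E, the words contributing to E are the same in the
    generations s and t. *)
Lemma net_interval_persists (s t : R) (E D : R * R) : 0 < t -> tg S K s E < t -> t <= s ->
  net_interval S K s E -> net_interval S K t D -> E.1 <= D.1 -> D.2 <= E.2 ->
  D = E /\ neighbour_set S K t D = neighbour_set S K s E.
Proof.
move=> t0 tgt ts netE netD ED1 ED2.
have s0 : 0 < s by exact: lt_le_trans ts.
have [_ tgmax] := tg_attained s0 netE.
have same w : contributes S K t E w <-> contributes S K s E w.
  split=> -[wL wh]; split=> //.
    have /LambdaP[wt _] := wL.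
    have [u [u' [wE uL]]] := Lambda_prefix (lt_le_trans wt ts).
    have uc : contributes S K s E u by split => //; rewrite wE in wh; exact: hits_prefix _ _ _ wh.
    have ut := le_lt_trans (tgmax _ uc) tgt.
    have u'0 : u' = [::] by apply: (Lambda_ext ut); rewrite -wE.
    by rewrite wE u'0 cats0.
  have /LambdaP[ws wp] := wL.
  apply/LambdaP; split; first exact: le_lt_trans (tgmax _ (conj wL wh)) tgt.
  by move=> s' l /wp; exact: le_trans.
have no y : endpoints S t y -> ~ open_segment E y.
  move=> [w wL yw] yE.
  have [wL' _] := (same w).1 (conj wL (endpoint_hits yw yE)).
  case: netE => _ _ _ oE _; suff : set0 y by [].
  by rewrite -oE; split => //; exists w.
have [e1 e2 D12 _ _] := netD.
have DE : D = E.
  rewrite [LHS]surjective_pairing [RHS]surjective_pairing; congr pair; apply/eqP; rewrite eq_le.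
  - rewrite ED1 andbT leNgt; apply/negP => h; apply: (no _ e1); apply/open_segmentE.
    by rewrite h; exact: lt_le_trans ED2.
  - rewrite ED2 /= leNgt; apply/negP => h; apply: (no _ e2); apply/open_segmentE.
    by rewrite h andbT; exact: le_lt_trans D12.
split=> //; rewrite DE; apply/seteqP.
by split=> f [w [/same wc ->]]; exists w.
Qed.

(** A net interval D is reached from [0, 1] by going from a net interval to
    its child containing D. The weights are bounded away from 1, so the
    generation finally reaches the one of D. *)
Lemma reachable v : GV v -> exists h, path_in S K GV [set sim_id] h /\ path_end [set sim_id] h = v.
Proof.
move=> [t [D [t0 netD vE]]]; apply: contrapT => no.
(* A vertex may be given by a generation larger than that of the root; all
   generations larger than 1 have the same words. *)
wlog t2 : t t0 netD vE / t <= 2.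
  move=> wl; have [t2|t2] := leP t 2; first exact: (wl t).
  have LE : Lambda S t = Lambda S 2 by rewrite /Lambda ltr1n /= ifT//; lra.
  apply: (wl 2) => //.
    by move: netD; rewrite /net_interval /endpoints LE.
  by rewrite vE /neighbour_set /generates /contributes LE.
have [r0 [r1 [r00 r01 r11 rP]]] := weight_bounds.
have r10 : 0 < r1 by lra.
have step n : exists h s E, [/\ path_in S K GV [set sim_id] h /\ path_end [set sim_id] h = neighbour_set S K s E,
   0 < s /\ net_interval S K s E, t <= s, E.1 <= D.1 /\ D.2 <= E.2 & tg S K s E <= r1 ^+ n].
  elim: n => [|n [h [s [E [[hG he] [s0 netE] ts [ED1 ED2] tgE]]]]].
    exists [::], 2, (0, 1); rewrite root_neighbours//.
    have netR := root_net.
    have GV0 : GV [set sim_id] by exists 2, (0, 1); rewrite root_neighbours.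
    have [e1 e2 D12 oD [y [/open_segmentE/andP[y1 y2] Ky]]] := netD.
    have /andP[y0 y01] := attractor01 Ky.
    have [b1 b2] := endpoints01 t0.
    split => //; last by rewrite expr0 tg_le1.
    split => /=; rewrite leNgt; apply/negP => h; suff : set0 (0 : R) \/ set0 (1 : R) by case.
      by left; rewrite -oD; split => //; apply/open_segmentE; rewrite h /=; lra.
    by right; rewrite -oD; split => //; apply/open_segmentE; rewrite h andbT; lra.
  have [tgt|ttg] := ltP (tg S K s E) t.
    have [DE vE'] := net_interval_persists t0 tgt ts netE netD ED1 ED2.
    by exfalso; apply: no; exists h; rewrite he vE vE'.
  have [e1 e2 D12 oD DK] := netD.
  have emp : `]D.1, D.2[%classic `&` endpoints S (tg S K s E) = set0.
    rewrite -subset0 => y [yD /(endpoints_mono t0 ttg) ye].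
    by rewrite -oD.
  have [E1 [ch h1 h2]] := child_around s0 netE ED1 ED2 emp DK.
  have [tg0 netE1] := child_net s0 netE ch.
  have r : realizes S K (child_edge S K s E E1) s E E1 by [].
  have ge : graph_edges S K (child_edge S K s E E1) by exists s, E, E1.
  pose a : @step R := (neighbour_set S K (tg S K s E) E1, (E1.1 - E.1) / diam E).
  exists (rcons h a), (tg S K s E), E1; split => //.
  - rewrite -cats1 path_end_cat; split => //; apply/path_in_cat; split=> //.
    rewrite he /=; split; first by exists s, E.
    by split => //; split => //; exists (tg S K s E), E1.
  - have := edge_weight_tg r; have /andP[_ w1] := rP _ ge => wE.
    have tgE1 : tg S K (tg S K s E) E1 = edge_weight S K (child_edge S K s E E1) * tg S K s E.
      by rewrite wE divfK// gt_eqF.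
    rewrite tgE1 exprS; apply: ler_pM => //; last exact: ltW.
    by apply: ltW; exact: edge_weight_gt0.
have [n /(_ n (leqnn n)) nt] := exp_small r10 r11 t0.
have [h [s [E [[hG he] [s0 netE] ts [ED1 ED2] tgE]]]] := step n.
have [DE vE'] := net_interval_persists t0 (le_lt_trans tgE nt) ts netE netD ED1 ED2.
by apply: no; exists h; rewrite he vE vE'.
Qed.

(** * Points of given local dimension *)

Section BlockSteps.
Context (L : set (vertex R)).
Implicit Types (P : seq (@step R)) (k : nat).

Definition anchored P : Prop :=
  path_in S K (graph_vertices S K) root P /\ L (path_end root P).

Context (vz : vertex R) (z : seq (@step R)) (a : R).

(** The path made of k blocks has cost about k ^+ 2, and its decay should be
    about a k ^+ 2. *)
Definition excess k P : R := decay root P - a * k%:R ^+ 2.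

(** The k-th block has cost about 2 k + 1 = (k + 1) ^+ 2 - k ^+ 2, ends with
    the cycle z and has nearly the least or the greatest decay among the
    crossings of its cost, so as to correct the sign of the excess. The blocks
    become long, which makes the errors in gluing negligible, and yet short
    when compared with the whole path, which makes the local dimension
    insensitive to radii between two blocks. *)
Definition block_step (C : R) k P P' : Prop :=
  exists2 s, P' = P ++ s ++ z &
  [/\ path_in S K L (path_end root P) (s ++ z), path_end root (P ++ s) = vz,
     `|cost root P' - cost root P - (2 * k%:R + 1)| <= C,
     decay root P' - C <= decay root (P ++ s) /\
       cost root P' - C <= cost root (P ++ s) <= cost root P' &
   [/\ `|decay root P' - decay root P| <= C * k.+1%:R,
       0 < excess k P -> decay root P' - decay root P <=
         least_decay L (2 * k%:R + 1) + C &
       excess k P < 0 -> greatest_decay L (2 * k%:R + 1) - C <=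
         decay root P' - decay root P]].

End BlockSteps.

Section Gluing.
Context {L : set (vertex R)} (L_loop : loop_class S K L) (L_nonempty : L !=set0)
  (L_irr : irreducible_class S K le p L).
Context (vz : vertex R) (z : seq (@step R)) (zL : path_in S K L vz z).
Implicit Types (v w : vertex R) (h : seq (@step R)).

Let LGV : L `<=` GV. Proof. by case: L_loop. Qed.
Let inGV v h : path_in S K L v h -> path_in S K GV v h.
Proof. exact: path_in_sub. Qed.

(** Two applications of path_gluing, the second one with the path z. *)
Lemma append_block : exists2 C, 0 < C & forall P w h, anchored L P -> path_in S K L w h ->
  exists k, let P' := P ++ k ++ z in
  [/\ path_in S K L (path_end root P) (k ++ z), path_end root (P ++ k) = vz,
      `|decay root P' - decay root P - decay w h| <= C,
      `|cost root P' - cost root P - cost w h| <= C &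
      decay root P' - C <= decay root (P ++ k) /\ cost root P' - C <= cost root (P ++ k) <= cost root P'].
Proof.
have [C C0 CP] := path_gluing L_loop L_irr.
have cz := cost_ge0 (inGV zL).
exists (4 * C + `|decay vz z| + cost vz z); first by rewrite !ltr_pwDl// mulr_gt0.
move=> P w h [PG Pe] hL.
have [nu [nuL nuE nuc nud d1]] := CP _ _ _ _ PG Pe hL.
pose P1 := P ++ nu ++ h.
have nuhL : path_in S K L (path_end root P) (nu ++ h) by apply/path_in_cat; rewrite nuE.
have P1G : path_in S K GV root P1 by apply/path_in_cat; split=> //; exact: inGV.
have P1e : path_end root P1 = path_end w h by rewrite /P1 path_end_cat path_end_cat nuE.
have P1L : L (path_end root P1) by rewrite P1e; exact: path_in_end hL.
have [nu' [nu'L nu'E nu'c nu'd d2]] := CP _ _ _ _ P1G P1L zL.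
exists (nu ++ h ++ nu') => P'.
have P'E : P' = P1 ++ nu' ++ z by rewrite /P' /P1 -!catA.
have PkE : P ++ nu ++ h ++ nu' = P1 ++ nu' by rewrite /P1 -!catA.
have nu'zL : path_in S K L (path_end root P1) (nu' ++ z) by apply/path_in_cat; rewrite nu'E.
have P'G : path_in S K GV root P' by rewrite P'E; apply/path_in_cat; split=> //; exact: inGV.
have c1 : cost root P1 = cost root P + (cost (path_end root P) nu + cost w h).
  by rewrite cost_cat// cost_cat ?nuE//; exact: inGV.
have P1nu'G : path_in S K GV root (P1 ++ nu').
  by apply/path_in_cat; split=> //; exact: inGV.
have c2 : cost root (P1 ++ nu') = cost root P1 + cost (path_end root P1) nu' by rewrite cost_cat.
have P'E2 : P' = (P1 ++ nu') ++ z by rewrite P'E catA.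
have end2 : path_end root (P1 ++ nu') = vz by rewrite path_end_cat.
have c3 : cost root P' = cost root (P1 ++ nu') + cost vz z.
  by rewrite P'E2 cost_cat -?P'E2// end2.
have nu0 := cost_ge0 (inGV nuL); have nu'0 := cost_ge0 (inGV nu'L).
have e1 := decay_cat P1G.
have e2 := decay_cat (inGV nuhL); rewrite nuE in e2.
have e3 := decay_cat P1nu'G.
have e4 : decay root (P1 ++ nu') + decay vz z <= decay root P'.
  have := decay_cat (v := root) (h := P1 ++ nu') (h' := z).
  by rewrite -P'E2 end2; apply.
have n1 := ler_norm (decay vz z); have n2 := ler_norm (- decay vz z); rewrite normrN in n2.
rewrite -/P1 in d1; rewrite -P'E in d2; rewrite PkE.
split => //.
- rewrite -catA -catA catA; apply/path_in_cat; split => //.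
  by rewrite -path_end_cat -/P1.
- by rewrite ler_norml; apply/andP; split; lra.
- by rewrite ler_norml; apply/andP; split; lra.
- by split; [lra|apply/andP; split; lra].
Qed.

Context (a : R) (a_range : amin L <= a <= amax L).

Lemma block_step_exists : exists2 C, 0 < C & forall k P, anchored L P ->
  exists2 P', anchored L P' & block_step L vz z a C k P P'.
Proof.
have [C C0 CP] := append_block.
have [A A0 AP] := crossing_cost L_loop.
have [B B0 BP] := crossing_bound L_loop.
exists (2 * B + C + A + 1); first by lra.
move=> k P PA; pose u : R := 2 * k%:R + 1.
have k0 : 0 <= k%:R :> R by [].
have u1 : 1 <= u by rewrite /u; lra.
have [w [h [hcr hP]]] : exists w h, crossing L u w h /\
   (0 < excess a k P -> decay w h <= least_decay L u + 1) /\
   (excess a k P < 0 -> greatest_decay L u - 1 <= decay w h).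
  have [X|X] := ltP 0 (excess a k P).
    have [w [h [h1 h2]]] := least_decay_adherent L_loop L_nonempty u1 ltr01.
    by exists w, h; split=> //; split=> //; lra.
  have [w [h [h1 h2]]] := greatest_decay_adherent L_loop L_nonempty u1 ltr01.
  by exists w, h; split=> //; split=> //; lra.
have [hL [_ [_ [_ _ uh]]]] := hcr.
have hu := AP _ _ _ (le_trans ler01 u1) hcr; have hB := BP _ _ _ u1 hcr.
have [s [sL se dd cc [d3 c3]]] := CP P w h PA hL.
set P' := P ++ s ++ z in dd cc d3 c3.
exists P'.
  split; first by apply/path_in_cat; split; [case: PA|exact: inGV].
  by rewrite path_end_cat; exact: path_in_end sL.
move: dd cc hB hP; rewrite !ler_norml => /andP[dd1 dd2] /andP[cc1 cc2] /andP[hB1 hB2] [hP1 hP2].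
have kS : k.+1%:R = k%:R + 1 :> R by rewrite natr1.
have Bk : 0 <= (C + A + 1) * k%:R by rewrite mulr_ge0//; lra.
exists s => //; split => //.
- by rewrite -/u ler_norml; apply/andP; split; lra.
- by split; [lra|move/andP: c3 => [? ?]; apply/andP; split; lra].
- rewrite kS -/u; split.
  + by rewrite ler_norml; apply/andP; split; rewrite /u in hB1 hB2; nra.
  + by move=> /hP1 hh; lra.
  + by move=> /hP2 hh; lra.
Qed.

End Gluing.

Lemma path_in_nth (L : set (vertex R)) v h d n : path_in S K L v h -> (n < size h)%N ->
  GE (path_end v (take n h), (nth d h n).1, (nth d h n).2) /\
  path_end v (take n.+1 h) = (nth d h n).1.
Proof.
move=> vh nh; split; last by rewrite (take_nth d nh) -cats1 path_end_cat.
by move: vh; rewrite -{1}(cat_take_drop n h) (drop_nth d nh) => /path_in_cat[_ [_ []]].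
Qed.

(** An increasing sequence of finite paths from the root defines an infinite
    path, and so a descent. *)
Lemma limit_descent (P : nat -> seq (@step R)) :
  (forall k, path_in S K GV root (P k)) -> (forall k, (k <= size (P k))%N) ->
  (forall k i, exists r, P (k + i)%N = P k ++ r) ->
  exists t D, descent t D /\ forall k, walk t D 0 (size (P k)) = P k.
Proof.
move=> PG Psize Pext; pose d : @step R := (root, 0).
pose a n := nth d (P n.+1) n.
have aE k n : (n < size (P k))%N -> nth d (P k) n = a n.
  move=> nk; rewrite /a; have [kn|nk'] := leqP k n.+1.
    by have [r] := Pext k (n.+1 - k)%N; rewrite subnKC// => ->; rewrite nth_cat nk.
  have [r] := Pext n.+1 (k - n.+1)%N; rewrite subnKC; last exact: ltnW.
  by move=> ->; rewrite nth_cat ifT//; exact: Psize.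
pose v n := path_end root (take n (P n)).
have v0 : v 0%N = root by rewrite /v take0.
have takeS n : take n (P n) = take n (P n.+1).
  by have [r] := Pext n 1%N; rewrite addn1 => ->; rewrite takel_cat.
have aG n : GE (v n, (a n).1, (a n).2).
  by rewrite /v takeS; have [] := path_in_nth d (PG n.+1) (Psize n.+1).
have vS n : v n.+1 = (a n).1 by have [] := path_in_nth d (PG n.+1) (Psize n.+1).
have [t [D [dsc vaE]]] := path_descent v0 aG vS.
exists t, D; split=> // k; apply: (@eq_from_nth _ d); first by rewrite size_map size_iota.
move=> i; rewrite size_map size_iota => ik.
by rewrite (nth_map 0%N) ?size_iota// nth_iota// add0n aE//; have [_ ->] := vaE i.
Qed.

Lemma walk_split (t : nat -> R) (D : nat -> R * R) h h' :
  walk t D 0 (size (h ++ h')) = h ++ h' ->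
  walk t D 0 (size h) = h /\ walk t D (size h) (size h') = h'.
Proof.
rewrite size_cat walk_cat add0n => hE.
have sz : size (walk t D 0 (size h)) = size h by rewrite size_map size_iota.
have := congr1 (take (size h)) hE; rewrite (take_size_cat _ sz) (take_size_cat _ erefl) => e1.
split=> //; have := congr1 (drop (size h)) hE.
by rewrite (drop_size_cat _ sz) (drop_size_cat _ erefl).
Qed.

Section ExactPoint.
Context {L : set (vertex R)} (L_loop : loop_class S K L) (L_nonempty : L !=set0)
  (L_irr : irreducible_class S K le p L) (L_not_simple : ~ simple_class S K L).

Context (a : R) (a_range : amin L <= a <= amax L).

Section Blocks.
Context {C : R} (C0 : 0 < C) {vz : vertex R} {z : seq (@step R)} {P : nat -> seq (@step R)}
  (PA : forall k, anchored L (P k))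
  (PS : forall k, block_step L vz z a C k (P k) (P k.+1)).

Lemma cost_quadratic k : `|cost root (P k) - k%:R ^+ 2| <= `|cost root (P 0%N)| + C * k%:R.
Proof.
elim: k => [|k IH]; first by rewrite expr2 mulr0 subr0 mulr0 addr0.
have [s _ [_ _ h _ _]] := PS k.
have kS : k.+1%:R = k%:R + 1 :> R by rewrite natr1.
rewrite kS; move: IH h; rewrite !ler_norml => /andP[h1 h2] /andP[h3 h4].
by apply/andP; split; nra.
Qed.

(** The number a lies between the rates of the least and of the greatest
    decay, so every block reduces the absolute value of the excess up to an
    error that is small compared with k. *)
Lemma excess_small e : 0 < e -> exists k0, forall k, (k0 <= k)%N ->
  `|decay root (P k) - a * k%:R ^+ 2| <= e * k%:R ^+ 2.
Proof.
pose X k := decay root (P k) - a * k%:R ^+ 2.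
have XS k : X k.+1 - X k = decay root (P k.+1) - decay root (P k) - a * (2 * k%:R + 1).
  by rewrite /X -natr1; ring.
have na := normr_ge0 a.
apply: (@steering R X (C + 2 * `|a|)); first by rewrite addr_ge0 ?mulr_ge0 ?(ltW C0).
  move=> k; have [s _ [_ _ _ _ [h _ _]]] := PS k; rewrite XS.
  apply: le_trans (ler_normB _ _) _; rewrite normrM.
  have kS : k.+1%:R = k%:R + 1 :> R by rewrite natr1.
  have k0 : 0 <= k%:R :> R by [].
  have -> : `|2 * k%:R + 1| = 2 * k%:R + 1 :> R by rewrite ger0_norm//; lra.
  by rewrite kS in h *; nra.
move=> d d0; have d4 : 0 < d / 4 by lra.
have [u1 u1P] := alpha_min_limit L_loop L_nonempty d4.
have [u2 u2P] := alpha_max_limit L_loop L_nonempty L_irr d4.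
have [u3 u31 u3P] := const_le_linear C d4.
exists (Num.truncn (Num.max u1 (Num.max u2 u3))).+1 => k kk.
have k0 : 0 <= k%:R :> R by [].
have : Num.max u1 (Num.max u2 u3) <= 2 * k%:R + 1.
  by apply: (@le_trans _ _ k%:R); [exact: nat_above|lra].
rewrite !ge_max => /and3P[/u1P h1 /u2P h2 /u3P h3].
have kS : k.+1%:R = k%:R + 1 :> R by rewrite natr1.
have [s _ [_ _ _ _ [_ hmin hmax]]] := PS k.
move: h1 h2; rewrite !ler_norml => /andP[h1 h1'] /andP[h2 h2'].
have u0 : 0 <= 2 * k%:R + 1 :> R by lra.
have /andP[am ma] := a_range.
have i1 : amin L * (2 * k%:R + 1) <= a * (2 * k%:R + 1) by apply: ler_wpM2r.
have i2 : a * (2 * k%:R + 1) <= amax L * (2 * k%:R + 1) by apply: ler_wpM2r.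
have i3 : d / 4 * (2 * k%:R + 1) + d / 4 * (2 * k%:R + 1) <= d * k.+1%:R.
  by rewrite kS; nra.
rewrite XS; split => [/hmin|/hmax] h; lra.
Qed.

End Blocks.

(** Gluing blocks with the rule block_step gives a descent whose limit x is
    inside all the net intervals thanks to the occurrences of z, hence an
    interior point. Right after the k-th block the decay is asymptotic to
    a k ^+ 2 and the cost to k ^+ 2. The balls of radius 2 diam (D n) contain
    D n, which bounds their decay above; for the n at which z begins, the
    balls of radius c diam (D n) are contained in D n, which bounds it below. *)
Theorem exact_dimension_point : exists x,
  [/\ K_ S K L x, interior_point S K x & has_dim_loc mu x a%:E].
Proof.
have [vz [z [zne zL zE inner]]] := inner_cycle L_loop L_not_simple.
have [C C0 stepP] := block_step_exists L_loop L_nonempty L_irr zL a.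
have [P [PA PS]] : exists P : nat -> seq (@step R),
    (forall k, anchored L (P k)) /\
    (forall k, block_step L vz z a C k (P k) (P k.+1)).
  have [vL LvL] := L_nonempty.
  have [h0 [h0G h0e]] := reachable (L_loop.1 vL LvL).
  have next (x : nat * seq (@step R)) : exists y, anchored L x.2 ->
      anchored L y /\
      block_step L vz z a C x.1 x.2 y.
    have [xA|xA] := pselect (anchored L x.2); last by exists x.2.
    by have [y h1 h2] := stepP x.1 x.2 xA; exists y.
  have [F FP] := choice next.
  pose P := fix P k := if k is k'.+1 then F (k', P k') else h0.
  have PA k : anchored L (P k).
    by elim: k => [|k IH]; [split; rewrite //= h0e|have [] := FP (k, P k) IH].
  by exists P; split=> // k; have [] := FP (k, P k) (PA k).
have z1 : (0 < size z)%N by case: (z) zne.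
have Pext1 k : exists2 r, P k.+1 = P k ++ r & path_in S K L (path_end root (P k)) r /\ (0 < size r)%N.
  by have [s PE [sL _ _ _ _]] := PS k; exists (s ++ z) => //; rewrite size_cat addn_gt0 z1 orbT.
have Pext k i : exists2 r, P (k + i)%N = P k ++ r & path_in S K L (path_end root (P k)) r.
  elim: i => [|i [r PE rL]].
    by exists [::]; rewrite ?addn0 ?cats0//; split=> //; case: (PA k).
  have [r' PE' [r'L _]] := Pext1 (k + i)%N; exists (r ++ r').
    by rewrite addnS PE' PE catA.
  by apply/path_in_cat; split=> //; rewrite -path_end_cat -PE.
have Psize k : (k <= size (P k))%N.
  elim: k => // k IH; have [r -> [_ r0]] := Pext1 k; rewrite size_cat.
  by rewrite -addn1 leq_add.
have PG k : path_in S K GV root (P k) by case: (PA k).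
have [t [D [dsc segP]]] := limit_descent PG Psize (fun k i => let: ex_intro2 r h _ := Pext k i in ex_intro _ r h).
have v0 := vertex_at0 dsc.
(* the blocks are in L, unlike the path that leads from the root to L *)
have tailL n : (size (P 0%N) <= n)%N -> L (vertex_at t D n).
  move=> n0n; have [r PE rL] := Pext 0%N n; rewrite add0n in PE.
  have nP := Psize n; have := segP n; rewrite PE => /walk_split[e1 e2].
  have rsz : size r = (n - size (P 0%N) + (size (P n) - n))%N.
    by rewrite PE size_cat in nP *; lia.
  move: rL; rewrite -e2 rsz walk_cat => /path_in_cat[/path_in_end + _].
  by rewrite -[X in path_end (path_end _ X)]e1 -v0 !walk_end add0n subnKC.
(* mk k is the generation at which the final cycle z of the k-th block begins. *)
pose mk k := (size (P k.+1) - size z)%N.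
have blk k : exists2 s, P k.+1 = (P k ++ s) ++ z & [/\ mk k = size (P k ++ s),
    walk t D 0 (mk k) = P k ++ s, vertex_at t D (mk k) = vz,
    (forall i, (i < size z)%N -> step_at t D (mk k + i) = nth (vz, 0) z i) &
    decay root (P k.+1) - C <= decay root (P k ++ s) /\
    cost root (P k.+1) - C <= cost root (P k ++ s) <= cost root (P k.+1)].
  have [s PE [sL se _ dc _]] := PS k; exists s; first by rewrite PE catA.
  have mE : mk k = size (P k ++ s) by rewrite /mk PE catA size_cat addnK.
  have := segP k.+1; rewrite PE catA => /walk_split[e1 e2].
  rewrite -mE in e1 e2; split => //.
  - by have := walk_end (t := t) (D := D) 0 (mk k); rewrite e1 v0 se add0n.
  - move=> i iz; rewrite -[in RHS]e2 (nth_map 0%N) ?size_iota//; first by rewrite nth_iota.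
  - by rewrite -catA -PE.
have strict k : (D (mk k)).1 < (D (mk k + size z)%N).1 /\ (D (mk k + size z)%N).2 < (D (mk k)).2.
  by have [s _ [_ _ vm st _]] := blk k; exact: inner dsc _ vm st.
have mk_ge k : (k <= mk k)%N.
  by have [s _ [-> _ _ _ _]] := blk k; rewrite size_cat (leq_trans (Psize k))// leq_addr.
have [x Kx xE] := descent_point dsc.
have xcap : (\bigcap_n segment (D n)) x by rewrite xE.
have xD n : segment (D n) x by exact: xcap.
have xin n : open_segment (D n) x.
  have [s1 s2] := strict n; have [m1 m2] := descent_mono dsc n (mk n - n)%N.
  rewrite subnKC// in m1 m2; have /segmentE/andP[x1 x2] := xD (mk n + size z)%N.
  by apply/open_segmentE; apply/andP; split; lra.
exists x; have xsym := (symbolic_descent _ x).2 (ex_intro _ t (ex_intro _ D (And3 dsc (fun n => erefl) xE))).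
split.
- split=> //; eexists; first exact: xsym.
  exists (size (P 0%N)) => n n0 /=; split; first exact: tailL.
  by apply: tailL; exact: leqW.
- split=> //; eexists; split; first exact: xsym.
  move=> g' /symbolic_descent[t' [D' [dsc' gE' xE']]].
  have xD' n : segment (D' n) x.
    have xcap' : (\bigcap_n segment (D' n)) x by rewrite xE'.
    exact: xcap'.
  have same := descent_unique dsc dsc' xin xD'.
  apply/funext => n; rewrite gE' /step_at /vertex_at.
  by have [-> ->] := same n; have [-> ->] := same n.+1.
have xsupp r : 0 < r -> (0 < mu (ball x r))%E by exact: (attractor_ball_gt0 Kx).
have dn := descent_diam_gt0 dsc.
have [C1 C10 P1] := descent_mass_decay.
have [C2 C20 P2] := descent_diam_cost.
have [c c0 [c1 ballP]] := strictly_inside_ball dsc xD (size z).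
have lc : 0 <= - ln c by rewrite oppr_ge0 -ln1 ler_ln ?posrE.
have l2 : 0 <= ln 2 :> R by rewrite ln_ge0// ler1n.
have kS k : k.+1%:R = k%:R + 1 :> R by rewrite natr1.
have cq := cost_quadratic PS.
have nc := normr_ge0 (cost root (P 0%N)).
have ym := excess_small C0 PS.
have gmono : forall u v, u <= v -> ball_decay mu x u <= ball_decay mu x v.
  by move=> u v; exact: ball_decay_homo.
have g0 u : 0 <= u -> 0 <= ball_decay mu x u by move=> _; exact: ball_decay_ge0.
apply: dim_locP.
- (* lower bound, at the radii of the inner balls *)
  pose w k := - ln (c * diam (D (mk k))).
  have wE k : w k = - ln (diam (D (mk k))) - ln c by rewrite /w lnM ?posrE// opprD addrC.
  have wq k : `|w k - k%:R ^+ 2| <= (`|cost root (P 0%N)| + 3 * C + C2 - ln c + 2) * k.+1%:R.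
    have [s _ [_ e1 _ _ [_ /andP[c3 c4]]]] := blk k.
    have := P2 t D dsc (mk k); rewrite e1 v0 => h2.
    have h3 := cq k.+1; rewrite kS in h3 *.
    have k0 : 0 <= k%:R :> R by [].
    move: h2 h3; rewrite wE !ler_norml => /andP[h2 h2'] /andP[h3 h3'].
    have pos : 0 <= (`|cost root (P 0%N)| + C2 - ln c) * k%:R by rewrite mulr_ge0//; lra.
    by apply/andP; split; nra.
  apply: (interpolate_ge g0 gmono (quadratic_infty wq) (quadratic_slow wq)).
  move=> e e0.
  have yq d : 0 < d -> exists k0, forall k, (k0 <= k)%N ->
      `|(decay root (P k.+1) - C) - a * k%:R ^+ 2| <= d * k%:R ^+ 2.
    move=> d0; have d8 : 0 < d / 8 by lra.
    have [k1 k1P] := ym _ d8.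
    have [k2 k2P] := linear_le_quadratic (C + 2 * `|a|) d8.
    exists (maxn 1 (maxn k1 k2)) => k; rewrite !geq_max => /and3P[k11 kk1 /k2P h2].
    have := k1P k.+1 (leqW kk1); rewrite kS in h2 * => h1.
    have k1' : 1 <= k%:R :> R by rewrite ler1n.
    have na := ler_norm a; have na' := ler_norm (- a); rewrite normrN in na'.
    move: h1; rewrite !ler_norml => /andP[h1 h1'].
    move: (decay root (P k.+1)) (k%:R : R) k1' h1 h1' h2 => y q q1 h1 h1' h2.
    by apply/andP; split; nra.
  have [k0 k0P] := quadratic_compare wq yq e0.
  exists k0 => k /k0P; rewrite ler_norml => /andP[h1 _].
  have [s _ [_ e1 _ _ [d3 _]]] := blk k.
  have [M0 h2 _] := P1 t D dsc (mk k); rewrite e1 v0 in h2.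
  apply: (@le_trans _ _ (- ln (mass (open_segment (D (mk k)))))); first lra.
  have r0 : 0 < c * diam (D (mk k)) by rewrite mulr_gt0.
  rewrite /ball_decay opprK lnK ?posrE// lerN2 ler_ln ?posrE//; last exact: fine_ball_gt0 xsupp _ r0.
  apply: mass_le; [exact: ball_measurable|exact: measurable_itv|].
  by have [s1 s2] := strict k; exact: ballP.
- (* upper bound, at the radii twice the net intervals *)
  pose w k := - ln (2 * diam (D (size (P k)))).
  have wE k : w k = - ln (diam (D (size (P k)))) - ln 2 by rewrite /w lnM ?posrE// opprD addrC.
  have wq k : `|w k - k%:R ^+ 2| <= (`|cost root (P 0%N)| + C + C2 + ln 2) * k.+1%:R.
    have := P2 t D dsc (size (P k)); rewrite segP v0 => h2.
    have h3 := cq k; rewrite kS.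
    have k0 : 0 <= k%:R :> R by [].
    move: h2 h3; rewrite wE !ler_norml => /andP[h2 h2'] /andP[h3 h3'].
    have pos : 0 <= (`|cost root (P 0%N)| + C2 + ln 2) * k%:R by rewrite mulr_ge0//; lra.
    by apply/andP; split; nra.
  apply: (interpolate_le g0 gmono (quadratic_infty wq) (quadratic_slow wq)).
  move=> e e0.
  have yq d : 0 < d -> exists k0, forall k, (k0 <= k)%N ->
      `|(decay root (P k) + C1) - a * k%:R ^+ 2| <= d * k%:R ^+ 2.
    move=> d0; have d2 : 0 < d / 2 by lra.
    have [k1 k1P] := ym _ d2.
    have [k2 k2P] := linear_le_quadratic C1 d2.
    exists (maxn k1 k2) => k; rewrite !geq_max => /andP[/k1P h1 /k2P h2].
    have k0 : 0 <= k%:R :> R by [].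
    move: h1 h2; rewrite kS !ler_norml => /andP[h1 h1'] h2.
    by apply/andP; split; nra.
  have [k0 k0P] := quadratic_compare wq yq e0.
  exists k0 => k /k0P; rewrite ler_norml => /andP[_ h1].
  have [M0 _ h2] := P1 t D dsc (size (P k)); rewrite segP v0 in h2.
  apply: (@le_trans _ _ (- ln (mass (open_segment (D (size (P k))))))); last lra.
  have r0 : 0 < 2 * diam (D (size (P k))) by rewrite mulr_gt0.
  rewrite /ball_decay opprK lnK ?posrE// lerN2 ler_ln ?posrE//; last exact: fine_ball_gt0 xsupp _ r0.
  apply: mass_le; [exact: measurable_itv|exact: ball_measurable|].
  move=> y /open_segmentE/andP[y1 y2]; have /segmentE/andP[x1 x2] := xD (size (P k)).
  by rewrite /ball /= ltr_norml /diam; apply/andP; split; lra.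
Qed.

End ExactPoint.

End SelfSimilarMeasure.

(** * The sets of local dimensions and upper local dimensions *)

Theorem corollary4p8 (R : realType) (m : nat) (S : 'I_m -> sim R) (K : set R)
    (p : 'I_m -> R) (mu : probability (measurableTypeR R) R)
    (le : rel (sim R)) (L : set (vertex R))
    (S_ratio : forall i, 0 < `|(S i).1| < 1)
    (S_inj : injective S)
    (K_compact : compact K)
    (K_nonempty : K !=set0)
    (K_invariant : K = \bigcup_i (sim_app (S i) @` K))
    (K_not_singleton : forall x, K <> [set x])
    (K_hull : convex_hull K = `[0, 1]%classic)
    (p_gt0 : forall i, 0 < p i)
    (p_sum1 : \sum_i p i = 1)
    (mu_invariant : forall E : set (measurableTypeR R), measurable E ->
       mu E = (\sum_i (p i)%:E * mu (sim_app (S i) @^-1` E))%E)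
    (le_is_total : total le) (le_antisym : antisymmetric le)
    (le_transitive : transitive le)
    (fnc : finite_neighbour_condition S K)
    (L_maximal : maximal_loop_class S K L)
    (L_irreducible : irreducible_class S K le p L)
    (L_not_simple : ~ simple_class S K L) :
  (EFin @` `[alpha_min S K le p L, alpha_max S K le p L] =
     [set d | exists2 x, K_ S K L x /\ interior_point S K x &
                         has_dim_loc mu x d])%classic /\
  [set d | exists2 x, K_ S K L x /\ interior_point S K x & has_dim_loc mu x d] =
  [set upper_dim_loc mu x | x in [set x | K_ S K L x /\ interior_point S K x]].
Proof.
have HS : ifs_attractor S K by [].
have L_loop : loop_class S K L by case: L_maximal.
have L_nonempty : L !=set0.
  by have [v [a [b [[Lv _ _] _ _]]]] := branching HS L_loop L_not_simple; exists v.
set A := (X in (X = _)%classic /\ _); set B := (X in (_ = X)%classic /\ _); set U := (X in _ /\ (_ = X)%classic).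
have AB : A `<=` B.
  move=> _ [a + <-]; rewrite /= in_itv /= => aI.
  have [x [xL xi xd]] := exact_dimension_point HS p_gt0 p_sum1 mu_invariant fnc
    L_loop L_nonempty L_irreducible L_not_simple aI.
  by exists x.
have BU : B `<=` U by move=> d [x xP [_ dE]]; exists x.
have UA : U `<=` A.
  move=> _ [x [xL xi] <-].
  have [a aI ->] := upper_dim_in_range HS p_gt0 p_sum1 mu_invariant fnc
    L_loop L_nonempty L_irreducible xL xi.
  by exists a => //; rewrite /= in_itv.
split; apply/seteqP; split => //.
- exact: subset_trans BU UA.
- exact: subset_trans UA AB.
Qed.
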